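(* Let $1<p<\infty$, $a,b\in SO(\mathbb{R}_+)$ and $\alpha\in SOS(\mathbb{R}_+)$. The functional operator $aI-bW_\alpha$ is invertible on $L^p(\mathbb{R}_+)$ if and only if either \[ \text{(1)}\quad \inf_{t\in\mathbb{R}_+}|a(t)|>0\ \text{ and }\ \liminf_{t\to s}\Big(|a(t)|-|b(t)|(\alpha'(t))^{-1/p}\Big)>0\ \ (s\in\{0,\infty\}), \] or \[ \text{(2)}\quad \inf_{t\in\mathbb{R}_+}|b(t)|>0\ \text{ and }\ \limsup_{t\to s}\Big(|a(t)|-|b(t)|(\alpha'(t))^{-1/p}\Big)<0\ \ (s\in\{0,\infty\}). \] If (1) holds, then $(aI-bW_\alpha)^{-1}=\sum_{n=0}^\infty(a^{-1}bW_\alpha)^na^{-1}I$. If (2) holds, then $(aI-bW_\alpha)^{-1}=-W_\alpha^{-1}\sum_{n=0}^\infty(b^{-1}aW_\alpha^{-1})^nb^{-1}I$.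
   Context: $\mathbb{R}_+=(0,\infty)$. $C_b(\mathbb{R}_+)$: bounded continuous complex functions on $\mathbb{R}_+$. $\operatorname{osc}(f,[\lambda r,r]):=\sup\{|f(t)-f(\tau)|:t,\tau\in[\lambda r,r]\}$. $SO(\mathbb{R}_+)$ is the set of $f\in C_b(\mathbb{R}_+)$ with $\lim_{r\to s}\operatorname{osc}(f,[\lambda r,r])=0$ for $s\in\{0,\infty\}$ and each (equivalently, some) $\lambda\in(0,1)$. $SOS(\mathbb{R}_+)$ is the set of orientation-preserving diffeomorphisms $\alpha$ of $\mathbb{R}_+$ onto itself having no fixed points in $\mathbb{R}_+$ (only fixed points $0,\infty$) such that $\log\alpha'\in C_b(\mathbb{R}_+)$ and $\alpha'\in SO(\mathbb{R}_+)$. $W_\alpha f:=f\circ\alpha$, a bounded invertible operator on $L^p(\mathbb{R}_+)$. *)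

(* Defs.v *)
From HB Require Import structures.
From mathcomp Require Import all_boot all_order all_algebra.
From mathcomp Require Import all_classical all_reals all_analysis.
From mathcomp Require Export complex.
Import Order.TTheory GRing.Theory Num.Theory numFieldTopology.Exports.

Set Implicit Arguments.
Unset Strict Implicit.
Unset Printing Implicit Defensive.

Local Open Scope ring_scope.
Local Open Scope classical_set_scope.

Section Defs.
Variable R : realType.

Definition Rplus : set R := [set t : R | 0 < t].

Definition cmod (z : R[i]) : R := @Normc.normc R z.

Definition Cb (f : R -> R[i]) : Prop :=
  {within Rplus, continuous (fun t => complex.Re (f t))} /\
  {within Rplus, continuous (fun t => complex.Im (f t))} /\
  exists M : R, forall t, 0 < t -> cmod (f t) <= M.

Definition osc (f : R -> R[i]) (lam r : R) : R :=
  sup [set cmod (f x.1 - f x.2) | x in `[lam * r, r] `*` `[lam * r, r]].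

Definition SO (f : R -> R[i]) : Prop :=
  Cb f /\
  forall lam : R, 0 < lam -> lam < 1 ->
    (osc f lam r @[r --> (0:R)^'+] --> 0) /\
    (osc f lam r @[r --> +oo] --> 0).

Definition C1 (f : R -> R) : Prop :=
  (forall t, 0 < t -> derivable f t 1) /\
  {within Rplus, continuous (derive1 f)}.

Definition SOS (alpha : R -> R) : Prop :=
  (forall t, 0 < t -> 0 < alpha t) /\
  (exists beta : R -> R,
      (forall s, 0 < s -> 0 < beta s /\ alpha (beta s) = s) /\
      (forall t, 0 < t -> beta (alpha t) = t) /\ C1 beta) /\
  C1 alpha /\
  (forall s t, 0 < s -> s < t -> alpha s < alpha t) /\
  (forall t, 0 < t -> alpha t != t) /\
  (forall t, 0 < t -> 0 < (derive1 alpha) t) /\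
  {within Rplus, continuous (fun t => ln ((derive1 alpha) t))} /\
  (exists M : R, forall t, 0 < t -> `|ln ((derive1 alpha) t)| <= M) /\
  SO (fun t => real_complex R ((derive1 alpha) t)).

Definition cmeas (f : R -> R[i]) : Prop :=
  measurable_fun Rplus (fun t => complex.Re (f t)) /\
  measurable_fun Rplus (fun t => complex.Im (f t)).

Definition Lpnorm (p : R) (f : R -> R[i]) : \bar R :=
  ((\int[lebesgue_measure]_(x in Rplus) ((cmod (f x)) `^ p)%:E) `^ p^-1)%E.

Definition inLp (p : R) (f : R -> R[i]) : Prop :=
  cmeas f /\ (Lpnorm p f < +oo)%E.

Definition ae_zero (f : R -> R[i]) : Prop :=
  {ae lebesgue_measure, forall x, Rplus x -> f x = 0}.

(* A (function-level) operator acting on L^p(R_+) is an invertible bounded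
   operator: it maps L^p into L^p boundedly, is injective on L^p (modulo
   null functions), and is onto L^p with a bounded inverse. *)
Definition invertible_Lp (p : R) (A : (R -> R[i]) -> (R -> R[i])) : Prop :=
  (forall f, inLp p f -> inLp p (A f)) /\
  (exists c : R, forall f, inLp p f -> (Lpnorm p (A f) <= c%:E * Lpnorm p f)%E) /\
  (forall f, inLp p f -> ae_zero (A f) -> ae_zero f) /\
  (exists c : R, forall g, inLp p g ->
     exists f, inLp p f /\ ae_zero (fun t => A f t - g t) /\
               (Lpnorm p f <= c%:E * Lpnorm p g)%E).

Definition Wop (alpha : R -> R) (f : R -> R[i]) : R -> R[i] :=
  fun t => f (alpha t).

Definition Aop (a b : R -> R[i]) (alpha : R -> R) (f : R -> R[i]) : R -> R[i] :=
  fun t => a t * f t - b t * Wop alpha f t.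

Definition T1 (a b : R -> R[i]) (alpha : R -> R) (f : R -> R[i]) : R -> R[i] :=
  fun t => (a t)^-1 * b t * Wop alpha f t.

Definition S1 (a b : R -> R[i]) (alpha : R -> R) (N : nat) (g : R -> R[i]) : R -> R[i] :=
  fun t => \sum_(n < N) iter n (T1 a b alpha) (fun u => (a u)^-1 * g u) t.

(* b^{-1} a W_alpha^{-1}, where beta = alpha^{-1} so that W_alpha^{-1} = W_beta *)
Definition T2 (a b : R -> R[i]) (beta : R -> R) (f : R -> R[i]) : R -> R[i] :=
  fun t => (b t)^-1 * a t * Wop beta f t.

Definition S2 (a b : R -> R[i]) (beta : R -> R) (N : nat) (g : R -> R[i]) : R -> R[i] :=
  fun t => - Wop beta
             (fun u => \sum_(n < N) iter n (T2 a b beta) (fun v => (b v)^-1 * g v) u) t.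

Definition Dfun (p : R) (a b : R -> R[i]) (alpha : R -> R) (t : R) : R :=
  cmod (a t) - cmod (b t) * ((derive1 alpha) t) `^ (- p^-1).

Definition cond1 (p : R) (a b : R -> R[i]) (alpha : R -> R) : Prop :=
  0 < inf [set cmod (a t) | t in Rplus] /\
  (0 < limf_einf (fun t : R => (Dfun p a b alpha t)%:E) ((0:R)^'+))%E /\
  (0 < limf_einf (fun t : R => (Dfun p a b alpha t)%:E) (@pinfty_nbhs R))%E.

Definition cond2 (p : R) (a b : R -> R[i]) (alpha : R -> R) : Prop :=
  0 < inf [set cmod (b t) | t in Rplus] /\
  (limf_esup (fun t : R => (Dfun p a b alpha t)%:E) ((0:R)^'+) < 0)%E /\
  (limf_esup (fun t : R => (Dfun p a b alpha t)%:E) (@pinfty_nbhs R) < 0)%E.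

(* (S N) converges to the inverse of A in the operator norm of L^p *)
Definition neumann_conv (p : R) (A : (R -> R[i]) -> (R -> R[i]))
    (S : nat -> (R -> R[i]) -> (R -> R[i])) : Prop :=
  forall eps : R, 0 < eps -> exists N0 : nat, forall N : nat, (N0 <= N)%N ->
    forall g f, inLp p g -> inLp p f -> ae_zero (fun t => A f t - g t) ->
      (Lpnorm p (fun t => (S N g t - f t)%R) <= eps%:E * Lpnorm p g)%E.

End Defs.

(* Main.v *)
(** Sufficiency.  Under (1) the operator [(b/a) W_alpha] contracts [L^p] near the
    fixed points [0] and [oo].  As [alpha] has no fixed point in between, every
    orbit crosses the remaining compact interval in a bounded number of steps, so a
    bounded monotone weight gives an equivalent norm in which the operator
    contracts everywhere, and the Neumann series converges.  Case (2) is the same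
    argument for [alpha^-1].

    Necessity.  Testing [aI - b W_alpha] on functions that live on the orbit of a
    wandering interval shrinking to a point [t] gives bounds, uniform in [t], for the
    bidiagonal recurrence with coefficients [a(alpha^k t)] and [w(alpha^k t)],
    [w = b (alpha')^(-1/p)], and for its transpose.  By slow oscillation the first
    bound keeps [D = |a| - |w|] away from zero near both ends, so that [D] has a
    constant sign at each end.  If the signs at the two ends differ, one of the recurrence
    and its transpose has a decaying solution on a whole orbit, against
    injectivity or surjectivity.  If they agree, a zero of [a] (when [D > 0]) or of
    [b] (when [D < 0]) would produce such a solution on a half-orbit. *)

Require Import Defs.
From HB Require Import structures.
From mathcomp Require Import all_boot all_order all_algebra.
From mathcomp Require Import all_classical all_reals all_analysis.
From mathcomp Require Import complex.
From mathcomp Require Import measurable_realfun lra ring.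
Import Order.TTheory GRing.Theory Num.Theory numFieldTopology.Exports.
Import numFieldNormedType.Exports.

Set Implicit Arguments.
Unset Strict Implicit.
Unset Printing Implicit Defensive.

Local Open Scope classical_set_scope.
Local Open Scope ring_scope.

(** * Weighted push-forward and complex-valued functions *)

(** The obstacle in the necessity part is that a single orbit is a null set, so a recurrence along
    it says nothing about classes of functions. Functions are therefore normalised along orbits by
    the [p]-th root of the Jacobian: this turns [W_alpha] into an unweighted shift and puts all of
    [alpha'] into the coefficient [w]. Functions that are constant in this normalisation on each
    image of an interval realise arbitrary finite sequences, with an [l^p] norm times a power of the
    length of the interval, and that length cancels from every estimate.

    The transposed recurrence is reached without adjoint operators: a solution for a single delta is
    paired with the test sequence by summation by parts. This bounds a supremum by an [l^1] sum,
    with no conjugate exponent, which is enough because the test sequences leave only two truncation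
    terms, both small by geometric decay.

    In the sufficiency part the estimates are made for [p]-th powers of norms, and the Neumann
    series is summed pointwise almost everywhere under an integrable geometric majorant, in place of
    completeness of [L^p] and Minkowski's inequality. *)

Section weighted_pushforward.
Context d d' (X : measurableType d) (Y : measurableType d') (R : realType).
Variables (mu : {measure set X -> \bar R}) (g : X -> Y) (w : X -> R).
Hypotheses (mg : measurable_fun setT g) (mw : measurable_fun setT w).
Hypothesis w0 : forall x, 0 <= w x.
Local Open Scope ereal_scope.

(* The unused arguments let the [isMeasure] instance below find its side
   conditions. *)
Definition wpush (_ : measurable_fun setT g) (_ : measurable_fun setT w)
    (_ : forall x, (0 <= w x)%R) (E : set Y) : \bar R :=
  \int[mu]_x ((w x)%:E * (\1_E (g x))%:E).

Let m : set Y -> \bar R := wpush mg mw w0.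

Let mint (E : set Y) : measurable E ->
  measurable_fun setT (fun x => (w x)%:E * (\1_E (g x))%:E).
Proof.
move=> mE; apply: emeasurable_funM; first exact/measurable_EFinP.
by apply/measurable_EFinP; apply: measurableT_comp.
Qed.

Let m0 : m set0 = 0.
Proof.
by rewrite /m /wpush integral0_eq// => x _; rewrite indic0 mule0.
Qed.

Let m_ge0 E : 0 <= m E.
Proof. by apply: integral_ge0 => x _; rewrite -EFinM lee_fin mulr_ge0. Qed.

Let m_sigma_additive : semi_sigma_additive m.
Proof.
move=> F mF tF mUF.
rewrite [X in _ --> X](_ : _ =
  \int[mu]_x (\sum_(n <oo) ((w x)%:E * (\1_(F n) (g x))%:E))); last first.
  apply: eq_integral => x _; rewrite nneseriesZl; last by move=> i _; rewrite lee_fin.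
  congr (_ * _); apply/esym/cvg_lim => //.
  (* For fixed [x], the map from [E] to [\1_E (g x)] is the Dirac measure at [g x], whose countable
     additivity is known. *)
  have := @measure_semi_sigma_additive _ _ _ (\d_(g x) : {measure set Y -> \bar R}) F mF tF mUF.
  by rewrite /dirac.
rewrite integral_nneseries//.
- apply: is_cvg_nneseries => n _ _; exact: m_ge0.
- by move=> n; exact: mint.
- by move=> n x _; rewrite -EFinM lee_fin mulr_ge0.
Qed.

HB.instance Definition _ := isMeasure.Build _ _ R
  (wpush mg mw w0) m0 m_ge0 m_sigma_additive.

Import HBNNSimple.

Let integral_wpush_nnsfun (f : {nnsfun Y >-> R}) :
  \int[wpush mg mw w0]_y (f y)%:E = \int[mu]_x ((f (g x))%:E * (w x)%:E).
Proof.
under [in LHS]eq_integral do rewrite fimfunE -fsumEFin//.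
rewrite ge0_integral_fsum//; last 2 first.
  - by move=> r; exact/measurable_EFinP/measurableT_comp.
  - by move=> r z _; rewrite EFinM nnfun_muleindic_ge0.
transitivity (\int[mu]_x (\sum_(r \in range f)
    (r%:E * ((w x)%:E * (\1_(f @^-1` [set r]) (g x))%:E)))); last first.
  apply: eq_integral => x _; rewrite fimfunE -fsumEFin// muleC ge0_mule_fsumr//; last first.
    by move=> r; rewrite EFinM nnfun_muleindic_ge0.
  by apply: eq_fsbigr => r _; rewrite EFinM muleCA.
rewrite ge0_integral_fsum//; last 2 first.
  - by move=> r; apply: measurable_funeM; exact: mint.
  - by move=> r x _; rewrite muleCA mule_ge0 ?lee_fin//; exact: nnfun_muleindic_ge0.
apply: eq_fsbigr => r _.
rewrite (integralZl_indic _ (fun r => f @^-1` [set r]))//; last first.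
  by move=> r0; rewrite preimage_nnfun0.
rewrite /= integral_indic// setIT.
(* A negative [r] is not a value of [f], so its level set is empty and both sides vanish. *)
have [r0|r0] := leP 0%R r.
  rewrite ge0_integralZl//.
  - exact: mint.
  - by move=> x _; rewrite -EFinM lee_fin mulr_ge0.
rewrite preimage_nnfun0// measure0 mule0 integral0_eq// => x _.
by rewrite indic0 !mule0.
Qed.

Lemma integral_wpush (f : Y -> \bar R) : (forall z, 0 <= f z) ->
  measurable_fun setT f ->
  \int[wpush mg mw w0]_y f y = \int[mu]_x (f (g x) * (w x)%:E).
Proof.
move=> f0 mf.
pose f_ := nnsfun_approx measurableT mf.
transitivity (\int[wpush mg mw w0]_z (lim ((f_ n z)%:E @[n --> \oo]))).
  by apply/eq_integral => z _; apply/esym/cvg_lim => //=; exact: cvg_nnsfun_approx.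
rewrite monotone_convergence//; last 3 first.
  by move=> n; exact/measurable_EFinP.
  by move=> n z _; rewrite lee_fin.
  by move=> z _ a b ab; rewrite lee_fin; exact/lefP/nd_nnsfun_approx.
rewrite (_ : (fun _ => _) =
    (fun n => \int[mu]_x ((f_ n (g x))%:E * (w x)%:E))); last first.
  by apply/funext => n; exact: integral_wpush_nnsfun.
rewrite -monotone_convergence//; last 3 first.
- move=> n; apply: emeasurable_funM; last exact/measurable_EFinP.
  by apply/measurable_EFinP; apply: measurableT_comp.
- by move=> n x _; rewrite mule_ge0 ?lee_fin.
- move=> x _ a b ab; apply: lee_pmul; rewrite ?lee_fin//.
  exact/lefP/nd_nnsfun_approx.
apply: eq_integral => x _; apply/cvg_lim => //.
by apply: cvgeZr => //; exact: cvg_nnsfun_approx.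
Qed.

End weighted_pushforward.

Section complex_modulus.
Context {R : realType}.
Implicit Types x y z : R[i].

Lemma cmod_ge0 z : 0 <= cmod z.
Proof. by case: z => a b; rewrite /cmod /= sqrtr_ge0. Qed.

Lemma cmod0 : cmod (0 : R[i]) = 0.
Proof. exact: Normc.normc0. Qed.

Lemma cmod1 : cmod (1 : R[i]) = 1.
Proof. exact: Normc.normc1. Qed.

Lemma cmod_eq0 z : cmod z = 0 -> z = 0.
Proof. exact: Normc.eq0_normc. Qed.

Lemma cmod_gt0 z : z != 0 -> 0 < cmod z.
Proof.
by move=> z0; rewrite lt_neqAle cmod_ge0 andbT eq_sym; apply: contra z0 => /eqP/cmod_eq0->.
Qed.

Lemma cmodM x y : cmod (x * y) = cmod x * cmod y.
Proof. exact: Normc.normcM. Qed.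

Lemma cmodV x : cmod x^-1 = (cmod x)^-1.
Proof. exact: Normc.normcV. Qed.

Lemma cmodN x : cmod (- x) = cmod x.
Proof. exact: normcN. Qed.

Lemma ler_cmodD x y : cmod (x + y) <= cmod x + cmod y.
Proof. exact: le_normcD. Qed.

Lemma ler_cmodB x y : cmod (x - y) <= cmod x + cmod y.
Proof. by rewrite -(cmodN y); exact: ler_cmodD. Qed.

Lemma cmod_distC x y : cmod (x - y) = cmod (y - x).
Proof. by rewrite -cmodN opprB. Qed.

Lemma ler_cmod_dist x y : `|cmod x - cmod y| <= cmod (x - y).
Proof.
rewrite ler_norml; apply/andP; split.
  rewrite lerBrDr addrC lerBlDr addrC cmod_distC.
  by have := ler_cmodD (y - x) x; rewrite subrK addrC.
by rewrite lerBlDr; have := ler_cmodD (x - y) y; rewrite subrK.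
Qed.

Lemma cmod_real (x : R) : cmod (real_complex R x) = `|x|.
Proof. by rewrite /cmod /= expr0n addr0 sqrtr_sqr. Qed.

Lemma ler_Re_cmod z : `|complex.Re z| <= cmod z.
Proof.
by case: z => a b; rewrite /cmod /= -sqrtr_sqr ler_wsqrtr// lerDl sqr_ge0.
Qed.

Lemma ler_Im_cmod z : `|complex.Im z| <= cmod z.
Proof.
by case: z => a b; rewrite /cmod /= -sqrtr_sqr ler_wsqrtr// lerDr sqr_ge0.
Qed.

Lemma cmodE z : cmod z = Num.sqrt (complex.Re z ^+ 2 + complex.Im z ^+ 2).
Proof. by case: z. Qed.

Lemma ler_cmod_sum (I : Type) (s : seq I) (F : I -> R[i]) :
  cmod (\sum_(i <- s) F i) <= \sum_(i <- s) cmod (F i).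
Proof.
elim/big_ind2 : _ => [|x1 x2 y1 y2 h1 h2|//]; first by rewrite cmod0.
by apply: le_trans (ler_cmodD _ _) _; exact: lerD.
Qed.

End complex_modulus.

Section complex_measurability.
Context {R : realType}.
Local Notation mR := (measurableTypeR R).
Implicit Types f g : R -> R[i].

Lemma open_Rplus : open (@Rplus R).
Proof.
have -> : @Rplus R = `]0, +oo[%classic by apply/seteqP; split => x /=; rewrite in_itv/= ?andbT.
exact: interval_open.
Qed.

Lemma measurable_Rplus : measurable (@Rplus R).
Proof. by apply: open_measurable; exact: open_Rplus. Qed.

Lemma measurable_within (f : R -> R) : {within @Rplus R, continuous f} ->
  measurable_fun (@Rplus R) f.
Proof. by move=> cf; apply: subspace_continuous_measurable_fun => //; exact: measurable_Rplus. Qed.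

Lemma cmeas_cmod f : cmeas f -> measurable_fun (@Rplus R) (fun t => cmod (f t)).
Proof.
move=> [mr mi]; rewrite (_ : (fun t => _) =
  (fun t => (complex.Re (f t) ^+ 2 + complex.Im (f t) ^+ 2) `^ 2^-1)).
  apply: (measurableT_comp (measurable_powR _)).
  by apply: measurable_funD; apply: measurable_funX.
by apply/funext => t; rewrite cmodE powR12_sqrt// addr_ge0// sqr_ge0.
Qed.

Lemma cmeas_powR f p : cmeas f ->
  measurable_fun (@Rplus R) (fun t => cmod (f t) `^ p).
Proof. by move=> mf; apply: (measurableT_comp (measurable_powR _)); exact: cmeas_cmod. Qed.

Lemma cmeasD f g : cmeas f -> cmeas g -> cmeas (fun t => f t + g t).
Proof.
by move=> [fr fi] [gr gi]; split; under eq_fun do rewrite raddfD; apply: measurable_funD.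
Qed.

Lemma cmeasN f : cmeas f -> cmeas (fun t => - f t).
Proof.
by move=> [fr fi]; split; under eq_fun do rewrite raddfN; apply: measurable_funN.
Qed.

Lemma cmeasB f g : cmeas f -> cmeas g -> cmeas (fun t => f t - g t).
Proof. by move=> mf mg; apply: cmeasD => //; apply: cmeasN. Qed.

Lemma cmeasM f g : cmeas f -> cmeas g -> cmeas (fun t => f t * g t).
Proof.
move=> [fr fi] [gr gi]; split.
  rewrite (_ : (fun t => _) = (fun t => complex.Re (f t) * complex.Re (g t)
     - complex.Im (f t) * complex.Im (g t))).
    by apply: measurable_funB; apply: measurable_funM.
  by apply/funext => t; case: (f t) (g t) => [a b] [c d].
rewrite (_ : (fun t => _) = (fun t => complex.Re (f t) * complex.Im (g t)
     + complex.Im (f t) * complex.Re (g t))).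
  by apply: measurable_funD; apply: measurable_funM.
by apply/funext => t; case: (f t) (g t) => [a b] [c d].
Qed.

Lemma cmeas_real (f : R -> R) : measurable_fun (@Rplus R) f ->
  cmeas (fun t => real_complex R (f t)).
Proof. by move=> mf; split => //=; exact: measurable_cst. Qed.

Lemma cmeas_cst (z : R[i]) : cmeas (fun _ => z).
Proof. by split; exact: measurable_cst. Qed.

Lemma cmeasV f : cmeas f -> cmeas (fun t => (f t)^-1).
Proof.
move=> mf; have [fr fi] := mf.
pose n2 t := (complex.Re (f t) ^+ 2 + complex.Im (f t) ^+ 2) `^ (-1).
have mn : measurable_fun (@Rplus R) n2.
  apply: (measurableT_comp (measurable_powR _)).
  by apply: measurable_funD; apply: measurable_funX.
have n2E t : n2 t = (complex.Re (f t) ^+ 2 + complex.Im (f t) ^+ 2)^-1.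
  by rewrite /n2 powR_inv1// addr_ge0// sqr_ge0.
split.
  rewrite (_ : (fun t => _) = (fun t => complex.Re (f t) * n2 t)); first exact: measurable_funM.
  by apply/funext => t; rewrite n2E; case: (f t).
rewrite (_ : (fun t => _) = (fun t => - (complex.Im (f t) * n2 t))).
  by apply: measurable_funN; exact: measurable_funM.
by apply/funext => t; rewrite n2E; case: (f t).
Qed.

Lemma cmeas_comp f (g : R -> R) : cmeas f -> measurable_fun (@Rplus R) g ->
  (forall t, 0 < t -> 0 < g t) -> cmeas (fun t => f (g t)).
Proof.
move=> [fr fi] mg g0; have sub : g @` (@Rplus R) `<=` @Rplus R by move=> _ [t /= t0 <-]; exact: g0.
split.
  exact: (measurable_comp measurable_Rplus sub fr).
exact: (measurable_comp measurable_Rplus sub fi).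
Qed.

Lemma cmeas_sum (I : Type) (s : seq I) (F : I -> R -> R[i]) :
  (forall i, cmeas (F i)) -> cmeas (fun t => \sum_(i <- s) F i t).
Proof.
move=> mF; elim: s => [|i s ih].
  by under eq_fun do rewrite big_nil; exact: cmeas_cst.
by under eq_fun do rewrite big_cons; exact: cmeasD.
Qed.

Lemma Cb_cmeas f : Cb f -> cmeas f.
Proof. by move=> [cr [ci _]]; split; exact: measurable_within. Qed.

End complex_measurability.

(** * Change of variables under a shift *)

Definition change_of_var {R : realType} (g j : R -> R) :=
  forall phi : R -> \bar R, measurable_fun (@Rplus R) phi ->
    (forall x, Rplus x -> (0 <= phi x)%E) ->
    (\int[lebesgue_measure]_(x in @Rplus R) (phi (g x) * (j x)%:E) =
     \int[lebesgue_measure]_(x in @Rplus R) phi x)%E.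

(** A map of the half-line together with its Jacobian. The interface is shared by [alpha], its
    inverse and its iterates, and is stable under composition. *)
Record weighted_shift {R : realType} (g j : R -> R) : Prop := WeightedShift {
  shift_gt0 : forall t, 0 < t -> 0 < g t ;
  shift_meas : measurable_fun (@Rplus R) g ;
  shift_jac_gt0 : forall t, 0 < t -> 0 < j t ;
  shift_jac_meas : measurable_fun (@Rplus R) j ;
  shift_cv : change_of_var g j }.

Section SOS_change_of_variable.
Context {R : realType}.
Variable alpha : R -> R.
Hypothesis Salpha : SOS alpha.
Local Notation mu := (@lebesgue_measure R).
Local Notation mR := (measurableTypeR R).

Lemma SOS_gt0 t : 0 < t -> 0 < alpha t.
Proof. by case: Salpha => h _; exact: h. Qed.

Lemma SOS_inv : exists beta : R -> R,
  (forall s, 0 < s -> 0 < beta s /\ alpha (beta s) = s) /\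
  (forall t, 0 < t -> beta (alpha t) = t).
Proof. by case: Salpha => _ [[b [h1 [h2 _]]] _]; exists b. Qed.

Lemma SOS_derivable t : 0 < t -> derivable alpha t 1.
Proof. by case: Salpha => _ [_ [[h _] _]]; exact: h. Qed.

Lemma continuous_Rplus (f : R -> R) : {within @Rplus R, continuous f} ->
  forall t, 0 < t -> {for t, continuous f}.
Proof.
rewrite continuous_open_subspace; last exact: open_Rplus.
by move=> h t t0; apply: h; rewrite inE.
Qed.

Lemma within_Rplus (f : R -> R) : (forall t, 0 < t -> {for t, continuous f}) ->
  {within @Rplus R, continuous f}.
Proof.
rewrite continuous_open_subspace; last exact: open_Rplus.
by move=> h t; rewrite inE; exact: h.
Qed.

Lemma SOS_cont t : 0 < t -> {for t, continuous alpha}.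
Proof. by move=> t0; apply: differentiable_continuous; apply/derivable1_diffP/SOS_derivable. Qed.

Lemma SOS_dcont t : 0 < t -> {for t, continuous (derive1 alpha)}.
Proof. by case: Salpha => _ [_ [[_ h] _]]; exact: continuous_Rplus. Qed.

Lemma SOS_homo s t : 0 < s -> s < t -> alpha s < alpha t.
Proof. by case: Salpha => _ [_ [_ [h _]]]; exact: h. Qed.

Lemma SOS_neq t : 0 < t -> alpha t != t.
Proof. by case: Salpha => _ [_ [_ [_ [h _]]]]; exact: h. Qed.

Lemma SOS_d_gt0 t : 0 < t -> 0 < (derive1 alpha) t.
Proof. by case: Salpha => _ [_ [_ [_ [_ [h _]]]]]; exact: h. Qed.

Lemma SOS_mono s t : 0 < s -> 0 < t -> (alpha s < alpha t) = (s < t).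
Proof.
move=> s0 t0; have [st|ts|->] := ltgtP s t; last by rewrite ltxx.
  by rewrite SOS_homo.
by apply/negbTE; rewrite -leNgt ltW// SOS_homo.
Qed.

Lemma SOS_cc u v : 0 < u -> {within `[u, v], continuous alpha}.
Proof.
move=> u0; apply: derivable_within_continuous => x; rewrite in_itv/= => /andP[ux _].
by apply: SOS_derivable; exact: lt_le_trans ux.
Qed.

Lemma SOS_meas : measurable_fun (@Rplus R) alpha.
Proof. by apply: measurable_within; apply: within_Rplus; exact: SOS_cont. Qed.

Lemma SOS_dmeas : measurable_fun (@Rplus R) (derive1 alpha).
Proof. by apply: measurable_within; apply: within_Rplus; exact: SOS_dcont. Qed.

(** [wpush] lives on the whole line, so map and weight are extended by zero; the zero weight
    discards the points off the half-line. *)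
Let g0 : mR -> mR := alpha \_ (@Rplus R).
Let w0 : mR -> R := (derive1 alpha) \_ (@Rplus R).

Let g0E t : 0 < t -> g0 t = alpha t.
Proof. by move=> t0; rewrite /g0 patchE mem_set. Qed.

Let w0E t : 0 < t -> w0 t = derive1 alpha t.
Proof. by move=> t0; rewrite /w0 patchE mem_set. Qed.

Let w0N t : ~ 0 < t -> w0 t = 0.
Proof. by move=> t0; rewrite /w0 patchE memNset. Qed.

Let mg0 : measurable_fun setT g0.
Proof. by apply/(measurable_restrictT _ measurable_Rplus); exact: SOS_meas. Qed.

Let mw0 : measurable_fun setT w0.
Proof. by apply/(measurable_restrictT _ measurable_Rplus); exact: SOS_dmeas. Qed.

Let w0_ge0 x : 0 <= w0 x.
Proof.
have [x0|x0] := pselect (0 < x); last by rewrite w0N.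
by rewrite w0E// ltW// SOS_d_gt0.
Qed.

Local Notation m := (wpush mu mg0 mw0 w0_ge0).

Let m_Rplus E : m (E `&` @Rplus R) = m E.
Proof.
apply: eq_integral => x _; have [x0|x0] := pselect (0 < x); last by rewrite w0N// !mul0e.
congr (_ * (_)%:E)%E; rewrite !indicE; congr (nat_of_bool _)%:R.
apply/idP/idP; rewrite !inE; first by case.
by split => //; rewrite /Rplus/= g0E// SOS_gt0.
Qed.

(** The fundamental theorem of calculus on the preimage, the interval from [beta u] to [beta v]. *)
Let m_oc u v : 0 < u -> u < v -> m `]u, v] = (v - u)%:E.
Proof.
move=> u_gt0 uv; have v_gt0 := lt_trans u_gt0 uv.
have [beta [b1 b2]] := SOS_inv.
have [bu bue] := b1 _ u_gt0; have [bv bve] := b1 _ v_gt0.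
have buv : beta u < beta v by rewrite -SOS_mono// bue bve.
transitivity (\int[mu]_(x in `[beta u, beta v]) (derive1 alpha x)%:E)%E; last first.
  rewrite (continuous_FTC2 buv (F := alpha)) ?bue ?bve ?EFinB//.
  - apply: (@continuous_subspaceW _ _ _ (@Rplus R)).
      by move=> x /=; rewrite in_itv/= /Rplus/= => /andP[h _]; exact: lt_le_trans h.
    by apply: within_Rplus; exact: SOS_dcont.
  - split.
    + by move=> x; rewrite in_itv/= => /andP[h _]; apply: SOS_derivable; exact: lt_trans h.
    + by apply: cvg_at_right_filter; exact: SOS_cont.
    + by apply: cvg_at_left_filter; exact: SOS_cont.
rewrite -integral_itv_obnd_cbnd; last first.
  apply/measurable_EFinP; apply: measurable_funS SOS_dmeas; first exact: measurable_Rplus.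
  by move=> x /=; rewrite in_itv/= /Rplus/= => /andP[h _]; exact: lt_trans h.
rewrite [RHS]integral_mkcond; apply: eq_integral => x _.
rewrite patchE; have [x0|x0] := pselect (0 < x); last first.
  rewrite w0N// mul0e memNset//= in_itv/= => /andP[h _].
  by apply: x0; exact: lt_trans h.
rewrite w0E// g0E// indicE -{1}bue -{1}bve.
have -> : (alpha x \in `]alpha (beta u), alpha (beta v)]%classic) = (x \in `]beta u, beta v]%classic).
  apply/idP/idP; rewrite !inE/= !in_itv/=.
    by rewrite SOS_mono// !leNgt SOS_mono.
  by rewrite SOS_mono// !leNgt SOS_mono.
by case: ifP; rewrite ?mule1 ?mule0.
Qed.

(** At the end [0] the derivative need not extend, so the interval is exhausted from inside by
    intervals to which [m_oc] applies. *)
Let m_0c v : 0 < v -> m `]0, v] = v%:E.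
Proof.
(* The index [n.+2] keeps the left endpoint strictly below [v] already for [n = 0]. *)
move=> v0; pose F n : set R := `]v / n.+2%:R, v]%classic.
have mF n : measurable (F n) by exact: measurable_itv.
have UF : \bigcup_n F n = `]0, v]%classic.
  apply/seteqP; rewrite /F; split => [x [n _]|x] /=; rewrite !in_itv/= => /andP[h xv].
    by rewrite xv andbT; apply: lt_trans h; rewrite divr_gt0.
  exists (Num.truncn (v / x)) => //=; rewrite in_itv/= xv andbT.
  rewrite ltr_pdivrMr// mulrC -ltr_pdivrMr//.
  apply: lt_trans (Num.Theory.truncnS_gt _) _; by rewrite ltr_nat.
have mUF : measurable (\bigcup_n F n) by rewrite UF; exact: measurable_itv.
have hF : {homo F : n k / (n <= k)%N >-> (n <= k)%O}.
  move=> n k nk; apply/subsetPset; rewrite /F => x /=; rewrite !in_itv/= => /andP[h ->]; rewrite andbT.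
  by apply: le_lt_trans h; rewrite ler_pM2l// lef_pV2 ?posrE// ler_nat !ltnS.
have c1 := @nondecreasing_cvg_mu _ _ _ m F mF mUF hF.
have c2 := @nondecreasing_cvg_mu _ _ _ mu F mF mUF hF.
have e : m \o F = mu \o F.
  apply/funext => n /=; have l : v / n.+2%:R < v.
    by rewrite ltr_pdivrMr// ltr_pMr// ltr1n.
  by rewrite m_oc ?divr_gt0// lebesgue_measure_itv/= lte_fin l.
rewrite e in c1; rewrite -UF (cvg_unique _ c1 c2) ?UF//.
by have := @lebesgue_measure_itv R `]0, v]; rewrite /= lte_fin v0 sube0.
Qed.

(** Both measures agree on half-open intervals, which are stable under intersection and generate the
    Borel sets, and they are finite on the exhausting sequence [I]; uniqueness of measures
    concludes. *)
Let m_mu E : measurable E -> m E = mrestr mu measurable_Rplus E.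
Proof.
pose I k : set R := `](- k%:R), k%:R]%classic.
apply: (@measure_unique _ R mR (@ocitv R) I _ _ _ _
  m (mrestr mu measurable_Rplus)) => //.
- exact: ocitvI.
- by move=> k; exact: is_ocitv.
- exact: bigcup_itvT.
- move=> _ [[u v] /= _ <-]; rewrite -m_Rplus /mrestr.
  have -> : (`]u, v]%classic : set R) `&` @Rplus R = `]Num.max u 0, v]%classic.
    by apply/seteqP; split => x /=; rewrite !in_itv/= /Rplus/= gt_max;
      [move=> [/andP[-> ->] ->]|move=> /andP[/andP[-> ->] ->]].
  have [uv|uv] := ltP (Num.max u 0) v; last by rewrite set_itv_ge ?measure0// bnd_simp -leNgt.
  rewrite lebesgue_measure_itv/= lte_fin uv.
  have [u0|u0] := leP u 0.
    by rewrite m_0c ?oppr0 ?adde0//; move: uv; rewrite gt_max => /andP[].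
  by rewrite m_oc ?EFinB//; move: uv; rewrite gt_max => /andP[].
- move=> k /=; rewrite -m_Rplus.
  rewrite /I; have -> : (`](- k%:R), k%:R]%classic : set R) `&` @Rplus R = `]0, k%:R]%classic.
    apply/seteqP; split => x /=; rewrite !in_itv/= /Rplus/=.
      by move=> [/andP[_ ->] ->].
    move=> /andP[x0 xk]; split=> //; rewrite xk andbT.
    by apply: le_lt_trans x0; rewrite oppr_le0.
  case: k => [|k]; first by rewrite set_itv_ge ?measure0// bnd_simp ltxx.
  by rewrite m_0c// ltry.
Qed.

Lemma SOS_shift : weighted_shift alpha (derive1 alpha).
Proof.
split; [exact: SOS_gt0|exact: SOS_meas|exact: SOS_d_gt0|exact: SOS_dmeas|].
move=> phi mphi phi0.
have -> : (\int[mu]_(x in @Rplus R) phi x = \int[m]_(x in @Rplus R) phi x)%E.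
  apply/esym/eq_measure_integral => A mA AR.
  by rewrite [LHS]m_mu// /mrestr (setIidl AR).
rewrite [RHS]integral_mkcond integral_wpush; last 2 first.
- by move=> z; rewrite patchE; case: ifPn => // /set_mem; exact: phi0.
- by apply/(measurable_restrictT _ measurable_Rplus).
rewrite [LHS]integral_mkcond; apply: eq_integral => x _.
rewrite patchE; have [x0|x0] := pselect (0 < x); last by rewrite w0N// mule0 memNset.
by rewrite mem_set// w0E// patchE g0E// mem_set// /Rplus /= SOS_gt0.
Qed.

End SOS_change_of_variable.

(** * The p-th power of the norm of L^p *)

Section almost_everywhere_Rplus.
Context {R : realType}.
Local Notation mu := (@lebesgue_measure R).

Definition ae_Rplus (P : R -> Prop) : Prop :=
  {ae lebesgue_measure, forall x : R, Rplus x -> P x}.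

Lemma aeW_Rplus (P : R -> Prop) : (forall x, 0 < x -> P x) -> ae_Rplus P.
Proof. by move=> h; apply: aeW => x; exact: h. Qed.

Lemma aeS (P Q : R -> Prop) : (forall x, 0 < x -> P x -> Q x) ->
  ae_Rplus P -> ae_Rplus Q.
Proof.
move=> PQ; apply: (@filterS _ _ (ae_filter_ringOfSetsType mu)) => x h x0.
exact: PQ x0 (h x0).
Qed.

Lemma aeS2 (P Q S : R -> Prop) : (forall x, 0 < x -> P x -> Q x -> S x) ->
  ae_Rplus P -> ae_Rplus Q -> ae_Rplus S.
Proof.
move=> PQ; apply: (@filterS2 _ _ (ae_filter_ringOfSetsType mu)) => x h h' x0.
exact: PQ x0 (h x0) (h' x0).
Qed.

Lemma ae_Rplus_foralln (P : nat -> R -> Prop) : (forall n, ae_Rplus (P n)) ->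
  ae_Rplus (fun x => forall n, P n x).
Proof.
move=> h; have := @ae_foralln _ _ _ mu _ h.
by apply: (@filterS _ _ (ae_filter_ringOfSetsType mu)) => x hx x0 n; exact: hx.
Qed.

End almost_everywhere_Rplus.

Section Lp_basics.
Context {R : realType}.
Variable p : R.
Hypothesis p_gt1 : 1 < p.
Local Notation mu := (@lebesgue_measure R).
Implicit Types f g : R -> R[i].

Let p_gt0 : 0 < p. Proof. exact: lt_trans p_gt1. Qed.
Let p_ge0 : 0 <= p. Proof. exact: ltW. Qed.
Let p_neq0 : p != 0. Proof. by rewrite gt_eqF. Qed.

Definition wnpow (h : R -> R) f : \bar R :=
  (\int[lebesgue_measure]_(x in @Rplus R) (h x * cmod (f x) `^ p)%:E)%E.

Definition npow f : \bar R :=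
  (\int[lebesgue_measure]_(x in @Rplus R) (cmod (f x) `^ p)%:E)%E.

Lemma npow_ge0 f : (0 <= npow f)%E.
Proof. by apply: integral_ge0 => x _; rewrite lee_fin powR_ge0. Qed.

Lemma LpnormE f : Lpnorm p f = (npow f `^ p^-1)%E.
Proof. by []. Qed.

Lemma Lpnorm_powR f : (Lpnorm p f `^ p)%E = npow f.
Proof. by rewrite LpnormE -poweRrM mulVf// poweRe1// npow_ge0. Qed.

Lemma inLpE f : inLp p f <-> cmeas f /\ (npow f < +oo)%E.
Proof.
split=> -[mf h]; split => //; last by rewrite LpnormE; exact: poweR_lty.
by apply: (@lty_poweRy _ _ p^-1); rewrite ?invr_eq0.
Qed.

Lemma Lpnorm_le f g (K : R) : 0 <= K -> (npow f <= K%:E * npow g)%E ->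
  (Lpnorm p f <= (K `^ p^-1)%:E * Lpnorm p g)%E.
Proof.
move=> K0 h; rewrite !LpnormE -poweR_EFin -poweRM ?lee_fin ?npow_ge0//.
apply: gt0_ler_poweR => //; rewrite ?invr_ge0// in_itv/= leey andbT ?npow_ge0//.
by rewrite mule_ge0 ?npow_ge0 ?lee_fin.
Qed.

Lemma npow_le_Lpnorm f g (c : R) : 0 <= c ->
  (Lpnorm p f <= c%:E * Lpnorm p g)%E -> (npow f <= (c `^ p)%:E * npow g)%E.
Proof.
move=> c0 h; rewrite -!Lpnorm_powR -poweR_EFin -poweRM ?lee_fin ?poweR_ge0//.
apply: gt0_ler_poweR => //; rewrite in_itv/= leey andbT ?poweR_ge0//.
by rewrite mule_ge0 ?poweR_ge0 ?lee_fin.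
Qed.

Lemma Lpnorm_ge0 f : (0 <= Lpnorm p f)%E.
Proof. exact: poweR_ge0. Qed.

Lemma measurable_npow f : cmeas f ->
  measurable_fun (@Rplus R) (fun x => (cmod (f x) `^ p)%:E).
Proof. by move=> mf; apply/measurable_EFinP; exact: cmeas_powR. Qed.

Lemma measurable_wnpow (h : R -> R) f : measurable_fun (@Rplus R) h -> cmeas f ->
  measurable_fun (@Rplus R) (fun x => (h x * cmod (f x) `^ p)%:E).
Proof.
by move=> mh mf; apply/measurable_EFinP; apply: measurable_funM => //; exact: cmeas_powR.
Qed.

Lemma npow_ae_le f g (C : R) : cmeas f -> cmeas g -> 0 <= C ->
  ae_Rplus (fun x => cmod (f x) `^ p <= C * cmod (g x) `^ p) ->
  (npow f <= C%:E * npow g)%E.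
Proof.
move=> mf mg C0 fg; rewrite /npow -ge0_integralZl_EFin//; last 3 first.
- exact: measurable_Rplus.
- by move=> x _; rewrite lee_fin powR_ge0.
- exact: measurable_npow.
apply: ae_ge0_le_integral.
- exact: measurable_Rplus.
- by move=> x _; rewrite lee_fin powR_ge0.
- exact: measurable_npow.
- by move=> x _; rewrite mule_ge0// lee_fin// powR_ge0.
- by apply: measurable_funeM; exact: measurable_npow.
- by apply: (aeS _ fg) => x x0; rewrite -EFinM lee_fin.
Qed.

Lemma npow_le f g (C : R) : cmeas f -> cmeas g -> 0 <= C ->
  (forall x, 0 < x -> cmod (f x) <= C * cmod (g x)) ->
  (npow f <= (C `^ p)%:E * npow g)%E.
Proof.
move=> mf mg C0 fg; apply: npow_ae_le => //; first exact: powR_ge0.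
apply: aeW_Rplus => x x0; rewrite -powRM ?cmod_ge0//.
by apply: ge0_ler_powR => //; rewrite ?nnegrE ?cmod_ge0 ?mulr_ge0 ?cmod_ge0//; exact: fg.
Qed.

Lemma npow_ae_eq f g : cmeas f -> cmeas g -> ae_Rplus (fun x => f x = g x) ->
  npow f = npow g.
Proof.
move=> mf mg fg; apply: ge0_ae_eq_integral.
- exact: measurable_Rplus.
- exact: measurable_npow.
- exact: measurable_npow.
- by move=> x _; rewrite lee_fin powR_ge0.
- by move=> x _; rewrite lee_fin powR_ge0.
- by apply: (aeS _ fg) => x x0 ->.
Qed.

Lemma npow0_ae_zero f : cmeas f -> npow f = 0%E -> ae_zero f.
Proof.
move=> mf f0; have := measurable_npow mf.
move=> /(ae_eq_integral_abs mu measurable_Rplus)[+ _].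
under eq_integral do rewrite gee0_abs ?lee_fin ?powR_ge0//.
move=> /(_ f0); apply: aeS => x x0; rewrite /cst /= => -[] /eqP.
by rewrite powR_eq0 => /andP[/eqP/cmod_eq0].
Qed.

Lemma ae_zeroB_eq f g : ae_zero (fun t => f t - g t) <-> ae_Rplus (fun x => f x = g x).
Proof.
split; apply: aeS => x x0 h; last by rewrite h subrr.
by apply/eqP; rewrite -subr_eq0 h.
Qed.

(** The sum is at most twice the larger term. This crude substitute for Minkowski's inequality is
    enough, since only finiteness and boundedness are drawn from it. *)
Lemma powRD_le (x y : R) : 0 <= x -> 0 <= y ->
  (x + y) `^ p <= 2 `^ p * (x `^ p + y `^ p).
Proof.
move=> x0 y0; have [xy|yx] := leP x y.
  apply: (@le_trans _ _ ((2 * y) `^ p)).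
    by apply: ge0_ler_powR; rewrite ?nnegrE ?addr_ge0 ?mulr_ge0//; lra.
  by rewrite powRM// ler_wpM2l ?powR_ge0// lerDr powR_ge0.
apply: (@le_trans _ _ ((2 * x) `^ p)).
  by apply: ge0_ler_powR; rewrite ?nnegrE ?addr_ge0 ?mulr_ge0//; lra.
by rewrite powRM// ler_wpM2l ?powR_ge0// lerDl powR_ge0.
Qed.

Lemma npowD f g : cmeas f -> cmeas g ->
  (npow (fun t => (f t + g t)%R) <= (2 `^ p)%:E * (npow f + npow g))%E.
Proof.
move=> mf mg; rewrite /npow -ge0_integralD//; last 5 first.
- exact: measurable_Rplus.
- by move=> x _; rewrite lee_fin powR_ge0.
- exact: measurable_npow.
- by move=> x _; rewrite lee_fin powR_ge0.
- exact: measurable_npow.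
rewrite -ge0_integralZl_EFin ?powR_ge0//; last 3 first.
- exact: measurable_Rplus.
- by move=> x _; rewrite adde_ge0// lee_fin powR_ge0.
- by apply: emeasurable_funD; exact: measurable_npow.
apply: ge0_le_integral.
- exact: measurable_Rplus.
- by move=> x _; rewrite lee_fin powR_ge0.
- by apply: measurable_npow; exact: cmeasD.
- by apply: measurable_funeM; apply: emeasurable_funD; exact: measurable_npow.
- move=> x _; rewrite -EFinD -EFinM lee_fin.
  apply: le_trans (powRD_le (cmod_ge0 _) (cmod_ge0 _)).
  apply: ge0_ler_powR; rewrite ?nnegrE ?addr_ge0 ?cmod_ge0//; exact: ler_cmodD.
Qed.

Lemma npowN f : npow (fun t => - f t) = npow f.
Proof. by apply: eq_integral => x _; rewrite cmodN. Qed.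

Lemma npowD_lty f g : cmeas f -> cmeas g -> (npow f < +oo)%E -> (npow g < +oo)%E ->
  (npow (fun t => (f t + g t)%R) < +oo)%E.
Proof.
move=> mf mg f1 g1; apply: le_lt_trans (npowD mf mg) _.
by apply: lte_mul_pinfty => //; exact: lte_add_pinfty.
Qed.

Lemma npowZ_lty f g (C : R) : 0 <= C -> (npow f <= C%:E * npow g)%E ->
  (npow g < +oo)%E -> (npow f < +oo)%E.
Proof.
move=> C0 h g1; apply: le_lt_trans h _.
by rewrite lte_mul_pinfty ?lee_fin.
Qed.

Section with_shift.
Variables g j : R -> R.
Hypothesis sgj : weighted_shift g j.

(** Change of variables applied to the indicator of an exceptional null set [N]: the integral of
    [\1_N (g x) * j x] vanishes, and positivity of [j] makes the preimage of [N] null. *)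
Lemma ae_shift (P : R -> Prop) :
  ae_Rplus P -> ae_Rplus (fun x => P (g x)).
Proof.
move=> [N [mN N0 PN]].
have mphi : measurable_fun (@Rplus R) (fun x => (\1_N x)%:E : \bar R).
  by apply/measurable_EFinP; exact: measurable_indic.
have := shift_cv sgj mphi.
have -> : (\int[mu]_(x in @Rplus R) (\1_N x)%:E = 0)%E.
  rewrite integral_indic//; last exact: measurable_Rplus.
  by apply: (subset_measure0 _ _ _ N0) => //; apply: measurableI => //; exact: measurable_Rplus.
move=> h; have {h} : (\int[mu]_(x in @Rplus R) `|(\1_N (g x))%:E * (j x)%:E| = 0)%E.
  rewrite -[RHS]h; last by move=> x _; rewrite lee_fin.
  apply: eq_integral => x; rewrite inE => x0; rewrite gee0_abs// -EFinM lee_fin mulr_ge0//.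
  by rewrite ltW// (shift_jac_gt0 sgj).
have mm : measurable_fun (@Rplus R) (fun x => ((\1_N (g x))%:E * (j x)%:E)%E).
  apply: emeasurable_funM; last by apply/measurable_EFinP; exact: (shift_jac_meas sgj).
  have sub : g @` (@Rplus R) `<=` @Rplus R by move=> _ [t /= t0 <-]; exact: (shift_gt0 sgj).
  exact: (measurable_comp measurable_Rplus sub mphi (shift_meas sgj)).
move=> /(ae_eq_integral_abs mu measurable_Rplus mm); apply: aeS => x x0.
rewrite /cst /= -EFinM => -[] /eqP.
rewrite mulf_eq0 (gt_eqF (shift_jac_gt0 sgj x0)) orbF indicE pnatr_eq0 eqb0 => /negP gN.
apply: contrapT => nP; apply: gN; rewrite inE; apply: PN => /= /(_ (shift_gt0 sgj x0)).
exact: nP.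
Qed.

Lemma wnpow_shift (h : R -> R) f : measurable_fun (@Rplus R) h -> (forall t, 0 < t -> 0 <= h t) ->
  cmeas f ->
  (\int[lebesgue_measure]_(x in @Rplus R) (h (g x) * cmod (f (g x)) `^ p * j x)%:E)%E
  = wnpow h f.
Proof.
move=> mh h0 mf; rewrite /wnpow -(shift_cv sgj (measurable_wnpow mh mf)).
  by apply: eq_integral => x _; rewrite -EFinM.
by move=> x x0; rewrite lee_fin mulr_ge0 ?powR_ge0// h0.
Qed.

Lemma npow_shift f : cmeas f ->
  (\int[lebesgue_measure]_(x in @Rplus R) (cmod (f (g x)) `^ p * j x)%:E)%E = npow f.
Proof.
move=> mf; rewrite /npow -(shift_cv sgj (measurable_npow mf)).
  by apply: eq_integral => x _; rewrite -EFinM.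
by move=> x x0; rewrite lee_fin powR_ge0.
Qed.

Lemma cmeas_shift f : cmeas f -> cmeas (fun t => f (g t)).
Proof. by move=> mf; apply: cmeas_comp => //; [exact: (shift_meas sgj)|exact: (shift_gt0 sgj)]. Qed.

Lemma npow_shift_le (m : R) f : 0 < m -> (forall t, 0 < t -> m <= j t) -> cmeas f ->
  (npow (fun t => f (g t)) <= m^-1%:E * npow f)%E.
Proof.
move=> m0 mj mf; rewrite -(npow_shift mf) -ge0_integralZl_EFin//; last 4 first.
- exact: measurable_Rplus.
- by move=> x x0; rewrite lee_fin mulr_ge0 ?powR_ge0// ltW// (shift_jac_gt0 sgj).
- apply/measurable_EFinP; apply: measurable_funM; last exact: (shift_jac_meas sgj).
  by apply: cmeas_powR; exact: cmeas_shift.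
- by rewrite invr_ge0 ltW.
apply: ge0_le_integral.
- exact: measurable_Rplus.
- by move=> x _; rewrite lee_fin powR_ge0.
- by apply: measurable_npow; exact: cmeas_shift.
- apply: measurable_funeM; apply/measurable_EFinP; apply: measurable_funM.
    by apply: cmeas_powR; exact: cmeas_shift.
  exact: (shift_jac_meas sgj).
- move=> x x0; rewrite -EFinM lee_fin mulrC -mulrA ler_peMr ?powR_ge0//.
  by rewrite ler_pdivlMr// mul1r mj.
Qed.

End with_shift.

End Lp_basics.

(** * Neumann series of weighted composition operators *)

Section complex_sequences.
Context {R : realType}.

(** Componentwise, so that uniqueness of limits and measurability of a limit reduce to the real
    case. *)
Definition ccvg (u : nat -> R[i]) (z : R[i]) : Prop :=
  (complex.Re (u n) @[n --> \oo] --> complex.Re z) /\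
  (complex.Im (u n) @[n --> \oo] --> complex.Im z).

Lemma complex_eqP (x y : R[i]) : complex.Re x = complex.Re y ->
  complex.Im x = complex.Im y -> x = y.
Proof. by case: x y => [a b] [c d] /= -> ->. Qed.

Lemma ccvg_unique u y z : ccvg u y -> ccvg u z -> y = z.
Proof.
move=> [r1 i1] [r2 i2]; apply: complex_eqP.
  exact: (cvg_unique _ r1 r2).
exact: (cvg_unique _ i1 i2).
Qed.

Lemma ccvg_affine u z a b : ccvg u z -> ccvg (fun n => a + b * u n) (a + b * z).
Proof.
have ReM (x y : R[i]) : complex.Re (x * y) =
  complex.Re x * complex.Re y - complex.Im x * complex.Im y by case: x y => [? ?] [? ?].
have ImM (x y : R[i]) : complex.Im (x * y) =
  complex.Re x * complex.Im y + complex.Im x * complex.Re y by case: x y => [? ?] [? ?].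
move=> [r i]; split.
  under eq_fun do rewrite raddfD /= ReM; rewrite raddfD /= ReM.
  by apply: cvgD; [exact: cvg_cst|apply: cvgB; apply: cvgMr].
under eq_fun do rewrite raddfD /= ImM; rewrite raddfD /= ImM.
by apply: cvgD; [exact: cvg_cst|apply: cvgD; apply: cvgMr].
Qed.

Lemma ccvgS u z : ccvg u z -> ccvg (fun n => u n.+1) z.
Proof.
by move=> [r i]; split; [rewrite -(cvg_shiftS (fun n => complex.Re (u n))) in r|
  rewrite -(cvg_shiftS (fun n => complex.Im (u n))) in i].
Qed.

Let real_geo (v : nat -> R) (B r : R) : 0 <= B -> 0 < r -> r < 1 ->
  (forall n, `|v n| <= B * r ^+ n) ->
  exists2 l, series v n @[n --> \oo] --> l & `|l| <= B / (1 - r).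
Proof.
move=> B0 r0 r1 vB.
have nr : `|r| < 1 by rewrite ger0_norm// ltW.
have cv : cvgn (series v).
  apply: normed_cvg; apply: (series_le_cvg _ _ vB) => [n|n|]; first by [].
    by rewrite mulr_ge0// exprn_ge0// ltW.
  exact: (@is_cvg_geometric_series _ B r).
exists (limn (series v)) => //.
have nle n : `|series v n| <= B / (1 - r).
  apply: le_trans (geometric_le_lim n B0 r0 nr).
  rewrite /series /=; apply: le_trans (ler_norm_sum _ _ _) _.
  exact: ler_sum.
have h : `|series v n| @[n --> \oo] --> `|limn (series v)| by exact: cvg_norm cv.
rewrite -(cvg_lim _ h)//.
by apply: limr_le; [apply/cvg_ex; eexists; exact: h|apply: nearW].
Qed.

Lemma csum_geometric (u : nat -> R[i]) (B r : R) : 0 <= B -> 0 < r -> r < 1 ->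
  (forall n, cmod (u n) <= B * r ^+ n) ->
  exists2 z, ccvg (fun N => \sum_(n < N) u n) z & cmod z <= 2 * (B / (1 - r)).
Proof.
move=> B0 r0 r1 uB.
have [x rx xB] := real_geo B0 r0 r1 (fun n => le_trans (ler_Re_cmod (u n)) (uB n)).
have [y ry yB] := real_geo B0 r0 r1 (fun n => le_trans (ler_Im_cmod (u n)) (uB n)).
exists (x +i* y)%C.
  split => /=.
    by under eq_fun do rewrite raddf_sum/= -(big_mkord xpredT (fun i => complex.Re (u i))).
  by under eq_fun do rewrite raddf_sum/= -(big_mkord xpredT (fun i => complex.Im (u i))).
rewrite mulr_natl mulr2n; apply: le_trans (lerD xB yB).
have -> : (x +i* y)%C = real_complex R x + 'i%C * real_complex R y.
  by apply: complex_eqP => /=; ring.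
apply: le_trans (ler_cmodD _ _) _; rewrite cmodM !cmod_real.
by rewrite {1}/cmod /= expr0n/= add0r expr1n sqrtr1 mul1r.
Qed.

End complex_sequences.

Section Neumann.
Context {R : realType}.
Variable p : R.
Hypothesis p_gt1 : 1 < p.
Local Notation mu := (@lebesgue_measure R).
Implicit Types f : R -> R[i].
Variables g j : R -> R.
Hypothesis sgj : weighted_shift g j.
Variables (c : R -> R[i]) (w : R -> R) (m H q : R).
Hypotheses (mc : cmeas c) (mw : measurable_fun (@Rplus R) w).
Hypotheses (m_gt0 : 0 < m) (wm : forall t, 0 < t -> m <= w t).
Hypothesis (wH : forall t, 0 < t -> w t <= H).
Hypotheses (q_gt0 : 0 < q) (q_lt1 : q < 1).
Hypothesis contraction : forall t, 0 < t ->
  cmod (c t) `^ p * w t <= q * (w (g t) * j t).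

Definition wcomp f : R -> R[i] := fun t => c t * f (g t).

Let p_gt0 : 0 < p. Proof. exact: lt_trans p_gt1. Qed.
Let p_ge0 : 0 <= p. Proof. exact: ltW. Qed.
Let p_neq0 : p != 0. Proof. by rewrite gt_eqF. Qed.
Let w_gt0 t : 0 < t -> 0 < w t.
Proof. by move=> t0; apply: lt_le_trans m_gt0 _; exact: wm. Qed.

Let H_ge0 : 0 <= H.
Proof. by apply: le_trans (wH ltr01); apply: ltW; apply: w_gt0. Qed.

Let wn := wnpow p w.

Let wn_ge0 f : (0 <= wn f)%E.
Proof.
by apply: integral_ge0 => x x0; rewrite lee_fin mulr_ge0 ?powR_ge0// ltW// w_gt0.
Qed.

Let npow_wn f : cmeas f -> (npow p f <= m^-1%:E * wn f)%E.
Proof.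
move=> mf; rewrite /npow /wn /wnpow -ge0_integralZl_EFin//; last 4 first.
- exact: measurable_Rplus.
- by move=> x x0; rewrite lee_fin mulr_ge0 ?powR_ge0// ltW// w_gt0.
- exact: measurable_wnpow.
- by rewrite invr_ge0 ltW.
apply: ge0_le_integral.
- exact: measurable_Rplus.
- by move=> x _; rewrite lee_fin powR_ge0.
- exact: measurable_npow.
- by apply: measurable_funeM; exact: measurable_wnpow.
- move=> x x0; rewrite -EFinM lee_fin mulrA ler_peMl ?powR_ge0//.
  by rewrite mulrC ler_pdivlMr// mul1r wm.
Qed.

Let wn_npow f : cmeas f -> (wn f <= H%:E * npow p f)%E.
Proof.
move=> mf; rewrite /npow /wn /wnpow -ge0_integralZl_EFin//; last 3 first.
- exact: measurable_Rplus.
- by move=> x x0; rewrite lee_fin powR_ge0.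
- exact: measurable_npow.
apply: ge0_le_integral.
- exact: measurable_Rplus.
- by move=> x x0; rewrite lee_fin mulr_ge0 ?powR_ge0// ltW// w_gt0.
- exact: measurable_wnpow.
- by apply: measurable_funeM; exact: measurable_npow.
- by move=> x x0; rewrite -EFinM lee_fin ler_wpM2r ?powR_ge0// wH.
Qed.

Lemma cmeas_wcomp f : cmeas f -> cmeas (wcomp f).
Proof. by move=> mf; apply: cmeasM => //; apply: (cmeas_shift sgj). Qed.

Lemma cmeas_iter n f : cmeas f -> cmeas (iter n wcomp f).
Proof. by move=> mf; elim: n => //= n; exact: cmeas_wcomp. Qed.

(** After the substitution [g] in the right-hand integral, this is [contraction] integrated
    pointwise against [cmod (f (g x)) ^ p]. *)
Let wn_wcomp f : cmeas f -> (wn (wcomp f) <= q%:E * wn f)%E.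
Proof.
move=> mf; have w_ge0 t : 0 < t -> 0 <= w t by move=> t0; exact/ltW/w_gt0.
rewrite /wn -(wnpow_shift p sgj mw w_ge0 mf).
have mm : measurable_fun (@Rplus R) (fun x => (w (g x) * cmod (f (g x)) `^ p * j x)%:E).
  apply/measurable_EFinP; apply: measurable_funM; last exact: (shift_jac_meas sgj).
  apply: measurable_funM; last by apply: cmeas_powR; exact: (cmeas_shift sgj).
  have sub : g @` (@Rplus R) `<=` @Rplus R by move=> _ [t /= t0 <-]; exact: (shift_gt0 sgj).
  exact: (measurable_comp measurable_Rplus sub mw (shift_meas sgj)).
have pos x : 0 < x -> 0 <= w (g x) * cmod (f (g x)) `^ p * j x.
  move=> x0; rewrite !mulr_ge0 ?powR_ge0//; last exact/ltW/(shift_jac_gt0 sgj).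
  exact/ltW/w_gt0/(shift_gt0 sgj).
rewrite -ge0_integralZl_EFin//; last 2 first.
- exact: measurable_Rplus.
- exact: ltW.
apply: ge0_le_integral.
- exact: measurable_Rplus.
- by move=> x x0; rewrite lee_fin mulr_ge0 ?powR_ge0// ltW// w_gt0.
- by apply: measurable_wnpow => //; exact: cmeas_wcomp.
- exact: measurable_funeM.
- move=> x x0; rewrite -EFinM lee_fin /wcomp cmodM powRM ?cmod_ge0//.
  rewrite mulrCA mulrA (_ : q * _ = q * (w (g x) * j x) * cmod (f (g x)) `^ p); last by ring.
  by rewrite ler_wpM2r ?powR_ge0// contraction.
Qed.

Let wn_iter n f : cmeas f -> (wn (iter n wcomp f) <= (q ^+ n)%:E * wn f)%E.
Proof.
move=> mf; elim: n => [|n ih]; first by rewrite expr0 mul1e.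
rewrite iterS; apply: le_trans (wn_wcomp (cmeas_iter n mf)) _.
by rewrite exprS EFinM -muleA lee_pmul2l// lte_fin.
Qed.

Lemma npow_iter n f : cmeas f ->
  (npow p (iter n wcomp f) <= (H / m * q ^+ n)%:E * npow p f)%E.
Proof.
move=> mf; apply: le_trans (npow_wn (cmeas_iter n mf)) _.
rewrite (_ : H / m * q ^+ n = m^-1 * (q ^+ n * H)); last by ring.
rewrite EFinM -muleA lee_pmul2l ?lte_fin ?invr_gt0//.
apply: le_trans (wn_iter n mf) _.
by rewrite EFinM -muleA lee_pmul2l ?lte_fin ?exprn_gt0// wn_npow.
Qed.

(** A fixed point satisfies [wn f <= q * wn f], and a finite nonnegative number with this property
    is zero because [q < 1]. *)
Lemma wcomp_injective f : cmeas f -> (npow p f < +oo)%E ->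
  ae_Rplus (fun t => f t = wcomp f t) -> ae_zero f.
Proof.
move=> mf f1 fT.
have wnf : wn f \is a fin_num.
  rewrite ge0_fin_numE//; apply: le_lt_trans (wn_npow mf) _.
  exact: lte_mul_pinfty.
have e : wn f = wn (wcomp f).
  apply: ge0_ae_eq_integral.
  - exact: measurable_Rplus.
  - exact: measurable_wnpow.
  - by apply: measurable_wnpow => //; exact: cmeas_wcomp.
  - by move=> x x0; rewrite lee_fin mulr_ge0 ?powR_ge0// ltW// w_gt0.
  - by move=> x x0; rewrite lee_fin mulr_ge0 ?powR_ge0// ltW// w_gt0.
  - by apply: (aeS _ fT) => x x0 {1}->.
have h : fine (wn f) <= q * fine (wn f).
  by rewrite -lee_fin EFinM (fineK wnf) {1}e; exact: wn_wcomp.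
have f0 : fine (wn f) = 0.
  apply/eqP; rewrite eq_le fine_ge0// andbT.
  have : (1 - q) * fine (wn f) <= 0 by rewrite mulrBl mul1r subr_le0.
  by rewrite pmulr_rle0// subr_gt0.
apply: (npow0_ae_zero (p := p)) => //; apply/eqP; rewrite eq_le npow_ge0 andbT.
by apply: le_trans (npow_wn mf) _; rewrite -(fineK wnf) f0 mule0.
Qed.

(** The Neumann series is summed pointwise. The majorant [G], which sums the weighted [p]-th powers
    of the terms magnified by [r ^- n], has a finite integral; wherever [G] is finite the terms
    decay geometrically, and the modulus of the sum is controlled by [G]. *)
Lemma wcomp_solve : exists2 C, 0 <= C & forall h, cmeas h -> (npow p h < +oo)%E ->
  exists f, [/\ cmeas f, (npow p f <= C%:E * npow p h)%E &
    ae_Rplus (fun t => f t - wcomp f t = h t)].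
Proof.
(* Splitting [q] as [z * r] with both factors below 1 serves two purposes: [z] makes the integrals
   of the magnified terms summable, and [rho], the [p]-th root of [r], is the pointwise decay
   rate. *)
pose r := (q + 1) / 2.
have := midf_lt q_lt1; rewrite -/r => -[qr r1].
have r0 : 0 < r by exact: lt_trans qr.
pose z := q / r; have z0 : 0 < z by rewrite divr_gt0.
have z1 : z < 1 by rewrite ltr_pdivrMr// mul1r.
pose rho := r `^ p^-1.
have rho0 : 0 < rho by rewrite powR_gt0.
have rhop : rho `^ p = r by rewrite -powRrM mulVf// powRr1// ltW.
have rho1 : rho < 1.
  rewrite ltNge; apply/negP => h; have := @ge0_ler_powR R p p_ge0 1 rho.
  rewrite !nnegrE ler01 (ltW rho0) powR1 rhop => /(_ isT isT h).
  by rewrite leNgt r1.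
(* The factor [2 / (1 - rho)] is the bound of [csum_geometric]; the division by [m] removes the
   weight. *)
pose C0 := (2 / (1 - rho)) `^ p / m.
have C0_gt0 : 0 < C0 by rewrite divr_gt0 ?powR_gt0// divr_gt0// subr_gt0.
have C0_ge0 := ltW C0_gt0.
exists (C0 * (H / (1 - z))).
  by rewrite mulr_ge0// divr_ge0// subr_ge0 ltW.
move=> h mh h1.
pose u n := iter n wcomp h.
have mu_ n : cmeas (u n) by exact: cmeas_iter.
pose Gn n t : \bar R := ((r ^+ n)^-1 * (w t * cmod (u n t) `^ p))%:E.
have Gn_ge0 n t : 0 < t -> (0 <= Gn n t)%E.
  by move=> t0; rewrite lee_fin !mulr_ge0 ?powR_ge0 ?invr_ge0 ?exprn_ge0// ltW// w_gt0.
have mGn n : measurable_fun (@Rplus R) (Gn n).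
  apply/measurable_EFinP; apply: measurable_funM; first exact: measurable_cst.
  by apply/measurable_EFinP; exact: measurable_wnpow.
pose G t : \bar R := (\sum_(0 <= n <oo) Gn n t)%E.
have G_ge0 t : 0 < t -> (0 <= G t)%E.
  by move=> t0; apply: nneseries_ge0 => n _ _; exact: Gn_ge0.
have mG : measurable_fun (@Rplus R) G.
  rewrite (_ : G = fun t => (\sum_(0 <= n <oo | n \in xpredT) Gn n t)%E).
    by apply: ge0_emeasurable_sum => // k x x0 _; exact: Gn_ge0.
  by apply/funext => t; exact: eq_eseriesl.
have wnh : wn h \is a fin_num.
  rewrite ge0_fin_numE//; apply: le_lt_trans (wn_npow mh) _.
  exact: lte_mul_pinfty.
have intG : (\int[mu]_(t in @Rplus R) G t <= (fine (wn h) / (1 - z))%:E)%E.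
  rewrite /G integral_nneseries//; last 1 first.
  - exact: measurable_Rplus.
  apply: lime_le.
    by apply: is_cvg_nneseries => n _ _; apply: integral_ge0 => t t0; exact: Gn_ge0.
  apply: nearW => N.
  have zn : `|z| < 1 by rewrite ger0_norm// ltW.
  apply: (@le_trans _ _ (series (geometric (fine (wn h)) z) N)%:E); last first.
    by rewrite lee_fin geometric_le_lim ?fine_ge0.
  rewrite /series /= -sumEFin; apply: lee_sum => n _.
  rewrite [leLHS](_ : _ = ((r ^+ n)^-1)%:E * wn (u n))%E; last first.
    rewrite /wn /wnpow -ge0_integralZl_EFin//.
    - exact: measurable_Rplus.
    - by move=> x x0; rewrite lee_fin mulr_ge0 ?powR_ge0// ltW// w_gt0.
    - exact: measurable_wnpow.
    - by rewrite invr_ge0 exprn_ge0// ltW.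
  rewrite (_ : fine (wn h) * z ^+ n = (r ^+ n)^-1 * (q ^+ n * fine (wn h))); last first.
    by rewrite /z expr_div_n; ring.
  rewrite EFinM lee_pmul2l ?lte_fin ?invr_gt0 ?exprn_gt0// EFinM fineK//.
  exact: wn_iter.
have intGoo : (\int[mu]_(t in @Rplus R) G t < +oo)%E.
  by apply: le_lt_trans intG _; exact: ltry.
have aeG : ae_Rplus (fun t => (G t < +oo)%E).
  have iG : mu.-integrable (@Rplus R) G.
    apply/integrableP; split => //.
    under eq_integral => x /set_mem x0 do rewrite gee0_abs ?G_ge0//.
    exact: intGoo.
  have h' := fun mR => integrable_ae mR iG.
  have {h'} := h' measurable_Rplus.
  by apply: aeS => t t0; rewrite ge0_fin_numE// G_ge0.
(* Cutting the partial sums to [0] where [G] is infinite makes them converge at every point of the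
   half-line, so that [f] is measurable as a pointwise limit. *)
pose F N t := if (G t < +oo)%E then \sum_(n < N) u n t else 0.
pose Bd t := (fine (G t) / m) `^ p^-1.
have uBd t n : 0 < t -> (G t < +oo)%E -> cmod (u n t) <= Bd t * rho ^+ n.
  move=> t0 Gt; have Gf : G t \is a fin_num by rewrite ge0_fin_numE// G_ge0.
  have GG : (r ^+ n)^-1 * (w t * cmod (u n t) `^ p) <= fine (G t).
    rewrite -lee_fin fineK//.
    have := @nneseries_lim_ge R (Gn^~ t) xpredT 0%N n.+1.
    move=> /(_ (fun k _ _ => Gn_ge0 k t t0)); apply: le_trans.
    rewrite big_nat_recr//= leeDr// sume_ge0// => k _; exact: Gn_ge0.
  have X : cmod (u n t) `^ p <= (fine (G t) / m) * r ^+ n.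
    rewrite mulrAC ler_pdivlMr// mulrC.
    apply: (@le_trans _ _ (w t * cmod (u n t) `^ p)).
      by rewrite ler_wpM2r ?powR_ge0// wm.
    by rewrite [leRHS]mulrC -ler_pdivrMl ?exprn_gt0.
  have rnE : r ^+ n = (rho ^+ n) `^ p.
    by rewrite -[rho ^+ n]powR_mulrn ?ltW// -powRrM mulrC powRrM rhop powR_mulrn// ltW.
  have BE : fine (G t) / m = Bd t `^ p.
    by rewrite /Bd -powRrM mulVf// powRr1// divr_ge0 ?fine_ge0 ?G_ge0// ltW.
  rewrite leNgt; apply/negP => lt.
  have := gt0_ltr_powR p_gt0 _ _ lt; rewrite !nnegrE cmod_ge0.
  rewrite mulr_ge0 ?powR_ge0 ?exprn_ge0 ?ltW// => /(_ isT isT).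
  by rewrite powRM ?powR_ge0 ?exprn_ge0 ?ltW// -BE -rnE ltNge X.
have /choice[f fP] : forall t, exists y, 0 < t ->
    [/\ ccvg (F ^~ t) y, (G t < +oo)%E -> cmod y <= 2 * (Bd t / (1 - rho)) &
     ~~ (G t < +oo)%E -> y = 0].
  move=> t; have [t0|] := pselect (0 < t); last by exists 0.
  have [Gt|Gt] := boolP (G t < +oo)%E.
    rewrite (_ : F ^~ t = fun N => \sum_(n < N) u n t); last first.
      by apply/funext => N; rewrite /F Gt.
    have [y y1 y2] := csum_geometric (powR_ge0 _ _) rho0 rho1 (fun n => uBd t n t0 Gt).
    by exists y.
  rewrite (_ : F ^~ t = fun=> 0); last by apply/funext => N; rewrite /F (negbTE Gt).
  by exists 0 => _; split => //; split; exact: cvg_cst.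
have mF N : cmeas (F N).
  pose chi t : R[i] := real_complex R (if (G t < +oo)%E then 1 else 0).
  have -> : F N = fun t => chi t * \sum_(n < N) u n t.
    by apply/funext => t; rewrite /F /chi; case: ifP; rewrite ?mul1r ?mul0r.
  apply: cmeasM; last exact: cmeas_sum.
  apply: cmeas_real; apply: measurable_fun_if => //; first exact: measurable_Rplus.
  apply: (measurable_fun_bool true).
  rewrite (_ : _ @^-1` _ = [set x | (G x < +oo)%E]).
    by apply: emeasurable_fun_infty_o => //; exact: measurable_Rplus.
  by apply/seteqP; split => t /=.
have mf : cmeas f.
  split.
    apply: (measurable_fun_cvg (fun N => (mF N).1)) => t t0.
    by have [[]] := fP t t0.
  apply: (measurable_fun_cvg (fun N => (mF N).2)) => t t0.
  by have [[]] := fP t t0.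
exists f; split => //.
  apply: (@le_trans _ _ (C0%:E * \int[mu]_(t in @Rplus R) G t)%E).
    rewrite /npow -ge0_integralZl_EFin//; last exact: measurable_Rplus.
    apply: ge0_le_integral => //.
    - exact: measurable_Rplus.
    - by move=> x _; rewrite lee_fin powR_ge0.
    - exact: measurable_npow.
    - exact: measurable_funeM.
    - move=> t t0; have [_ fB f0] := fP t t0.
      have [Gt|Gt] := boolP (G t < +oo)%E; last first.
        by rewrite f0// cmod0 powR0// mule_ge0// ?lee_fin ?G_ge0.
      have Gf : G t \is a fin_num by rewrite ge0_fin_numE// G_ge0.
      rewrite -(fineK Gf) -EFinM lee_fin.
      have BE : fine (G t) / m = Bd t `^ p.
        by rewrite /Bd -powRrM mulVf// powRr1// divr_ge0 ?fine_ge0 ?G_ge0// ltW.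
      rewrite /C0 mulrAC -mulrA BE -powRM ?powR_ge0//; last first.
        by rewrite divr_ge0// subr_ge0 ltW.
      apply: ge0_ler_powR; rewrite ?nnegrE ?cmod_ge0//.
        by rewrite mulr_ge0 ?powR_ge0// divr_ge0// subr_ge0 ltW.
      by apply: le_trans (fB Gt) _; rewrite le_eqVlt; apply/orP; left; apply/eqP; ring.
  rewrite (EFinM C0) -muleA lee_pmul2l ?lte_fin//.
  apply: le_trans intG _; rewrite mulrC EFinM fineK// mulrC [in leRHS]EFinM -muleA.
  by rewrite lee_pmul2l ?lte_fin ?invr_gt0 ?subr_gt0// wn_npow.
have aeGg := ae_shift sgj aeG.
(* Where [G] is finite both at [t] and at [g t], the limit can be taken in the identity expressing
   partial sum [n.+1] at [t] as [h t] plus [c t] times partial sum [n] at [g t]. *)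
apply: (aeS2 _ aeG aeGg) => t t0 Gt Ggt.
have gt0 := shift_gt0 sgj t0.
have [c1 _ _] := fP t t0; have [c2 _ _] := fP (g t) gt0.
suff -> : f t = h t + c t * f (g t) by rewrite /wcomp addrK.
apply: (ccvg_unique (ccvgS c1)).
have -> : (fun n => F n.+1 t) = (fun n => h t + c t * F n (g t)).
  apply/funext => n; rewrite /F Gt Ggt big_ord_recl /=; congr (_ + _).
  by rewrite mulr_sumr; apply: eq_bigr.
exact: ccvg_affine.
Qed.

(** Applying the [n]-th power of the operator to [h = f - wcomp f] gives a telescoping sum. *)
Lemma partial_sum_wcomp f h : cmeas f -> cmeas h ->
  ae_Rplus (fun t => f t - wcomp f t = h t) -> forall N,
  ae_Rplus (fun t => \sum_(n < N) iter n wcomp h t = f t - iter N wcomp f t).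
Proof.
move=> mf mh fh.
have fhn n : ae_Rplus (fun t => iter n wcomp h t = iter n wcomp f t - iter n.+1 wcomp f t).
  elim: n => [|n ih]; first by apply: (aeS _ fh) => t t0 /= <-.
  apply: (aeS _ (ae_shift sgj ih)) => t t0 ht.
  by rewrite !iterS /wcomp ht mulrBr iterS.
have := ae_Rplus_foralln fhn => /[swap] N; apply: aeS => t t0 ht.
elim: N => [|N ih]; first by rewrite big_ord0 /= subrr.
by rewrite big_ord_recr /= ih ht /=; ring.
Qed.

(** The difference between [f] and the solution built in [wcomp_solve] is a fixed point, hence null,
    so [f] inherits the bound of that solution. *)
Lemma wcomp_bound : exists2 C, 0 <= C & forall f h, cmeas f ->
  (npow p f < +oo)%E -> cmeas h -> (npow p h < +oo)%E ->
  ae_Rplus (fun t => f t - wcomp f t = h t) -> (npow p f <= C%:E * npow p h)%E.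
Proof.
have [C C0 solve] := wcomp_solve; exists C => // f h mf f1 mh h1 fh.
have [f' [mf' f'h f'E]] := solve _ mh h1.
rewrite (npow_ae_eq p mf mf')//; apply/ae_zeroB_eq.
apply: wcomp_injective.
- exact: cmeasB.
- have f'1 := npowZ_lty C0 f'h h1.
  have f'N : (npow p (fun t => (- f' t)%R) < +oo)%E by rewrite npowN.
  exact: (npowD_lty p_gt1 mf (cmeasN mf') f1 f'N).
- apply: (aeS2 _ fh f'E) => t t0 e e'; rewrite /wcomp mulrBr.
  apply/eqP; rewrite -subr_eq0; apply/eqP.
  transitivity ((f t - c t * f (g t)) - (f' t - c t * f' (g t))); first by ring.
  by move: e e'; rewrite /wcomp => -> ->; rewrite subrr.
Qed.

End Neumann.

Lemma iter_wcompN {R : realType} (g : R -> R) (c : R -> R[i]) (f : R -> R[i]) n :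
  iter n (wcomp g c) (fun t => - f t) = (fun t => - iter n (wcomp g c) f t).
Proof. by elim: n => //= n ->; apply/funext => t; rewrite /wcomp mulrN. Qed.

(** * Lower and upper limits at the ends of the half-line *)

Section limits_inferior.
Context {R : realType} {F : set_system R} {FF : ProperFilter F}.
Implicit Types f : R -> R.

Lemma limf_einf_gt0P f :
  (0 < limf_einf (fun t => (f t)%:E) F)%E <->
  exists2 e, 0 < e & \forall t \near F, e <= f t.
Proof.
rewrite limf_einfE; split.
  move=> /ereal_sup_gt[_ [V FV <-]] h.
  have lb t : V t -> (ereal_inf [set (f x)%:E | x in V] <= (f t)%:E)%E.
    by move=> Vt; apply: ereal_inf_lbound; exists t.
  (* A point of [V] excludes the value [+oo] of the infimum. *)
  have [t0 Vt0] := filter_ex FV.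
  case E : (ereal_inf _) h lb => [r||] // h lb.
    exists r; first by rewrite -lte_fin.
    by apply: filterS FV => t Vt; rewrite -lee_fin; exact: lb.
  by have := lb _ Vt0; rewrite leye_eq.
move=> [e e0 Fe]; apply: (@lt_le_trans _ _ e%:E); first by rewrite lte_fin.
apply: (@le_trans _ _ (ereal_inf [set (f t)%:E | t in [set t | e <= f t]])).
  by apply: le_ereal_inf_tmp => _ [t /= et <-]; rewrite lee_fin.
by apply: ereal_sup_ubound; exists [set t | e <= f t].
Qed.

Lemma limf_esup_lt0P f :
  (limf_esup (fun t => (f t)%:E) F < 0)%E <->
  exists2 e, 0 < e & \forall t \near F, f t <= - e.
Proof.
have -> : (limf_esup (fun t => (f t)%:E) F < 0)%E <->
    (0 < limf_einf (fun t => (- f t)%:E) F)%E.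
  have := @limf_einfN R R R (fun t => (f t)%:E) F.
  rewrite [X in limf_einf X](_ : _ = (fun t => (- f t)%:E)); last first.
    by apply/funext => t; rewrite EFinN.
  by move=> ->; rewrite oppe_gt0.
rewrite limf_einf_gt0P; split => -[e e0 Fe]; exists e => //;
  by apply: filterS Fe => t; rewrite lerNr.
Qed.

End limits_inferior.

Section ends.
Context {R : realType}.

Lemma near_right0P (P : R -> Prop) : (\forall t \near (0:R)^'+, P t) ->
  exists2 x, 0 < x & forall t, 0 < t -> t <= x -> P t.
Proof.
move=> [e /= e0 h]; exists (e / 2); first by rewrite divr_gt0.
move=> t t0 te; apply: h => //=; rewrite sub0r normrN gtr0_norm//.
by apply: le_lt_trans te _; rewrite ltr_pdivrMr// ltr_pMr// ltr1n.
Qed.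

Lemma near_pinftyP (P : R -> Prop) : (\forall t \near +oo, P t) ->
  exists2 y, 0 < y & forall t, y <= t -> P t.
Proof.
move=> [M [_ h]]; exists (`|M| + 1); first by rewrite ltr_wpDl.
move=> t Mt; apply: h; apply: lt_le_trans Mt.
by rewrite ltr_pwDr// ler_norm.
Qed.

End ends.

(** * Fixed-point-free maps and the monotone weight *)

Section fixed_point_free.
Context {R : realType}.
Variable g : R -> R.
Hypothesis g_cont : forall t, 0 < t -> {for t, continuous g}.
Hypothesis g_neq : forall t, 0 < t -> g t != t.

Let g_within u v : 0 < u -> {within `[u, v], continuous g}.
Proof.
move=> u0; apply: (@continuous_subspaceW _ _ _ (@Rplus R)).
  by move=> x /=; rewrite in_itv/= /Rplus/= => /andP[h _]; exact: lt_le_trans h.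
exact: within_Rplus.
Qed.

Let gid_within u v : 0 < u -> {within `[u, v], continuous (fun t => g t - t)}.
Proof.
move=> u0; apply: (@continuous_subspaceW _ _ _ (@Rplus R)).
  by move=> x /=; rewrite in_itv/= /Rplus/= => /andP[h _]; exact: lt_le_trans h.
by apply: within_Rplus => t t0; apply: cvgB; [exact: g_cont|exact: cvg_id].
Qed.

(** By the intermediate value theorem, a change of sign of [g t - t] would produce a fixed point. *)
Lemma sign_of_shift :
  (forall t, 0 < t -> t < g t) \/ (forall t, 0 < t -> g t < t).
Proof.
have nochange s t : 0 < s -> s <= t -> (0 < g s - s) = (0 < g t - t).
  move=> s0 st; apply: contrapT => h.
  have t0 := lt_le_trans s0 st.
  have [|c] := @IVT R _ s t 0 st (gid_within s0).
    rewrite ge_min le_max; move: (g_neq s0) (g_neq t0) h; rewrite !subr_gt0 !subr_le0 !subr_ge0.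
    by case: (ltgtP (g s) s) => //= _ _; case: (ltgtP (g t) t) => //= _ _ /(_ erefl).
  rewrite in_itv/= => /andP[sc _] /eqP; rewrite subr_eq0; apply/negP/g_neq.
  exact: lt_le_trans sc.
have all1 t : 0 < t -> (0 < g t - t) = (0 < g 1 - 1).
  by move=> t0; have [h|h] := leP 1 t; [rewrite -(nochange 1 t ltr01 h)|rewrite (nochange t 1 t0 (ltW h))].
have [h|h] := boolP (0 < g 1 - 1).
  by left => t t0; rewrite -subr_gt0 all1.
right => t t0; rewrite lt_neqAle g_neq// -subr_le0 leNgt all1//.
Qed.

(* [w] is monotone in the direction of [g] and grows fast where [v] is not
   below [q], i.e. on a compact interval, which [g] crosses in steps bounded
   below. *)
Lemma contraction_weight (v : R -> R) (q C x y : R) :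
  0 < q -> 0 < C -> 0 < x -> x <= y ->
  (forall t, 0 < t -> v t <= C) -> (forall t, 0 < t -> 0 <= v t) ->
  (forall t, 0 < t -> t <= x -> v t <= q) -> (forall t, y <= t -> v t <= q) ->
  exists w : R -> R, exists H, [/\ measurable_fun setT w,
    forall t, 1 <= w t, forall t, w t <= H &
    forall t, 0 < t -> v t * w t <= q * w (g t)].
Proof.
move=> q0 C0 x0 xy vC v0 vx vy.
have y0 := lt_le_trans x0 xy.
have dcont : {within `[x, y], continuous (fun t => `|g t - t|)}.
  by move=> t; apply: cvg_norm; exact: gid_within.
have [c cxy cmin] := EVT_min xy dcont.
pose d := `|g c - c|.
have d0 : 0 < d.
  rewrite normr_gt0 subr_eq0; apply: g_neq; move: cxy; rewrite in_itv/= => /andP[h _].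
  exact: lt_le_trans h.
have [a axy amin] := EVT_min xy (@g_within x y x0).
have [b bxy bmax] := EVT_max xy (@g_within x y x0).
(* The interval from [x'] to [y'] contains both [[x, y]] and its image under [g], so the truncation
   [cl] fixes [t] and [g t] for every [t] in the middle zone, while it stays bounded and monotone
   everywhere. *)
pose x' := Num.min x (g a); pose y' := Num.max y (g b).
pose cl t := Num.min (Num.max t x') y'.
have cl_homo s t : s <= t -> cl s <= cl t.
  by move=> st; rewrite /cl ge_min !le_min !ge_max !le_max st !lexx !orbT/=; lra.
have x'y' : x' <= y' by rewrite /x' /y' ge_min !le_max xy.
have cl_id t : x' <= t -> t <= y' -> cl t = t.
  by move=> h1 h2; rewrite /cl (max_idPl h1) (min_idPl h2).
have cl_in t : x' <= cl t <= y'.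
  by rewrite /cl le_min le_max lexx orbT x'y' ge_min lexx orbT.
have mid t : x <= t -> t <= y -> cl t = t /\ cl (g t) = g t.
  move=> h1 h2; have txy : t \in `[x, y] by rewrite in_itv/= h1.
  split; apply: cl_id; rewrite /x' /y' ?ge_min ?le_max ?h1 ?h2//.
    by rewrite amin ?orbT.
  by rewrite bmax ?orbT.
(* The slope is such that one step of length at least [d] multiplies the exponential weight by at
   least [1 + C / q], which beats the bound [C] on [v]. *)
pose L := (C / q) / d.
have L0 : 0 <= L by rewrite !divr_ge0// ltW.
have eL : C <= q * expR (L * d).
  rewrite mulrC -ler_pdivrMr//; apply: le_trans (expR_ge1Dx _).
  by rewrite /L divfK ?gt_eqF// lerDr.
have mcl : measurable_fun setT cl.
  by apply: measurable_minr => //; exact: measurable_maxr.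
(* The weight is [expR k] with [k] nondecreasing along [g]; [k] increases or decreases in [t]
   according to the direction in which [g] moves points. *)
have main (k : R -> R) (H : R) : measurable_fun setT k -> (forall t, 0 <= k t <= H) ->
    (forall t, 0 < t -> k t <= k (g t)) ->
    (forall t, x <= t -> t <= y -> k t + L * d <= k (g t)) ->
  exists w : R -> R, exists H, [/\ measurable_fun setT w,
    forall t, 1 <= w t, forall t, w t <= H &
    forall t, 0 < t -> v t * w t <= q * w (g t)].
  move=> mk kH kmono kmid; exists (fun t => expR (k t)), (expR H); split.
  - exact: measurableT_comp.
  - by move=> t; rewrite -expR0 ler_expR; case/andP: (kH t).
  - by move=> t; rewrite ler_expR; case/andP: (kH t).
  - move=> t t0.
    have easy : v t <= q -> v t * expR (k t) <= q * expR (k (g t)).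
      by move=> vq; rewrite ler_pM ?expR_ge0 ?v0 ?ler_expR ?kmono.
    have [tx|xt] := leP t x; first by apply: easy; exact: vx.
    have [yt|ty] := leP y t; first by apply: easy; exact: vy.
    apply: (@le_trans _ _ (C * expR (k t))); first by rewrite ler_wpM2r ?expR_ge0 ?vC.
    apply: (@le_trans _ _ (q * expR (L * d) * expR (k t))).
      by rewrite ler_wpM2r ?expR_ge0.
    rewrite -mulrA -expRD ler_pM2l// ler_expR addrC; apply: kmid; exact: ltW.
have [up|dn] := sign_of_shift.
  apply: (main (fun t => L * (cl t - x')) (L * (y' - x'))).
  - apply: measurable_funM; first exact: measurable_cst.
    by apply: measurable_funB => //; exact: measurable_cst.
  - move=> t; have /andP[h1 h2] := cl_in t.
    by rewrite mulr_ge0 ?subr_ge0//= ler_wpM2l// lerB.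
  - by move=> t t0; rewrite ler_wpM2l// lerB// cl_homo// ltW// up.
  - move=> t h1 h2; have [-> ->] := mid _ h1 h2.
    rewrite -mulrDr ler_wpM2l//.
    have t0 := lt_le_trans x0 h1.
    have : d <= `|g t - t| by apply: cmin; rewrite in_itv/= h1.
    by rewrite gtr0_norm ?subr_gt0 ?up//; lra.
apply: (main (fun t => L * (y' - cl t)) (L * (y' - x'))).
- apply: measurable_funM; first exact: measurable_cst.
  by apply: measurable_funB => //; exact: measurable_cst.
- move=> t; have /andP[h1 h2] := cl_in t.
  by rewrite mulr_ge0 ?subr_ge0//= ler_wpM2l// lerB.
- by move=> t t0; rewrite ler_wpM2l// lerB// cl_homo// ltW// dn.
- move=> t h1 h2; have [-> ->] := mid _ h1 h2.
  rewrite -mulrDr ler_wpM2l//.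
  have t0 := lt_le_trans x0 h1.
  have : d <= `|g t - t| by apply: cmin; rewrite in_itv/= h1.
  by rewrite ltr0_norm ?subr_lt0 ?dn//; lra.
Qed.

End fixed_point_free.

(** * Sufficiency of the conditions *)

Section contracting_weighted_composition.
Context {R : realType}.
Variable p : R.
Hypothesis p_gt1 : 1 < p.
Variables g j : R -> R.
Hypothesis sgj : weighted_shift g j.
Variable c : R -> R[i].
Hypothesis mc : cmeas c.

(* The bounded weight [w] defines an equivalent norm for which the operator
   [wcomp g c] has norm less than 1. *)
Definition contracting (g j : R -> R) (c : R -> R[i]) : Prop :=
  exists w : R -> R, exists m, exists H, exists q,
  [/\ measurable_fun (@Rplus R) w, 0 < m,
    forall t, 0 < t -> m <= w t, forall t, 0 < t -> w t <= H &
    [/\ 0 < q, q < 1 &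
      forall t, 0 < t -> cmod (c t) `^ p * w t <= q * (w (g t) * j t)]].

Hypothesis ctr : contracting g j c.

Lemma contracting_iter : exists K, exists q, [/\ 0 <= K, 0 < q, q < 1 &
  forall n f, cmeas f ->
    (npow p (iter n (wcomp g c) f) <= (K * q ^+ n)%:E * npow p f)%E].
Proof.
have [w [m [H [q [mw m0 wm wH [q0 q1 h]]]]]] := ctr.
exists (H / m), q; split => //.
  rewrite divr_ge0//; last exact: ltW.
  by apply: le_trans (wH _ ltr01); apply: le_trans (ltW m0) (wm _ ltr01).
by move=> n f mf; apply: (npow_iter sgj mc mw m0 wm wH q0 h).
Qed.

Lemma contracting_injective f : cmeas f -> (npow p f < +oo)%E ->
  ae_Rplus (fun t => f t = wcomp g c f t) -> ae_zero f.
Proof.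
have [w [m [H [q [mw m0 wm wH [q0 q1 h]]]]]] := ctr.
exact: (wcomp_injective sgj mc mw m0 wm wH q0 q1 h).
Qed.

Lemma contracting_solve : exists2 C, 0 <= C & forall h, cmeas h ->
  (npow p h < +oo)%E ->
  exists f, [/\ cmeas f, (npow p f <= C%:E * npow p h)%E &
    ae_Rplus (fun t => f t - wcomp g c f t = h t)].
Proof.
have [w [m [H [q [mw m0 wm wH [q0 q1 h]]]]]] := ctr.
exact: (wcomp_solve p_gt1 sgj mc mw m0 wm wH q0 q1 h).
Qed.

Lemma contracting_bound : exists2 C, 0 <= C & forall f h, cmeas f ->
  (npow p f < +oo)%E -> cmeas h -> (npow p h < +oo)%E ->
  ae_Rplus (fun t => f t - wcomp g c f t = h t) -> (npow p f <= C%:E * npow p h)%E.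
Proof.
have [w [m [H [q [mw m0 wm wH [q0 q1 h]]]]]] := ctr.
exact: (wcomp_bound p_gt1 sgj mc mw m0 wm wH q0 q1 h).
Qed.

End contracting_weighted_composition.

Section operator_estimates.
Context {R : realType}.
Variable p : R.
Hypothesis p_gt1 : 1 < p.
Let p_gt0 : 0 < p. Proof. exact: lt_trans p_gt1. Qed.

Lemma Cb_bound (a : R -> R[i]) : Cb a ->
  exists2 M, 0 < M & forall t, 0 < t -> cmod (a t) <= M.
Proof.
move=> [_ [_ [M h]]]; exists (`|M| + 1); first by rewrite ltr_wpDl.
by move=> t t0; apply: le_trans (h t t0) _; apply: le_trans (ler_norm _) _; rewrite lerDl.
Qed.

Lemma SOS_d_bound (alpha : R -> R) : SOS alpha ->
  exists e0, exists e1, [/\ 0 < e0, 0 < e1 & forall t, 0 < t ->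
    e0 <= derive1 alpha t <= e1].
Proof.
move=> S; case: (S) => _ [_ [_ [_ [_ [_ [_ [[M h] _]]]]]]].
exists (expR (- M)), (expR M); split; rewrite ?expR_gt0// => t t0.
rewrite -[derive1 alpha t]lnK ?posrE ?SOS_d_gt0// !ler_expR.
by have := h t t0; rewrite ler_norml.
Qed.

Lemma SO_Cb (a : R -> R[i]) : SO a -> Cb a. Proof. by case. Qed.

Lemma npow_mul_le (a f : R -> R[i]) M : 0 <= M -> cmeas a -> cmeas f ->
  (forall t, 0 < t -> cmod (a t) <= M) ->
  (npow p (fun t => (a t * f t)%R) <= (M `^ p)%:E * npow p f)%E.
Proof.
move=> M0 ma mf aM; apply: npow_le => //; first exact: cmeasM.
by move=> t t0; rewrite cmodM ler_wpM2r ?cmod_ge0 ?aM.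
Qed.

Lemma cmeas_Aop (a b f : R -> R[i]) (g j : R -> R) : weighted_shift g j ->
  cmeas a -> cmeas b -> cmeas f -> cmeas (Aop a b g f).
Proof.
move=> s ma mb mf; apply: cmeasB; apply: cmeasM => //.
exact: (cmeas_shift s).
Qed.

Lemma npow_Aop (a b : R -> R[i]) (g j : R -> R) e0 : Cb a -> Cb b ->
  weighted_shift g j -> 0 < e0 -> (forall t, 0 < t -> e0 <= j t) ->
  exists2 C, 0 <= C & forall f, cmeas f ->
    (npow p (Aop a b g f) <= C%:E * npow p f)%E.
Proof.
move=> Ca Cb s e00 je0.
have [Ma Ma0 aM] := Cb_bound Ca; have [Mb Mb0 bM] := Cb_bound Cb.
have ma := Cb_cmeas Ca; have mb := Cb_cmeas Cb.
exists (2 `^ p * (Ma `^ p + Mb `^ p / e0)).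
  by rewrite mulr_ge0 ?powR_ge0// addr_ge0 ?divr_ge0 ?powR_ge0// ltW.
move=> f mf; have mfg := cmeas_shift s mf.
have mbf : cmeas (fun t => b t * f (g t)) by exact: cmeasM.
apply: le_trans (npowD p_gt1 (cmeasM ma mf) (cmeasN mbf)) _.
rewrite npowN EFinM -muleA lee_pmul2l ?lte_fin ?powR_gt0//.
rewrite EFinD ge0_muleDl ?lee_fin ?divr_ge0 ?powR_ge0 ?(ltW e00)//.
apply: leeD; first exact: npow_mul_le (ltW Ma0) ma mf aM.
apply: le_trans (npow_mul_le (ltW Mb0) mb mfg bM) _.
rewrite EFinM -muleA lee_pmul2l ?lte_fin ?powR_gt0//.
exact: (npow_shift_le p s e00 je0 mf).
Qed.

Lemma neumann_conv_geometric (A : (R -> R[i]) -> (R -> R[i]))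
    (S : nat -> (R -> R[i]) -> (R -> R[i])) (K q : R) :
  0 <= K -> 0 < q -> q < 1 ->
  (forall N f h, cmeas f -> (npow p f < +oo)%E -> cmeas h -> (npow p h < +oo)%E ->
     ae_Rplus (fun t => A f t = h t) ->
     (npow p (fun t => (S N h t - f t)%R) <= (K * q ^+ N)%:E * npow p h)%E) ->
  neumann_conv p A S.
Proof.
move=> K0 q0 q1 est eps eps0.
have nq : `|q| < 1 by rewrite ger0_norm// ltW.
have := @cvg_geometric R K q nq => /cvgrPdist_lt/(_ (eps `^ p)).
rewrite powR_gt0// => /(_ isT)[N0 _ h]; exists N0 => N NN0 k f.
move=> /(inLpE p_gt1)[mk k1] /(inLpE p_gt1)[mf f1] /ae_zeroB_eq Af.
have KN0 : 0 <= K * q ^+ N by rewrite mulr_ge0// exprn_ge0// ltW.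
have := h N NN0; rewrite /= sub0r normrN ger0_norm// => KN.
apply: le_trans (Lpnorm_le p_gt1 KN0 (est N f k mf f1 mk k1 Af)) _.
apply: lee_wpmul2r; first exact: Lpnorm_ge0.
rewrite lee_fin -[leRHS]powRr1 ?(ltW eps0)// -(mulfV (lt0r_neq0 p_gt0)) powRrM.
apply: ge0_ler_powR; rewrite ?nnegrE ?invr_ge0 ?powR_ge0//; exact: ltW.
Qed.

Lemma invertible_intro (A : (R -> R[i]) -> (R -> R[i])) (C1 C2 : R) :
  0 <= C1 -> 0 <= C2 ->
  (forall f, cmeas f -> cmeas (A f)) ->
  (forall f, cmeas f -> (npow p (A f) <= C1%:E * npow p f)%E) ->
  (forall f, cmeas f -> (npow p f < +oo)%E -> ae_zero (A f) -> ae_zero f) ->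
  (forall h, cmeas h -> (npow p h < +oo)%E -> exists f, [/\ cmeas f,
     (npow p f <= C2%:E * npow p h)%E & ae_Rplus (fun t => A f t = h t)]) ->
  invertible_Lp p A.
Proof.
move=> C10 C20 mA bA iA sA; split; last split; last split.
- move=> f /(inLpE p_gt1)[mf f1]; apply/(inLpE p_gt1); split; first exact: mA.
  exact: npowZ_lty C10 (bA f mf) f1.
- exists (C1 `^ p^-1) => f /(inLpE p_gt1)[mf f1].
  exact: Lpnorm_le C10 (bA f mf).
- by move=> f /(inLpE p_gt1)[mf f1]; exact: iA.
- exists (C2 `^ p^-1) => h /(inLpE p_gt1)[mh h1].
  have [f [mf fh Af]] := sA h mh h1; exists f; split; [|split].
  + by apply/(inLpE p_gt1); split; [|exact: npowZ_lty C20 fh h1].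
  + exact/ae_zeroB_eq.
  + exact: Lpnorm_le.
Qed.

End operator_estimates.

Section sufficiency.
Context {R : realType}.
Variable p : R.
Hypothesis p_gt1 : 1 < p.
Variables (a b : R -> R[i]) (alpha : R -> R).
Hypotheses (Ca : Cb a) (Cbb : Cb b) (Salpha : SOS alpha).
Let p_gt0 : 0 < p. Proof. exact: lt_trans p_gt1. Qed.

Let ma : cmeas a := Cb_cmeas Ca.
Let mb : cmeas b := Cb_cmeas Cbb.
Let dp t := derive1 alpha t `^ (- p^-1).

Let dp_gt0 t : 0 < t -> 0 < dp t.
Proof. by move=> t0; rewrite powR_gt0// SOS_d_gt0. Qed.

Let dp_powR t : 0 < t -> dp t `^ p = (derive1 alpha t)^-1.
Proof.
move=> t0; rewrite /dp -powRrM mulNr mulVf ?gt_eqF// powR_inv1//.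
exact/ltW/SOS_d_gt0.
Qed.

Let sa : weighted_shift alpha (derive1 alpha) := SOS_shift Salpha.

Lemma inf_gt0P (u : R -> R[i]) : 0 < inf [set cmod (u t) | t in @Rplus R] ->
  forall t, 0 < t -> inf [set cmod (u t) | t in @Rplus R] <= cmod (u t).
Proof.
move=> u0 t t0; apply: inf_lbound; last by exists t.
by exists 0 => _ [s _ <-]; exact: cmod_ge0.
Qed.

(** The quotient is at most [1 - e / A], hence at most [1 - e / M]; a number in [[0, 1]] does not
    grow when raised to the power [p > 1]. *)
Let ratio (A B M e q : R) : 0 < e -> 0 < M -> 0 <= B -> B <= A - e -> A <= M ->
  1 - e / M <= q -> (A^-1 * B) `^ p <= q.
Proof.
move=> e0 M0 B0 BA AM qe.
have A0 : 0 < A by apply: lt_le_trans e0 _; rewrite -subr_ge0; exact: le_trans BA.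
have r : A^-1 * B <= 1 - e / M.
  rewrite mulrC ler_pdivrMr// mulrBl mul1r; apply: le_trans BA _.
  by rewrite lerB// mulrAC ler_pdivrMr// ler_pM2l.
have r0 : 0 <= A^-1 * B by rewrite mulr_ge0// invr_ge0 ltW.
apply: le_trans qe; apply: le_trans r.
move: r0; rewrite le_eqVlt => /orP[/eqP <-|r0]; first by rewrite powR0// gt_eqF.
apply: ge1r_powR; last exact: ltW.
rewrite r0/= mulrC ler_pdivrMr// mul1r; apply: le_trans BA _.
by rewrite gerBl ltW.
Qed.

Lemma cond1_contracting : cond1 p a b alpha ->
  contracting p alpha (derive1 alpha) (fun t => (a t)^-1 * b t).
Proof.
move=> [inf0 [/limf_einf_gt0P[e e_gt0 /near_right0P[x x0 hx]]
  /limf_einf_gt0P[e' e'_gt0 /near_pinftyP[y y0 hy]]]].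
have ainf := inf_gt0P inf0; set i := inf _ in inf0 ainf.
have [Ma Ma0 aM] := Cb_bound Ca; have [Mb Mb0 bM] := Cb_bound Cbb.
have [e0 [e1 [e00 e10 de]]] := SOS_d_bound Salpha.
(* [v] is the local factor by which the operator multiplies the [p]-th power of the norm, once its
   Jacobian is divided out. *)
pose v t := (cmod (a t)^-1 * cmod (b t)) `^ p * (derive1 alpha t)^-1.
pose e2 := Num.min e e'.
have e2_gt0 : 0 < e2 by rewrite lt_min e_gt0.
(* The value [2^-1] ensures [q > 0] without comparing [e2] with [Ma]. *)
pose q := Num.max 2^-1 (1 - e2 / Ma).
have q_gt0 : 0 < q by rewrite lt_max invr_gt0 ltr0n.
have q_lt1 : q < 1 by rewrite gt_max invf_lt1 ?ltr1n//= gtrBl divr_gt0.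
have vq t : 0 < t -> e2 <= Dfun p a b alpha t -> v t <= q.
  move=> t0 h; rewrite /v cmodV -dp_powR// -powRM ?(ltW (dp_gt0 t0)) ?mulr_ge0 ?invr_ge0 ?cmod_ge0//.
  rewrite -mulrA; apply: (ratio e2_gt0 Ma0).
  - by rewrite mulr_ge0 ?cmod_ge0// ltW// dp_gt0.
  - by rewrite lerBrDr addrC -lerBrDr.
  - exact: aM.
  - by rewrite le_max lexx orbT.
have vC t : 0 < t -> v t <= (i^-1 * Mb) `^ p * e0^-1.
  move=> t0; have d0 := SOS_d_gt0 Salpha t0.
  rewrite ler_pM ?powR_ge0 ?invr_ge0 ?(ltW d0)//.
    apply: ge0_ler_powR; rewrite ?nnegrE ?mulr_ge0 ?cmod_ge0 ?invr_ge0 ?(ltW p_gt0) ?(ltW inf0) ?(ltW Mb0)//.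
    rewrite ler_pM ?cmod_ge0 ?bM// cmodV lef_pV2 ?posrE ?ainf//.
    by apply: lt_le_trans inf0 _; exact: ainf.
  by rewrite lef_pV2 ?posrE//; case/andP: (de t t0).
have v0 t : 0 < t -> 0 <= v t.
  by move=> t0; rewrite mulr_ge0 ?powR_ge0// invr_ge0 ltW// SOS_d_gt0.
have C0 : 0 < (i^-1 * Mb) `^ p * e0^-1.
  by rewrite mulr_gt0 ?invr_gt0 ?powR_gt0 ?mulr_gt0 ?invr_gt0.
have xy : x <= Num.max x y by rewrite le_max lexx.
have [|t yt|w [H [mw w1 wH wq]]] := @contraction_weight R alpha (SOS_cont Salpha)
  (SOS_neq Salpha) v q _ x (Num.max x y) q_gt0 C0 x0 xy vC v0.
- move=> t t0 tx; apply: vq => //; apply: le_trans (hx t t0 tx).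
  by rewrite ge_min lexx.
- have t0 : 0 < t by apply: lt_le_trans yt; rewrite lt_max x0.
  apply: vq => //; apply: (le_trans _ (hy t _)); first by rewrite ge_min lexx orbT.
  by apply: le_trans yt; rewrite le_max lexx orbT.
exists w, 1, H, q; split => //.
- exact: measurable_funTS.
- split=> // t t0; have d0 := SOS_d_gt0 Salpha t0.
  rewrite cmodM mulrA -ler_pdivrMr//; apply: le_trans (wq t t0).
  by rewrite /v le_eqVlt; apply/orP; left; apply/eqP; ring.
Qed.

Lemma cond1_aneq0 : cond1 p a b alpha -> forall t, 0 < t -> a t != 0.
Proof.
move=> [inf0 _] t t0; apply/eqP => at0; have := inf_gt0P inf0 t0.
by rewrite at0 cmod0 leNgt inf0.
Qed.

Section inverse_shift.
Variable beta : R -> R.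
Hypothesis beta1 : forall s, 0 < s -> 0 < beta s /\ alpha (beta s) = s.
Hypothesis beta2 : forall t, 0 < t -> beta (alpha t) = t.

(** On the half-line [beta] coincides with the [C1] inverse contained in [SOS] and inherits its
    continuity. *)
Lemma inv_cont s : 0 < s -> {for s, continuous beta}.
Proof.
move=> s0; case: Salpha => _ [[b0 [b1 [b2 [db _]]]] _].
have bE u : 0 < u -> beta u = b0 u.
  by move=> u0; have [bu {2}<-] := beta1 u0; rewrite b2.
have cb0 : {for s, continuous b0}.
  by apply: differentiable_continuous; apply/derivable1_diffP/db.
rewrite /prop_for /continuous_at bE//; apply: cvg_trans cb0.
apply: near_eq_cvg; near=> u; apply/esym/bE; near: u; exact: lt_nbhsr.
Unshelve. all: by end_near. Qed.

(** The formula for [alpha], applied to [phi (beta s)] divided by the derivative of [alpha] at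
    [beta s], is the formula for [beta]. *)
Lemma inv_shift : weighted_shift beta (fun s => (derive1 alpha (beta s))^-1).
Proof.
have mbeta : measurable_fun (@Rplus R) beta.
  by apply: measurable_within; apply: within_Rplus; exact: inv_cont.
have bpos s : 0 < s -> 0 < beta s by move=> /beta1[].
have mjb : measurable_fun (@Rplus R) (fun s => (derive1 alpha (beta s))^-1).
  have sub : beta @` (@Rplus R) `<=` @Rplus R by move=> _ [t /= t0 <-]; exact: bpos.
  have := measurable_comp measurable_Rplus sub (SOS_dmeas Salpha) mbeta.
  move=> /(measurableT_comp (measurable_powR (-1))).
  apply: eq_measurable_fun => s /set_mem s0 /=.
  by rewrite powR_inv1// ltW// SOS_d_gt0// bpos.
split => //.
- by move=> s s0; rewrite invr_gt0 SOS_d_gt0// bpos.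
- move=> phi mphi phi0.
  have sub : beta @` (@Rplus R) `<=` @Rplus R by move=> _ [t /= t0 <-]; exact: bpos.
  have mpsi : measurable_fun (@Rplus R)
      (fun s => (phi (beta s) * ((derive1 alpha (beta s))^-1)%:E)%E).
    apply: emeasurable_funM; last exact/measurable_EFinP.
    exact: (measurable_comp measurable_Rplus sub mphi mbeta).
  rewrite -(shift_cv sa mpsi); last first.
    move=> s s0; have bs := bpos s s0.
    by rewrite mule_ge0 ?phi0// lee_fin invr_ge0 ltW// SOS_d_gt0.
  apply: eq_integral => t /set_mem t0.
  rewrite beta2// -muleA -EFinM mulVf ?mule1// gt_eqF// SOS_d_gt0//.
Qed.

Lemma cond2_contracting : cond2 p a b alpha ->
  contracting p beta (fun s => (derive1 alpha (beta s))^-1) (fun t => (b t)^-1 * a t).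
Proof.
move=> [inf0 [/limf_esup_lt0P[e e_gt0 /near_right0P[x x0 hx]]
  /limf_esup_lt0P[e' e'_gt0 /near_pinftyP[y y0 hy]]]].
have binf := inf_gt0P inf0; set i := inf _ in inf0 binf.
have [Ma Ma0 aM] := Cb_bound Ca; have [Mb Mb0 bM] := Cb_bound Cbb.
have [e0 [e1 [e00 e10 de]]] := SOS_d_bound Salpha.
pose v t := (cmod (b t)^-1 * cmod (a t)) `^ p * derive1 alpha t.
pose e2 := Num.min e e'.
have e2_gt0 : 0 < e2 by rewrite lt_min e_gt0.
(* The dominating coefficient is now [cmod (b t) * dp t], and [M] bounds it from above. *)
pose M := Mb * e0 `^ (- p^-1).
have M0 : 0 < M by rewrite mulr_gt0// powR_gt0.
have bdM t : 0 < t -> cmod (b t) * dp t <= M.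
  move=> t0; rewrite ler_pM ?cmod_ge0 ?bM ?(ltW (dp_gt0 t0))//.
  rewrite /dp !powRN lef_pV2 ?posrE ?powR_gt0 ?SOS_d_gt0//.
  apply: ge0_ler_powR; rewrite ?nnegrE ?invr_ge0 ?(ltW p_gt0) ?(ltW e00)//.
    exact/ltW/SOS_d_gt0.
  by case/andP: (de t t0).
pose q := Num.max 2^-1 (1 - e2 / M).
have q_gt0 : 0 < q by rewrite lt_max invr_gt0 ltr0n.
have q_lt1 : q < 1 by rewrite gt_max invf_lt1 ?ltr1n//= gtrBl divr_gt0.
have vq t : 0 < t -> Dfun p a b alpha t <= - e2 -> v t <= q.
  move=> t0 h; have d0 := SOS_d_gt0 Salpha t0.
  have -> : v t = ((cmod (b t) * dp t)^-1 * cmod (a t)) `^ p.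
    rewrite /v cmodV invfM mulrAC [in RHS]powRM ?mulr_ge0 ?invr_ge0 ?cmod_ge0 ?(ltW (dp_gt0 t0))//.
    congr (_ * _); apply: (mulIf (lt0r_neq0 (powR_gt0 p (dp_gt0 t0)))).
    rewrite -[RHS]powRM ?invr_ge0 ?(ltW (dp_gt0 t0))//.
    by rewrite mulVf ?lt0r_neq0 ?dp_gt0// powR1 dp_powR// mulfV// lt0r_neq0.
  apply: (ratio e2_gt0 M0).
  - exact: cmod_ge0.
  - by move: h; rewrite /Dfun -/(dp t) lerBlDl addrC.
  - exact: bdM.
  - by rewrite le_max lexx orbT.
have vC t : 0 < t -> v t <= (i^-1 * Ma) `^ p * e1.
  move=> t0; have d0 := SOS_d_gt0 Salpha t0.
  rewrite ler_pM ?powR_ge0 ?(ltW d0)//.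
    apply: ge0_ler_powR; rewrite ?nnegrE ?mulr_ge0 ?cmod_ge0 ?invr_ge0 ?(ltW p_gt0) ?(ltW inf0) ?(ltW Ma0)//.
    rewrite ler_pM ?cmod_ge0 ?aM// cmodV lef_pV2 ?posrE ?binf//.
    by apply: lt_le_trans inf0 _; exact: binf.
  by case/andP: (de t t0).
have v0 t : 0 < t -> 0 <= v t.
  by move=> t0; rewrite mulr_ge0 ?powR_ge0// ltW// SOS_d_gt0.
have C0 : 0 < (i^-1 * Ma) `^ p * e1.
  by rewrite mulr_gt0 ?powR_gt0 ?mulr_gt0 ?invr_gt0.
have xy : x <= Num.max x y by rewrite le_max lexx.
have bneq s : 0 < s -> beta s != s.
  move=> s0; have [bs0 bs] := beta1 s0; have := SOS_neq Salpha bs0.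
  by rewrite bs eq_sym.
have [|t yt|w [H [mw w1 wH wq]]] := @contraction_weight R beta inv_cont
  bneq v q _ x (Num.max x y) q_gt0 C0 x0 xy vC v0.
- move=> t t0 tx; apply: vq => //; apply: le_trans (hx t t0 tx) _.
  by rewrite lerN2 ge_min lexx.
- have t0 : 0 < t by apply: lt_le_trans yt; rewrite lt_max x0.
  apply: vq => //; apply: (le_trans (hy t _)); last by rewrite lerN2 ge_min lexx orbT.
  by apply: le_trans yt; rewrite le_max lexx orbT.
(* The extra factor cancels the Jacobian of [beta]: the new weight at [beta t] times this Jacobian
   is [w (beta t)], and the factor left over at [t] is part of [v t]. *)
exists (fun t => w t * derive1 alpha t), e0, (H * e1), q.
have w0 t : 0 <= w t by apply: le_trans (w1 t).
split => //.
- by apply: measurable_funM; [exact: measurable_funTS|exact: (SOS_dmeas Salpha)].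
- move=> t t0; case/andP: (de t t0) => d1 _; apply: le_trans d1 _.
  by rewrite ler_peMl// ltW// SOS_d_gt0.
- move=> t t0; have d0 := SOS_d_gt0 Salpha t0.
  by rewrite ler_pM ?(ltW d0)//; case/andP: (de t t0).
- split=> // t t0; have [bt0 bt] := beta1 t0.
  rewrite mulfK ?gt_eqF ?SOS_d_gt0//; apply: le_trans (wq t t0).
  by rewrite cmodM /v le_eqVlt; apply/orP; left; apply/eqP; ring.
Qed.

Lemma cond2_bneq0 : cond2 p a b alpha -> forall t, 0 < t -> b t != 0.
Proof.
move=> [inf0 _] t t0; apply/eqP => bt0; have := inf_gt0P inf0 t0.
by rewrite bt0 cmod0 leNgt inf0.
Qed.


(** With [u = f \o alpha] the equation [a f - b u = h] becomes [u - b^-1 a (u \o beta) = - b^-1 h],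
    to which the contraction along [beta] applies; then [f = u \o beta]. *)
Lemma cond2_invertible : cond2 p a b alpha -> invertible_Lp p (Aop a b alpha).
Proof.
move=> h2; have ctr := cond2_contracting h2; have bn := cond2_bneq0 h2.
have [e0 [e1 [e00 e10 de]]] := SOS_d_bound Salpha.
have [C1 C10 bA] := npow_Aop p_gt1 Ca Cbb sa e00 (fun t t0 => proj1 (andP (de t t0))).
have sb := inv_shift; have mc := cmeasM (cmeasV mb) ma.
have [C C0 solve] := contracting_solve p_gt1 sb mc ctr.
have i0 := h2.1; have binf := inf_gt0P i0; set i := inf _ in i0 binf.
have bV t : 0 < t -> cmod (b t)^-1 <= i^-1.
  move=> t0; rewrite cmodV lef_pV2 ?posrE ?binf//.
  by apply: lt_le_trans i0 _; exact: binf.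
have e1V t : 0 < t -> e1^-1 <= (derive1 alpha (beta t))^-1.
  move=> t0; have [bt0 _] := beta1 t0.
  by rewrite lef_pV2 ?posrE ?SOS_d_gt0//; case/andP: (de _ bt0).
pose C2 := e1 * (C * i^-1 `^ p).
apply: (@invertible_intro _ _ p_gt1 _ C1 C2) => //.
- by rewrite /C2 !mulr_ge0 ?powR_ge0// ltW.
- by move=> f mf; exact: (cmeas_Aop sa).
- move=> f mf f1 Af.
  have mu : cmeas (fun t => f (alpha t)) by exact: (cmeas_shift sa).
  have u1 : (npow p (fun t => f (alpha t)) < +oo)%E.
    have u := npow_shift_le p sa e00 (fun t t0 => proj1 (andP (de t t0))) mf.
    by apply: npowZ_lty u f1; rewrite invr_ge0 ltW.
  have u0 : ae_zero (fun t => f (alpha t)).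
    apply: (contracting_injective sb mc ctr mu u1).
    apply: (aeS _ Af) => t t0; rewrite /Aop /Wop /wcomp (proj2 (beta1 t0)) => /eqP.
    rewrite subr_eq0 => /eqP e; rewrite -mulrA e mulKf//; exact: bn.
  apply: (aeS _ (ae_shift sb u0)) => t t0; have [_ bt] := beta1 t0.
  by rewrite bt.
- move=> h mh h1.
  have mk : cmeas (fun t => - ((b t)^-1 * h t)) by apply: cmeasN; apply: cmeasM => //; exact: cmeasV.
  have i0' : 0 <= i^-1 by rewrite invr_ge0 ltW.
  have kh : (npow p (fun t => (- ((b t)^-1 * h t))%R) <= (i^-1 `^ p)%:E * npow p h)%E.
    by rewrite npowN; exact: npow_mul_le i0' (cmeasV mb) mh bV.
  have [u [mu uk uE]] := solve _ mk (npowZ_lty (powR_ge0 _ _) kh h1).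
  exists (fun t => u (beta t)); split.
  + exact: (cmeas_shift sb).
  + have e1V0 : 0 < e1^-1 by rewrite invr_gt0.
    apply: le_trans (npow_shift_le p sb e1V0 e1V mu) _.
    rewrite invrK /C2 EFinM -muleA lee_pmul2l ?lte_fin//.
    apply: le_trans uk _; rewrite EFinM -muleA.
    by apply: lee_pmul => //; rewrite ?npow_ge0 ?lee_fin.
  + apply: (aeS _ uE) => t t0; rewrite /Aop /Wop /wcomp beta2// => e.
    have b0 := bn t t0; rewrite (_ : u t = - ((b t)^-1 * h t) + (b t)^-1 * a t * u (beta t)); last by rewrite -e subrK.
    by field.
Qed.

Lemma cond2_neumann : cond2 p a b alpha -> neumann_conv p (Aop a b alpha) (S2 a b beta).
Proof.
move=> h2; have ctr := cond2_contracting h2; have bn := cond2_bneq0 h2.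
have [e0 [e1 [e00 e10 de]]] := SOS_d_bound Salpha.
have sb := inv_shift; have mc := cmeasM (cmeasV mb) ma.
have [C C0 bound] := contracting_bound p_gt1 sb mc ctr.
have [K [q [K0 q0 q1 iterK]]] := contracting_iter sb mc ctr.
have i0 := h2.1; have binf := inf_gt0P i0; set i := inf _ in i0 binf.
have bV t : 0 < t -> cmod (b t)^-1 <= i^-1.
  move=> t0; rewrite cmodV lef_pV2 ?posrE ?binf//.
  by apply: lt_le_trans i0 _; exact: binf.
have e1V t : 0 < t -> e1^-1 <= (derive1 alpha (beta t))^-1.
  move=> t0; have [bt0 _] := beta1 t0.
  by rewrite lef_pV2 ?posrE ?SOS_d_gt0//; case/andP: (de _ bt0).
apply: (@neumann_conv_geometric _ _ p_gt1 _ _ (e1 * (K * (C * i^-1 `^ p))) q) => //.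
  by rewrite !mulr_ge0 ?powR_ge0// ltW.
move=> N f h mf f1 mh h1 Af.
pose k t := - ((b t)^-1 * h t); pose u t := f (alpha t).
have mbh : cmeas (fun t => (b t)^-1 * h t) by apply: cmeasM => //; exact: cmeasV.
have mk : cmeas k by exact: cmeasN.
have i0' : 0 <= i^-1 by rewrite invr_ge0 ltW.
have kh : (npow p k <= (i^-1 `^ p)%:E * npow p h)%E.
  by rewrite /k npowN; exact: npow_mul_le i0' (cmeasV mb) mh bV.
have mu : cmeas u by exact: (cmeas_shift sa).
have u1 : (npow p u < +oo)%E.
  have hu := npow_shift_le p sa e00 (fun t t0 => proj1 (andP (de t t0))) mf.
  by apply: npowZ_lty hu f1; rewrite invr_ge0 ltW.
have uE : ae_Rplus (fun t => u t - wcomp beta (fun t => (b t)^-1 * a t) u t = k t).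
  apply: (aeS _ Af) => t t0; rewrite /Aop /Wop /wcomp /u /k (proj2 (beta1 t0)) => <-.
  by have b0 := bn t t0; field.
have uk := bound _ _ mu u1 mk (npowZ_lty (powR_ge0 _ _) kh h1) uE.
pose T := wcomp beta (fun t => (b t)^-1 * a t).
have miter n v : cmeas v -> cmeas (iter n T v) by exact: (cmeas_iter sb mc).
(* The minus sign of [S2] is absorbed in [k], and the partial sum for [u] telescopes, leaving the
   [N]-th iterate of [u] evaluated at [beta t]. *)
have S2E : ae_Rplus (fun t => S2 a b beta N h t - f t = - iter N T u (beta t)).
  have := ae_shift sb (partial_sum_wcomp sb mu mk uE N); apply: aeS => t t0 e.
  have [bt0 bt] := beta1 t0.
  rewrite /S2 /Wop -/(T2 a b beta) -sumrN.
  rewrite (eq_bigr (fun n : 'I_N => iter n T k (beta t))); last first.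
    by move=> n _; rewrite /k iter_wcompN.
  by rewrite e /u bt addrAC subrr add0r.
rewrite (npow_ae_eq p _ _ S2E); last 2 first.
- apply: cmeasB => //; apply: cmeasN; apply: (cmeas_shift sb).
  by apply: cmeas_sum => n; exact: miter.
- by apply: cmeasN; apply: (cmeas_shift sb); exact: miter.
rewrite npowN.
have e1V0 : 0 < e1^-1 by rewrite invr_gt0.
apply: le_trans (npow_shift_le p sb e1V0 e1V (miter N u mu)) _.
rewrite invrK -!mulrA EFinM -muleA lee_pmul2l ?lte_fin//.
apply: le_trans (iterK N u mu) _.
rewrite (_ : K * (C * _) = K * q ^+ N * (C * i^-1 `^ p)); last by ring.
have KqN : 0 <= K * q ^+ N by rewrite mulr_ge0// exprn_ge0// ltW.
rewrite [in leRHS]EFinM -muleA; apply: lee_pmul.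
- by rewrite lee_fin.
- exact: npow_ge0.
- exact: lexx.
apply: le_trans uk _; rewrite EFinM -muleA.
by apply: lee_pmul => //; rewrite ?npow_ge0 ?lee_fin.
Qed.

End inverse_shift.

Lemma cond1_invertible : cond1 p a b alpha -> invertible_Lp p (Aop a b alpha).
Proof.
move=> h1; have ctr := cond1_contracting h1; have an := cond1_aneq0 h1.
have [e0 [e1 [e00 e10 de]]] := SOS_d_bound Salpha.
have [C1 C10 bA] := npow_Aop p_gt1 Ca Cbb sa e00 (fun t t0 => proj1 (andP (de t t0))).
have mc := cmeasM (cmeasV ma) mb.
have [C C0 solve] := contracting_solve p_gt1 sa mc ctr.
have i0 := h1.1; have ainf := inf_gt0P i0; set i := inf _ in i0 ainf.
have aV t : 0 < t -> cmod (a t)^-1 <= i^-1.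
  move=> t0; rewrite cmodV lef_pV2 ?posrE ?ainf//.
  by apply: lt_le_trans i0 _; exact: ainf.
apply: (@invertible_intro _ _ p_gt1 _ C1 (C * i^-1 `^ p)) => //.
- by rewrite !mulr_ge0 ?powR_ge0.
- by move=> f mf; exact: (cmeas_Aop sa).
- move=> f mf f1 Af.
  apply: (contracting_injective sa mc ctr mf f1).
  apply: (aeS _ Af) => t t0; rewrite /Aop /Wop /wcomp => /eqP.
  by rewrite subr_eq0 => /eqP e; rewrite -mulrA -e mulKf//; exact: an.
- move=> h mh hoo.
  have mk : cmeas (fun t => (a t)^-1 * h t) by apply: cmeasM => //; exact: cmeasV.
  have i0' : 0 <= i^-1 by rewrite invr_ge0 ltW.
  have kh := npow_mul_le p_gt1 i0' (cmeasV ma) mh aV.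
  have [f [mf fk fE]] := solve _ mk (npowZ_lty (powR_ge0 _ _) kh hoo).
  exists f; split => //.
    apply: le_trans fk _; rewrite EFinM -muleA.
    by apply: lee_pmul => //; rewrite ?npow_ge0 ?lee_fin.
  apply: (aeS _ fE) => t t0; rewrite /Aop /Wop /wcomp => e.
  have a0 := an t t0; rewrite (_ : f t = (a t)^-1 * h t + (a t)^-1 * b t * f (alpha t)); last by rewrite -e subrK.
  by field.
Qed.

Lemma cond1_neumann : cond1 p a b alpha -> neumann_conv p (Aop a b alpha) (S1 a b alpha).
Proof.
move=> h1; have ctr := cond1_contracting h1; have an := cond1_aneq0 h1.
have mc := cmeasM (cmeasV ma) mb.
have [C C0 bound] := contracting_bound p_gt1 sa mc ctr.
have [K [q [K0 q0 q1 iterK]]] := contracting_iter sa mc ctr.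
have i0 := h1.1; have ainf := inf_gt0P i0; set i := inf _ in i0 ainf.
have aV t : 0 < t -> cmod (a t)^-1 <= i^-1.
  move=> t0; rewrite cmodV lef_pV2 ?posrE ?ainf//.
  by apply: lt_le_trans i0 _; exact: ainf.
apply: (@neumann_conv_geometric _ _ p_gt1 _ _ (K * (C * i^-1 `^ p)) q) => //.
  by rewrite !mulr_ge0 ?powR_ge0.
move=> N f h mf f1 mh hoo Af.
pose k t := (a t)^-1 * h t.
have mk : cmeas k by apply: cmeasM => //; exact: cmeasV.
have i0' : 0 <= i^-1 by rewrite invr_ge0 ltW.
have kh := npow_mul_le p_gt1 i0' (cmeasV ma) mh aV.
pose T := wcomp alpha (fun t => (a t)^-1 * b t).
have fE : ae_Rplus (fun t => f t - T f t = k t).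
  apply: (aeS _ Af) => t t0; rewrite /Aop /Wop /T /wcomp /k => <-.
  by have a0 := an t t0; field.
have fk := bound _ _ mf f1 mk (npowZ_lty (powR_ge0 _ _) kh hoo) fE.
have miter n v : cmeas v -> cmeas (iter n T v) by exact: (cmeas_iter sa mc).
have S1E : ae_Rplus (fun t => S1 a b alpha N h t - f t = - iter N T f t).
  have := partial_sum_wcomp sa mf mk fE N; apply: aeS => t t0 e.
  by rewrite /S1 e addrAC subrr add0r.
rewrite (npow_ae_eq p _ _ S1E); last 2 first.
- by apply: cmeasB => //; apply: cmeas_sum => n; exact: miter.
- by apply: cmeasN; exact: miter.
rewrite npowN; apply: le_trans (iterK N f mf) _.
rewrite (_ : K * (C * _) * _ = K * q ^+ N * (C * i^-1 `^ p)); last by ring.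
have KqN : 0 <= K * q ^+ N by rewrite mulr_ge0// exprn_ge0// ltW.
rewrite [in leRHS]EFinM -muleA; apply: lee_pmul.
- by rewrite lee_fin.
- exact: npow_ge0.
- exact: lexx.
apply: le_trans fk _; rewrite EFinM -muleA.
by apply: lee_pmul => //; rewrite ?npow_ge0 ?lee_fin.
Qed.

End sufficiency.

(** * Functions supported on the orbit of a wandering interval *)

Section complex_continuity.
Context {R : realType}.
Implicit Types (f g : R -> R[i]) (t : R).

Definition ccont f t : Prop :=
  {for t, continuous (fun s => complex.Re (f s))} /\
  {for t, continuous (fun s => complex.Im (f s))}.

Lemma ccontP f t : ccont f t <-> cmod (f s - f t) @[s --> t] --> 0.
Proof.
split.
  move=> [cr ci]; apply/cvgrPdist_lt => e e0.
  have e2 : 0 < e / 2 by rewrite divr_gt0.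
  move/cvgrPdist_lt: cr => /(_ _ e2) cr; move/cvgrPdist_lt: ci => /(_ _ e2) ci.
  near=> s.
  rewrite sub0r normrN ger0_norm ?cmod_ge0//.
  have -> : f s - f t = real_complex R (complex.Re (f s) - complex.Re (f t)) +
      'i%C * real_complex R (complex.Im (f s) - complex.Im (f t)).
    by case: (f s) (f t) => [x y] [x' y']; apply: complex_eqP => /=; ring.
  apply: le_lt_trans (ler_cmodD _ _) _; rewrite cmodM !cmod_real.
  rewrite [cmod 'i%C]/cmod /= expr0n/= add0r expr1n sqrtr1 mul1r.
  rewrite [ltRHS]splitr; apply: ltrD; rewrite distrC; near: s; [exact: cr|exact: ci].
move=> /cvgrPdist_lt h; split; apply/cvgrPdist_lt => e e0;
  have {}h := h e e0; apply: filterS h => s;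
  rewrite sub0r normrN ger0_norm ?cmod_ge0//; apply: le_lt_trans.
  by rewrite cmod_distC -raddfB ler_Re_cmod.
by rewrite cmod_distC -raddfB ler_Im_cmod.
Unshelve. all: by end_near. Qed.

Lemma ccont_cmod f t : ccont f t -> {for t, continuous (fun s => cmod (f s))}.
Proof.
move=> /ccontP/cvgrPdist_lt h; apply/cvgrPdist_lt => e e0.
have {}h := h e e0; apply: filterS h => s; rewrite sub0r normrN ger0_norm ?cmod_ge0//.
by apply: le_lt_trans; rewrite distrC ler_cmod_dist.
Qed.

Lemma ccontB f g t : ccont f t -> ccont g t -> ccont (fun s => f s - g s) t.
Proof.
move=> [fr fi] [gr gi]; split.
  rewrite (_ : (fun s => _) = (fun s => complex.Re (f s) - complex.Re (g s))); first exact: cvgB.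
  by apply/funext => s; rewrite raddfB.
rewrite (_ : (fun s => _) = (fun s => complex.Im (f s) - complex.Im (g s))); first exact: cvgB.
by apply/funext => s; rewrite raddfB.
Qed.

Lemma ccontM f g t : ccont f t -> ccont g t -> ccont (fun s => f s * g s) t.
Proof.
move=> [fr fi] [gr gi]; split.
  rewrite (_ : (fun s => _) = (fun s => complex.Re (f s) * complex.Re (g s)
    - complex.Im (f s) * complex.Im (g s))).
    by apply: cvgB; exact: cvgM.
  by apply/funext => s; case: (f s) (g s) => [? ?] [? ?].
rewrite (_ : (fun s => _) = (fun s => complex.Re (f s) * complex.Im (g s)
    + complex.Im (f s) * complex.Re (g s))).
  by apply: cvgD; exact: cvgM.
by apply/funext => s; case: (f s) (g s) => [? ?] [? ?].
Qed.

Lemma ccont_cst z t : ccont (fun=> z) t.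
Proof. by split; exact: cvg_cst. Qed.

Lemma ccont_real (h : R -> R) t : {for t, continuous h} ->
  ccont (fun s => real_complex R (h s)) t.
Proof. by move=> ch; split => //=; exact: cvg_cst. Qed.

Lemma ccont_comp f (h : R -> R) t : {for t, continuous h} -> ccont f (h t) ->
  ccont (fun s => f (h s)) t.
Proof.
move=> ch [fr fi]; split.
  exact: (@continuous_comp _ _ _ h (fun s => complex.Re (f s))).
exact: (@continuous_comp _ _ _ h (fun s => complex.Im (f s))).
Qed.

Lemma Cb_ccont f t : Cb f -> 0 < t -> ccont f t.
Proof. by move=> [fr [fi _]] t0; split; exact: continuous_Rplus. Qed.

End complex_continuity.

Section shift_iterates.
Context {R : realType}.

Lemma weighted_shift_id : weighted_shift (fun t : R => t) (fun=> 1).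
Proof.
split => //; try exact: measurable_id; try exact: measurable_cst.
by move=> phi mphi phi0; apply: eq_integral => x _; rewrite mule1.
Qed.

Lemma weighted_shift_comp (g j g' j' : R -> R) : weighted_shift g j ->
  weighted_shift g' j' ->
  weighted_shift (fun t => g' (g t)) (fun t => j' (g t) * j t).
Proof.
move=> s s'.
have sub (h k : R -> R) : weighted_shift h k -> h @` (@Rplus R) `<=` @Rplus R.
  by move=> sh _ [t /= t0 <-]; exact: (shift_gt0 sh).
have mj : measurable_fun (@Rplus R) (fun t => j' (g t)).
  exact: (measurable_comp measurable_Rplus (sub _ _ s) (shift_jac_meas s') (shift_meas s)).
split.
- by move=> t t0; apply/(shift_gt0 s')/(shift_gt0 s).
- exact: (measurable_comp measurable_Rplus (sub _ _ s) (shift_meas s') (shift_meas s)).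
- move=> t t0; rewrite mulr_gt0 ?(shift_jac_gt0 s)//.
  exact/(shift_jac_gt0 s')/(shift_gt0 s).
- by apply: measurable_funM => //; exact: (shift_jac_meas s).
- move=> phi mphi phi0; rewrite -(shift_cv s' mphi phi0).
  have mpsi : measurable_fun (@Rplus R) (fun x => (phi (g' x) * (j' x)%:E)%E).
    apply: emeasurable_funM; last by apply/measurable_EFinP; exact: (shift_jac_meas s').
    exact: (measurable_comp measurable_Rplus (sub _ _ s') mphi (shift_meas s')).
  rewrite -(shift_cv s mpsi); first by apply: eq_integral => x _; rewrite EFinM muleA.
  move=> x x0; rewrite mule_ge0// ?lee_fin; first by apply/phi0/(shift_gt0 s').
  exact/ltW/(shift_jac_gt0 s').
Qed.

(** The Jacobian of [iter k g] given by the chain rule. *)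
Fixpoint jac_iter (g j : R -> R) (k : nat) (t : R) : R :=
  if k is k'.+1 then j (iter k' g t) * jac_iter g j k' t else 1.

Lemma weighted_shift_iter (g j : R -> R) k : weighted_shift g j ->
  weighted_shift (iter k g) (jac_iter g j k).
Proof.
move=> s; elim: k => [|k ih]; first exact: weighted_shift_id.
exact: (weighted_shift_comp ih s).
Qed.

End shift_iterates.

Section orbit_slices.
Context {R : realType}.
Variable p : R.
Hypothesis p_gt1 : 1 < p.
Let p_gt0 : 0 < p. Proof. exact: lt_trans p_gt1. Qed.
Variables g j : R -> R.
Hypothesis sgj : weighted_shift g j.
Variable h : R -> R.
Hypothesis h_gt0 : forall t, 0 < t -> 0 < h t.
Hypothesis hK : forall t, 0 < t -> h (g t) = t.
Hypothesis gK : forall t, 0 < t -> g (h t) = t.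
Hypothesis mh : measurable_fun (@Rplus R) h.

Let g_gt0 := shift_gt0 sgj.

Lemma iter_gt0 (f : R -> R) : (forall t, 0 < t -> 0 < f t) ->
  forall k t, 0 < t -> 0 < iter k f t.
Proof. by move=> f0; elim=> //= k ih t t0; apply/f0/ih. Qed.

Lemma iter_cancel (f f' : R -> R) : (forall t, 0 < t -> 0 < f t) ->
  (forall t, 0 < t -> f' (f t) = t) -> forall k t, 0 < t -> iter k f' (iter k f t) = t.
Proof.
move=> f0 fK; elim=> [|k ih] t t0 //.
by rewrite iterSr iterS fK ?ih//; exact: iter_gt0.
Qed.

Definition jroot k t : R := jac_iter g j k t `^ p^-1.

Lemma jac_iter_gt0 k t : 0 < t -> 0 < jac_iter g j k t.
Proof. exact: (shift_jac_gt0 (weighted_shift_iter k sgj)). Qed.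

Lemma jroot_gt0 k t : 0 < t -> 0 < jroot k t.
Proof. by move=> t0; rewrite powR_gt0// jac_iter_gt0. Qed.

Lemma jroot_powR k t : 0 < t -> jroot k t `^ p = jac_iter g j k t.
Proof.
by move=> t0; rewrite /jroot -powRrM mulVf ?gt_eqF// powRr1// ltW// jac_iter_gt0.
Qed.

Lemma jrootS k t : 0 < t -> jroot k.+1 t = j (iter k g t) `^ p^-1 * jroot k t.
Proof.
move=> t0; rewrite /jroot /= powRM// ltW ?jac_iter_gt0//.
exact/(shift_jac_gt0 sgj)/iter_gt0.
Qed.

Variable I : interval R.
Hypothesis Ipos : forall t, t \in I -> 0 < t.
Hypothesis Isep : forall t k, t \in I -> (0 < k)%N -> iter k g t \notin I.

Definition chi (t : R) : R := (t \in I)%:R.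

Lemma chi_ge0 t : 0 <= chi t. Proof. by rewrite ler0n. Qed.

Lemma measurable_chi : measurable_fun setT chi.
Proof.
rewrite (_ : chi = \1_([set` I])); first by apply: measurable_indic; exact: measurable_itv.
by apply/funext => t; rewrite /chi indicE; congr (nat_of_bool _)%:R; apply/idP/idP; rewrite inE.
Qed.

Lemma iter_mix m n t : 0 < t -> iter m h (iter n g t) =
  if (m <= n)%N then iter (n - m) g t else iter (m - n) h t.
Proof.
move=> t0; case: leqP => [mn|/ltnW mn].
  rewrite -{1}(subnKC mn) iterD (iter_cancel g_gt0 hK)//.
  exact: iter_gt0.
by rewrite -{1}(subnK mn) iterD (iter_cancel g_gt0 hK).
Qed.

Lemma Isep_h t k : t \in I -> (0 < k)%N -> iter k h t \notin I.
Proof.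
move=> tI k0; apply/negP => hI; have := Isep hI k0; apply/negP; rewrite negbK.
by rewrite (iter_cancel h_gt0 gK)//; exact: Ipos.
Qed.

Lemma chi_orbit m n t : t \in I -> chi (iter m h (iter n g t)) = (m == n)%:R.
Proof.
move=> tI; have t0 := Ipos tI; rewrite /chi iter_mix//; congr (nat_of_bool _)%:R.
case: leqP => mn.
  have [->|ne] := eqVneq m n; first by rewrite subnn.
  by apply/negbTE/Isep => //; rewrite subn_gt0 ltn_neqAle ne.
rewrite (gtn_eqF mn); apply/negbTE/Isep_h => //; by rewrite subn_gt0.
Qed.

(** The images of the wandering interval are pairwise disjoint, so at most one indicator is nonzero
    at [x]. *)
Lemma sum_chi_le1 N x : 0 < x -> \sum_(k < N) chi (iter k h x) <= 1.
Proof.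
move=> x0; have [/existsP[k kI]|] := boolP [exists k : 'I_N, iter k h x \in I].
  rewrite (bigD1 k)//= big1 ?addr0 => [|i ik].
    by rewrite /chi; case: (_ \in _).
  rewrite -[x in iter i h x](iter_cancel h_gt0 gK k x0) chi_orbit//.
  by rewrite (negbTE (_ : (i : nat) != k)).
move=> /existsPn nI; rewrite big1 ?ler01// => i _.
by rewrite /chi (negbTE (nI i)).
Qed.

Let miter k : measurable_fun (@Rplus R) (iter k h).
Proof.
elim: k => [|k ih]; first exact: measurable_id.
have sub : iter k h @` (@Rplus R) `<=` @Rplus R.
  by move=> _ [t /= t0 <-]; exact: iter_gt0.
exact: (measurable_comp measurable_Rplus sub mh ih).
Qed.

Lemma measurable_chi_iter k : measurable_fun (@Rplus R) (fun t => chi (iter k h t)).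
Proof. exact: (measurableT_comp measurable_chi (miter k)). Qed.

(** [chi (iter k h x)] is the indicator of the [k]-th image of [I]. The substitution [iter k g]
    moves the integral back to [I], and the Jacobian enters the [p]-th power through its root
    [jroot]. *)
Lemma slice k (f : R -> R[i]) : cmeas f ->
  (\int[lebesgue_measure]_(x in @Rplus R) (chi (iter k h x) * cmod (f x) `^ p)%:E)%E =
  (\int[lebesgue_measure]_(t in @Rplus R)
     (chi t * (cmod (f (iter k g t)) * jroot k t) `^ p)%:E)%E.
Proof.
move=> mf; have s := weighted_shift_iter k sgj.
have mphi : measurable_fun (@Rplus R) (fun x => (chi (iter k h x) * cmod (f x) `^ p)%:E).
  apply/measurable_EFinP; apply: measurable_funM; last exact: cmeas_powR.
  exact: measurable_chi_iter.
rewrite -(shift_cv s mphi); last first.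
  by move=> x _; rewrite lee_fin mulr_ge0 ?powR_ge0 ?chi_ge0.
apply: eq_integral => t /set_mem t0.
rewrite (iter_cancel g_gt0 hK)// -EFinM powRM ?cmod_ge0 ?(ltW (jroot_gt0 _ _))//.
by rewrite jroot_powR// mulrA.
Qed.

Lemma measurable_slice k (f : R -> R[i]) : cmeas f -> measurable_fun (@Rplus R)
  (fun t => (chi t * (cmod (f (iter k g t)) * jroot k t) `^ p)%:E).
Proof.
move=> mf; have s := weighted_shift_iter k sgj.
apply/measurable_EFinP; apply: measurable_funM; first exact: measurable_funTS measurable_chi.
apply: (measurableT_comp (measurable_powR _)); apply: measurable_funM.
  by apply: cmeas_cmod; exact: (cmeas_shift s mf).
exact: (measurableT_comp (measurable_powR _) (shift_jac_meas s)).
Qed.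

Lemma sum_slice N (f : R -> R[i]) : cmeas f ->
  (\sum_(k < N) \int[lebesgue_measure]_(t in @Rplus R)
     (chi t * (cmod (f (iter k g t)) * jroot k t) `^ p)%:E)%E =
  (\int[lebesgue_measure]_(x in @Rplus R)
     ((\sum_(k < N) chi (iter k h x)) * cmod (f x) `^ p)%:E)%E.
Proof.
move=> mf; transitivity (\sum_(k < N)
  \int[lebesgue_measure]_(x in @Rplus R) (chi (iter k h x) * cmod (f x) `^ p)%:E)%E.
  by apply: eq_bigr => k _; rewrite slice.
rewrite -ge0_integral_sum//.
- by apply: eq_integral => x _; rewrite mulr_suml -sumEFin.
- exact: measurable_Rplus.
- move=> k; apply/measurable_EFinP; apply: measurable_funM; last exact: cmeas_powR.
  exact: measurable_chi_iter.
- by move=> k x _; rewrite lee_fin mulr_ge0 ?powR_ge0 ?chi_ge0.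
Qed.

Let msum N (f : R -> R[i]) : cmeas f -> measurable_fun (@Rplus R)
  (fun x => ((\sum_(k < N) chi (iter k h x)) * cmod (f x) `^ p)%:E).
Proof.
move=> mf; apply/measurable_EFinP; apply: measurable_funM; last exact: cmeas_powR.
by apply: measurable_sum => k; exact: measurable_chi_iter.
Qed.

Lemma sum_slice_le N (f : R -> R[i]) : cmeas f ->
  (\sum_(k < N) \int[lebesgue_measure]_(t in @Rplus R)
     (chi t * (cmod (f (iter k g t)) * jroot k t) `^ p)%:E <= npow p f)%E.
Proof.
move=> mf; rewrite sum_slice//; apply: ge0_le_integral.
- exact: measurable_Rplus.
- by move=> x x0; rewrite lee_fin mulr_ge0 ?powR_ge0 ?sumr_ge0// => k _; exact: chi_ge0.
- exact: msum.
- exact: measurable_npow.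
- by move=> x x0; rewrite lee_fin ler_piMl ?powR_ge0// sum_chi_le1.
Qed.

Lemma sum_slice_eq N (f : R -> R[i]) : cmeas f ->
  (forall x, 0 < x -> (forall k, (k < N)%N -> iter k h x \notin I) -> f x = 0) ->
  (\sum_(k < N) \int[lebesgue_measure]_(t in @Rplus R)
     (chi t * (cmod (f (iter k g t)) * jroot k t) `^ p)%:E = npow p f)%E.
Proof.
move=> mf f0; rewrite sum_slice//; apply: eq_integral => x /set_mem x0.
have [/existsP[k kI]|/existsPn nI] := boolP [exists k : 'I_N, iter k h x \in I].
  suff -> : \sum_(k < N) chi (iter k h x) = 1 by rewrite mul1r.
  rewrite (bigD1 k)//= big1 ?addr0 => [|i ik]; first by rewrite /chi kI.
  rewrite -[x in iter i h x](iter_cancel h_gt0 gK k x0) chi_orbit//.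
  by rewrite (negbTE (_ : (i : nat) != k)).
rewrite f0 ?cmod0 ?powR0 ?mulr0 ?gt_eqF// => k kN.
exact: (nI (Ordinal kN)).
Qed.

(** Division by [jroot] makes the normalised value on the [k]-th image of [I] equal to [x k], so
    that the [p]-th power of the norm is that of the [l^p] norm of [x] times the length of [I]. *)
Definition orbit_fun (x : nat -> R[i]) N (s : R) : R[i] :=
  \sum_(k < N) x k * real_complex R (chi (iter k h s) / jroot k (iter k h s)).

Lemma cmeas_orbit_fun x N : cmeas (orbit_fun x N).
Proof.
apply: cmeas_sum => k; apply: cmeasM; first exact: cmeas_cst.
apply: cmeas_real; apply: measurable_funM; first exact: measurable_chi_iter.
have sub : iter k h @` (@Rplus R) `<=` @Rplus R.
  by move=> _ [t /= t0 <-]; exact: iter_gt0.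
have s := weighted_shift_iter k sgj.
have m1 : measurable_fun (@Rplus R) (fun t => jac_iter g j k t `^ (- p^-1)).
  exact: (measurableT_comp (measurable_powR _) (shift_jac_meas s)).
have := measurable_comp measurable_Rplus sub m1 (miter k).
apply: eq_measurable_fun => t /set_mem t0 /=.
by rewrite powRN.
Qed.

Lemma orbit_funE x N n t : t \in I -> (n < N)%N ->
  orbit_fun x N (iter n g t) * real_complex R (jroot n t) = x n.
Proof.
move=> tI nN; have t0 := Ipos tI.
rewrite /orbit_fun (bigD1 (Ordinal nN))//= big1 ?addr0 => [|k kn].
  rewrite chi_orbit// eqxx (iter_cancel g_gt0 hK)// -mulrA -rmorphM/= mul1r mulVf ?mulr1//.
  by rewrite gt_eqF// jroot_gt0.
by rewrite chi_orbit// (negbTE (_ : (k : nat) != n))// mul0r mulr0.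
Qed.

Lemma orbit_fun_eq0 x N s : (forall k, (k < N)%N -> x k != 0 -> iter k h s \notin I) ->
  orbit_fun x N s = 0.
Proof.
move=> hI; rewrite /orbit_fun big1// => k _.
have [->|xk] := eqVneq (x k) 0; first by rewrite mul0r.
by rewrite /chi (negbTE (hI k _ xk))// mul0r mulr0.
Qed.

End orbit_slices.

Lemma continuous_powR_gt0 {R : realType} (r t : R) : 0 < t ->
  {for t, continuous (fun x : R => x `^ r)}.
Proof.
move=> t0; apply: differentiable_continuous; apply/derivable1_diffP.
by apply: derivable_powR; rewrite in_itv/= t0.
Qed.

(** Continuity of the power settles [e0 > 0]; at [e0 = 0] the increment is explicit. *)
Lemma powR_right_approx {R : realType} (p e0 e : R) : 0 < p -> 0 <= e0 -> 0 < e ->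
  exists2 d, 0 < d & (e0 + d) `^ p <= e0 `^ p + e.
Proof.
move=> p0; rewrite le_eqVlt => /orP[/eqP <-|e00] e_gt0.
  exists (e `^ p^-1); first by rewrite powR_gt0.
  by rewrite add0r -powRrM mulVf ?gt_eqF// powRr1 ?(ltW e_gt0)// lerDr powR_ge0.
have := @continuous_powR_gt0 _ p _ e00 => /cvgr_le/(_ (e0 `^ p + e)).
rewrite ltrDl e_gt0 => /(_ isT) /nbhs_ballP[d /= d0 hd].
exists (d / 2); first by rewrite divr_gt0.
apply: hd; rewrite /ball /= opprD addrA subrr sub0r normrN gtr0_norm ?divr_gt0//.
by rewrite ltr_pdivrMr// ltr_pMr// ltr1n.
Qed.

Lemma near_forall_ltn {T : Type} {F : set_system T} {FF : Filter F} (P : nat -> T -> Prop) N :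
  (forall k, \forall t \near F, P k t) ->
  \forall t \near F, forall k, (k < N)%N -> P k t.
Proof.
move=> FP; elim: N => [|N ih]; first exact: filterE.
apply: filterS2 ih (FP N) => t h1 h2 k; rewrite ltnS leq_eqVlt => /orP[/eqP ->//|].
exact: h1.
Qed.

(** * From the operator to recurrences along orbits *)

Section discrete_estimates.
Context {R : realType}.
Variable p : R.
Hypothesis p_gt1 : 1 < p.
Let p_gt0 : 0 < p. Proof. exact: lt_trans p_gt1. Qed.
Variables (a b : R -> R[i]) (alpha : R -> R).
Hypotheses (Ca : Cb a) (Cbb : Cb b) (Salpha : SOS alpha).
Variable beta : R -> R.
Hypothesis beta1 : forall s, 0 < s -> 0 < beta s /\ alpha (beta s) = s.
Hypothesis beta2 : forall t, 0 < t -> beta (alpha t) = t.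
Local Notation mu := (@lebesgue_measure R).
Local Notation d := (derive1 alpha).
Local Notation jr := (jroot p alpha d).

Let sa : weighted_shift alpha d := SOS_shift Salpha.
Let alpha_gt0 := SOS_gt0 Salpha.
Let beta_gt0 s : 0 < s -> 0 < beta s. Proof. by case/beta1. Qed.
Let alphaK t : 0 < t -> alpha (beta t) = t. Proof. by case/beta1. Qed.
Let mbeta : measurable_fun (@Rplus R) beta := shift_meas (inv_shift Salpha beta1 beta2).

(* The coefficient of [W_alpha] along an orbit once function values are
   multiplied by the [p]-th root of the Jacobian, which makes [W_alpha] a shift
   of [l^p]. *)
Definition wcoef t : R[i] := b t * real_complex R (d t `^ (- p^-1)).

Lemma ccont_wcoef t : 0 < t -> ccont wcoef t.
Proof.
move=> t0; apply: ccontM; first exact: Cb_ccont.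
apply: ccont_real.
apply: (@continuous_comp _ _ _ d (fun x => x `^ (- p^-1))).
  exact: SOS_dcont.
by apply: continuous_powR_gt0; exact: SOS_d_gt0.
Qed.

Lemma iter_alpha_gt0 k t : 0 < t -> 0 < iter k alpha t.
Proof. exact: iter_gt0. Qed.

Lemma iter_alpha_cont k t : 0 < t -> {for t, continuous (iter k alpha)}.
Proof.
move=> t0; elim: k => [|k ih]; first exact: cvg_id.
apply: (@continuous_comp _ _ _ (iter k alpha) alpha) => //.
by apply: SOS_cont => //; exact: iter_alpha_gt0.
Qed.

Lemma ccont_iter (f : R -> R[i]) k t : (forall t, 0 < t -> ccont f t) -> 0 < t ->
  ccont (fun s => f (iter k alpha s)) t.
Proof.
by move=> cf t0; apply: ccont_comp; [exact: iter_alpha_cont|apply/cf/iter_alpha_gt0].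
Qed.

(** In normalised values the operator is bidiagonal, with [a] on the diagonal and [- wcoef] next to
    it: the power of [d] in [wcoef] compensates for the passage from [jr k] to [jr k.+1]. *)
Lemma Aop_orbit (f : R -> R[i]) k t : 0 < t ->
  Aop a b alpha f (iter k alpha t) * real_complex R (jr k t) =
  a (iter k alpha t) * (f (iter k alpha t) * real_complex R (jr k t)) -
  wcoef (iter k alpha t) * (f (iter k.+1 alpha t) * real_complex R (jr k.+1 t)).
Proof.
move=> t0; have dk := SOS_d_gt0 Salpha (iter_alpha_gt0 k t0).
rewrite (jrootS _ sa k t0) /wcoef /Aop /Wop iterS.
set r := d _ in dk *; rewrite powRN.
have r0 : r `^ p^-1 != 0 by rewrite gt_eqF// powR_gt0.
rewrite mulrBl mulrA; congr (_ - _).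
rewrite -!mulrA; congr (_ * _); rewrite mulrCA; congr (_ * _).
by rewrite -!rmorphM/= mulrA mulVf// mul1r.
Qed.

Lemma iter_up_ge (f : R -> R) : (forall t, 0 < t -> 0 < f t) ->
  (forall t, 0 < t -> t < f t) -> forall k t, 0 < t -> (0 < k)%N -> f t <= iter k f t.
Proof.
move=> f0 fu; elim=> // -[|k] ih t t0 _ //; rewrite iterS.
by apply: le_trans (ih t t0 isT) _; apply/ltW/fu; exact: iter_gt0.
Qed.

Lemma iter_dn_le (f : R -> R) : (forall t, 0 < t -> 0 < f t) ->
  (forall t, 0 < t -> f t < t) -> forall k t, 0 < t -> (0 < k)%N -> iter k f t <= f t.
Proof.
move=> f0 fu; elim=> // -[|k] ih t t0 _ //; rewrite iterS.
by apply: le_trans _ (ih t t0 isT); apply/ltW/fu; exact: iter_gt0.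
Qed.

(** Near [t0] the midpoint [c] of [t0] and [alpha t0] separates [t] from [alpha t]. Later iterates
    move on in the same direction, so they never come back to the side of [c] on which the interval
    lies. *)
Lemma wandering_interval (Q : R -> Prop) (t0 : R) : 0 < t0 -> (\forall t \near t0, Q t) ->
  exists u v, [/\ 0 < u, u < v, forall t, t \in `]u, v[ -> Q t &
    forall t k, t \in `]u, v[ -> (0 < k)%N -> iter k alpha t \notin `]u, v[].
Proof.
move=> t00 Qt; pose c := (t0 + alpha t0) / 2.
have sep : exists c, (\forall t \near t0, t < c /\ c < alpha t) /\ (forall t, 0 < t -> t < alpha t)
   \/ (\forall t \near t0, alpha t < c /\ c < t) /\ (forall t, 0 < t -> alpha t < t).
  exists c; have cont := SOS_cont Salpha t00.
  have [up|dn] := sign_of_shift (SOS_cont Salpha) (SOS_neq Salpha).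
    left; split=> //; have [h1 h2] := midf_lt (up _ t00).
    near=> t; split; near: t; first exact: lt_nbhsl.
    exact: (cvgr_gt _ cont).
  right; split=> //; have [h1 h2] := midf_lt (dn _ t00); rewrite addrC -/c in h1 h2.
  near=> t; split; near: t; last exact: lt_nbhsr.
  exact: (cvgr_lt _ cont).
have tpos : \forall t \near t0, t0 / 2 < t.
  by apply: lt_nbhsr; rewrite ltr_pdivrMr// ltr_pMr// ltr1n.
have t2 : 0 < t0 / 2 by rewrite divr_gt0.
have ivl (P : R -> Prop) : (\forall t \near t0, P t) ->
    exists u v, [/\ 0 < u, u < v & forall t, t \in `]u, v[ -> [/\ P t, Q t & 0 < t]].
  move=> Pt; have : \forall t \near t0, [/\ P t, Q t & t0 / 2 < t].
    by near=> t; split; near: t.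
  move=> /nbhs_ballP[e /= e0 he]; exists (t0 - e / 2), (t0 + e / 2).
  have e2 : 0 < e / 2 by rewrite divr_gt0.
  have ee : e / 2 < e by rewrite ltr_pdivrMr// ltr_pMr// ltr1n.
  have hb t : t0 - e / 2 <= t -> t <= t0 + e / 2 -> [/\ P t, Q t & t0 / 2 < t].
    move=> h1 h2; apply: he; rewrite /ball /=; apply: le_lt_trans ee.
    by rewrite ler_distlC; lra.
  split; last 2 first.
  - by rewrite ltrD2l (lt_trans _ e2)// oppr_lt0.
  - move=> t; rewrite in_itv/= => /andP[/ltW h1 /ltW h2].
    by have [? ? h] := hb t h1 h2; split => //; exact: lt_trans h.
  - have [|_ _ h] := hb (t0 - e / 2) (lexx _).
      by lra.
    exact: lt_trans h.
have [c' [[near_c up]|[near_c dn]]] := sep; have [u [v [u0 uv h]]] := ivl _ near_c; exists u, v.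
  split=> // t; first by move=> /h[].
  move=> k tI k0; have [[tc ct] _ tt] := h t tI; apply/negP => kI.
  have [[kc _] _ _] := h _ kI.
  have := iter_up_ge alpha_gt0 up tt k0; apply/negP; rewrite -ltNge.
  exact: lt_trans ct.
split=> // t; first by move=> /h[].
move=> k tI k0; have [[tc ct] _ tt] := h t tI; apply/negP => kI.
have [[_ kc] _ _] := h _ kI.
have := iter_dn_le alpha_gt0 dn tt k0; apply/negP; rewrite -ltNge.
exact: lt_trans kc.
Unshelve. all: by end_near. Qed.

Section fixed_interval.
Variables u v : R.
Hypotheses (u_gt0 : 0 < u) (uv : u < v).
Let I : interval R := `]u, v[.
Hypothesis Isep : forall t k, t \in I -> (0 < k)%N -> iter k alpha t \notin I.
Let Ipos t : t \in I -> 0 < t.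
Proof. by rewrite in_itv/= => /andP[h _]; exact: lt_trans h. Qed.

Let int_chi_cst c : 0 <= c ->
  (\int[mu]_(t in @Rplus R) (chi I t * c)%:E = (c * (v - u))%:E)%E.
Proof.
move=> c0; transitivity (\int[mu]_(t in @Rplus R) (c%:E * (chi I t)%:E))%E.
  by apply: eq_integral => t _; rewrite mulrC EFinM.
have mchi : measurable_fun (@Rplus R) (fun t => (chi I t)%:E : \bar R).
  by apply/measurable_EFinP; exact: measurable_funTS (measurable_chi I).
rewrite ge0_integralZl_EFin//; last 2 first.
- exact: measurable_Rplus.
- by move=> t _; rewrite lee_fin chi_ge0.
have -> : (\int[mu]_(t in @Rplus R) (chi I t)%:E =
    \int[mu]_(t in @Rplus R) (\1_([set` I]) t)%:E)%E.
  apply: eq_integral => t _; rewrite /chi indicE; congr (nat_of_bool _)%:R%:E.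
  by apply/idP/idP; rewrite inE.
rewrite integral_indic; [|exact: measurable_Rplus|exact: measurable_itv].
rewrite setIidl; last by move=> t /Ipos.
have := @lebesgue_measure_itv R I; rewrite /= lte_fin uv => ->.
by rewrite EFinM EFinB.
Qed.

Let F (f : R -> R[i]) k t := f (iter k alpha t) * real_complex R (jr k t).

Let slices (f : R -> R[i]) k : R -> R :=
  fun t => chi I t * (cmod (f (iter k alpha t)) * jr k t) `^ p.

Let slicesE f k t : 0 < t -> slices f k t = chi I t * cmod (F f k t) `^ p.
Proof.
by move=> t0; rewrite /slices /F cmodM cmod_real ger0_norm// ltW// (jroot_gt0 p sa).
Qed.

Let mslices f k : cmeas f -> measurable_fun (@Rplus R) (fun t => (slices f k t)%:E).
Proof. by move=> mf; exact: (measurable_slice p sa I k mf). Qed.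

Let int_slice_le f k c : cmeas f -> 0 <= c -> (forall t, t \in I -> cmod (F f k t) <= c) ->
  (\int[mu]_(t in @Rplus R) (slices f k t)%:E <= (c `^ p * (v - u))%:E)%E.
Proof.
move=> mf c0 fc; rewrite -(int_chi_cst (powR_ge0 c p)); apply: ge0_le_integral.
- exact: measurable_Rplus.
- by move=> t _; rewrite lee_fin mulr_ge0 ?chi_ge0 ?powR_ge0.
- exact: mslices.
- apply/measurable_EFinP; apply: measurable_funM; last exact: measurable_cst.
  exact: measurable_funTS (measurable_chi I).
- move=> t t0; rewrite lee_fin slicesE//.
  rewrite /chi; have [tI|tI] := boolP (t \in I); last by rewrite !mul0r.
  rewrite !mul1r; apply: ge0_ler_powR; rewrite ?nnegrE ?cmod_ge0// ?(ltW p_gt0)//.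
  exact: fc.
Qed.

Let int_slice_eq f k c : (forall t, t \in I -> cmod (F f k t) = c) ->
  (\int[mu]_(t in @Rplus R) (slices f k t)%:E = (c `^ p * (v - u))%:E)%E.
Proof.
move=> fc; rewrite -(int_chi_cst (powR_ge0 c p)); apply: eq_integral => t /set_mem t0.
rewrite slicesE// /chi; have [tI|tI] := boolP (t \in I); last by rewrite !mul0r.
by rewrite fc.
Qed.

Lemma npow_orbit_fun (x : nat -> R[i]) N :
  npow p (orbit_fun p alpha d beta I x N) =
  ((\sum_(k < N) cmod (x k) `^ p) * (v - u))%:E.
Proof.
have mf := cmeas_orbit_fun p sa beta_gt0 mbeta I x N.
rewrite -(sum_slice_eq p_gt1 sa beta_gt0 beta2 alphaK mbeta Ipos Isep mf (N := N)).
  rewrite mulr_suml -sumEFin; apply: eq_bigr => k _.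
  apply: int_slice_eq => t tI.
  by rewrite /F (orbit_funE p sa beta_gt0 beta2 alphaK Ipos Isep).
move=> s s0 hs; apply: orbit_fun_eq0 => k kN _; exact: hs.
Qed.

Lemma npow_Aop_orbit_fun (x : nat -> R[i]) N (e : nat -> R) : x 0%N = 0 -> x N.+1 = 0 ->
  (forall k, 0 <= e k) ->
  (forall k t, (k <= N)%N -> t \in I ->
    cmod (a (iter k alpha t) * x k - wcoef (iter k alpha t) * x k.+1) <= e k) ->
  (npow p (Aop a b alpha (orbit_fun p alpha d beta I x N.+2)) <=
   ((\sum_(k < N.+1) e k `^ p) * (v - u))%:E)%E.
Proof.
move=> x0 xN e0 he; set f := orbit_fun _ _ _ _ _ _ _.
have mf : cmeas f by exact: (cmeas_orbit_fun p sa beta_gt0 mbeta I x).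
have mAf : cmeas (Aop a b alpha f) by exact: (cmeas_Aop sa (Cb_cmeas Ca) (Cb_cmeas Cbb) mf).
rewrite -(sum_slice_eq p_gt1 sa beta_gt0 beta2 alphaK mbeta Ipos Isep mAf (N := N.+1)).
  rewrite mulr_suml -sumEFin; apply: lee_sum => k _.
  apply: int_slice_le => // t tI; rewrite /F Aop_orbit; last exact: Ipos.
  have kN := ltn_ord k.
  rewrite !(orbit_funE p sa beta_gt0 beta2 alphaK Ipos Isep)//; last exact: ltnW.
  exact: he.
(* If [f (alpha s)] comes from slice [k.+1], then [s] lies on slice [k], which is excluded; slice
   [0] would put [s] before the orbit segment, but [x 0 = 0]. The last slice contributes nothing
   because [x N.+1 = 0]. *)
move=> s s0 hs; rewrite /Aop /Wop.
have -> : f s = 0.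
  apply: orbit_fun_eq0 => k; rewrite ltnS leq_eqVlt => /orP[/eqP ->|kN _].
    by rewrite xN eqxx.
  exact: hs.
have -> : f (alpha s) = 0; last by rewrite !mulr0 subrr.
apply: orbit_fun_eq0 => -[|k]; first by rewrite x0 eqxx.
by rewrite ltnS => kN _; rewrite iterSr beta2//; exact: hs.
Qed.

(** The solution [f] for the delta sequence at [m] is paired with [z], and summation by parts moves
    the recurrence onto its transpose acting on [z]. On almost every orbit each value of [f] is at
    most the [l^p] norm of all of them; integration over [I] then brings in the norm of [f]. *)
Lemma dual_slice_bound (f : R -> R[i]) (C : R) m N (z : nat -> R[i]) (S : R) :
  cmeas f -> 0 <= C -> (m <= N)%N ->
  (npow p f <= C%:E * npow p (orbit_fun p alpha d beta I (fun k => (k == m)%:R) N.+1))%E ->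
  ae_Rplus (fun t => Aop a b alpha f t =
    orbit_fun p alpha d beta I (fun k => (k == m)%:R) N.+1 t) ->
  z 0%N = 0 -> z N.+1 = 0 -> 0 <= S ->
  (forall t, t \in I -> \sum_(k < N.+1) cmod (a (iter k.+1 alpha t) * z k.+1
     - wcoef (iter k alpha t) * z k) <= S) ->
  cmod (z m) `^ p <= S `^ p * C.
Proof.
move=> mf C0 mN fC Af z0 zN S0 hS.
rewrite npow_orbit_fun in fC.
have sum1 : \sum_(k < N.+1) cmod ((k == m :> nat)%:R : R[i]) `^ p = 1.
  have mN1 : (m < N.+1)%N by [].
  rewrite (bigD1 (Ordinal mN1))//= eqxx cmod1 powR1 big1 ?addr0// => k km.
  by rewrite (negbTE (_ : (k : nat) != m))// cmod0 powR0// gt_eqF.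
rewrite sum1 mul1r -EFinM in fC.
have aeF : ae_Rplus (fun t => forall k, Aop a b alpha f (iter k alpha t) =
    orbit_fun p alpha d beta I (fun k => (k == m)%:R) N.+1 (iter k alpha t)).
  by apply: ae_Rplus_foralln => k; exact: (ae_shift (weighted_shift_iter k sa) Af).
have key t : t \in I -> (forall k, Aop a b alpha f (iter k alpha t) =
    orbit_fun p alpha d beta I (fun k => (k == m)%:R) N.+1 (iter k alpha t)) ->
    cmod (z m) `^ p <= S `^ p * \sum_(k < N.+2) cmod (F f k t) `^ p.
  move=> tI h; have t0 := Ipos tI.
  have eqk k : (k < N.+1)%N -> a (iter k alpha t) * F f k t -
      wcoef (iter k alpha t) * F f k.+1 t = (k == m)%:R.
    move=> kN; rewrite /F -Aop_orbit// h.
    by rewrite (orbit_funE p sa beta_gt0 beta2 alphaK Ipos Isep).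
  have zE : z m = \sum_(k < N.+1) F f k.+1 t *
      (a (iter k.+1 alpha t) * z k.+1 - wcoef (iter k alpha t) * z k).
    transitivity (\sum_(k < N.+1) z k * (a (iter k alpha t) * F f k t -
        wcoef (iter k alpha t) * F f k.+1 t)).
      rewrite (eq_bigr (fun k : 'I_N.+1 => z k * (k == m :> nat)%:R)); last first.
        by move=> k _; rewrite eqk.
      have mN1 : (m < N.+1)%N by [].
      rewrite (bigD1 (Ordinal mN1))//= eqxx mulr1 big1 ?addr0// => k km.
      by rewrite (negbTE (_ : (k : nat) != m))// mulr0.
    rewrite (eq_bigr (fun k : 'I_N.+1 => z k * a (iter k alpha t) * F f k t -
        z k * wcoef (iter k alpha t) * F f k.+1 t)); last first.
      by move=> k _; ring.
    rewrite [RHS](eq_bigr (fun k : 'I_N.+1 => z k.+1 * a (iter k.+1 alpha t) * F f k.+1 t -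
        z k * wcoef (iter k alpha t) * F f k.+1 t)); last first.
      by move=> k _; ring.
    rewrite !sumrB; congr (_ - _).
    (* The sums of the [a]-terms differ by one index, and the boundary terms vanish as [z 0 = 0] and
       [z N.+1 = 0]. *)
    rewrite big_ord_recl /= z0 !mul0r add0r [RHS]big_ord_recr/= zN !mul0r addr0.
    by apply: eq_bigr => k _.
  pose Phi := (\sum_(k < N.+2) cmod (F f k t) `^ p) `^ p^-1.
  have sum0 : 0 <= \sum_(k < N.+2) cmod (F f k t) `^ p by apply: sumr_ge0 => k _; exact: powR_ge0.
  have FPhi k : (k < N.+2)%N -> cmod (F f k t) <= Phi.
    move=> kN; rewrite -[leLHS]powRr1 ?cmod_ge0// -(mulfV (lt0r_neq0 p_gt0)) powRrM.
    apply: ge0_ler_powR; rewrite ?nnegrE ?invr_ge0 ?powR_ge0 ?(ltW p_gt0)//.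
    rewrite (bigD1 (Ordinal kN))//= lerDl; apply: sumr_ge0 => i _; exact: powR_ge0.
  have zPhi : cmod (z m) <= S * Phi.
    rewrite zE; apply: le_trans (ler_cmod_sum _ _) _.
    apply: (@le_trans _ _ (\sum_(k < N.+1) cmod (a (iter k.+1 alpha t) * z k.+1
        - wcoef (iter k alpha t) * z k) * Phi)).
      apply: ler_sum => k _; rewrite cmodM mulrC ler_wpM2l ?cmod_ge0// FPhi//.
      by rewrite ltnS ltn_ord.
    by rewrite -mulr_suml ler_wpM2r ?powR_ge0 ?hS.
  have -> : \sum_(k < N.+2) cmod (F f k t) `^ p = Phi `^ p.
    by rewrite /Phi -powRrM mulVf ?gt_eqF// powRr1.
  rewrite -powRM ?powR_ge0//; apply: ge0_ler_powR; rewrite ?nnegrE ?cmod_ge0 ?(ltW p_gt0)//.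
  by rewrite mulr_ge0 ?powR_ge0.
have vu0 : 0 < v - u by rewrite subr_gt0.
have : ((cmod (z m) `^ p * (v - u))%:E <= (S `^ p)%:E * (C * (v - u))%:E)%E.
  apply: (@le_trans _ _ ((S `^ p)%:E * \sum_(k < N.+2)
     \int[mu]_(t in @Rplus R) (slices f k t)%:E)%E); last first.
    apply: lee_wpmul2l; first by rewrite lee_fin powR_ge0.
    apply: le_trans fC.
    exact: (sum_slice_le p_gt1 sa beta_gt0 beta2 alphaK mbeta Ipos Isep).
  rewrite -ge0_integral_sum//; last 3 first.
  - exact: measurable_Rplus.
  - by move=> k; exact: mslices.
  - by move=> k t t0; rewrite lee_fin mulr_ge0 ?chi_ge0 ?powR_ge0.
  rewrite -ge0_integralZl_EFin ?powR_ge0//; last 3 first.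
  - exact: measurable_Rplus.
  - by move=> t t0; apply: sume_ge0 => k _; rewrite lee_fin mulr_ge0 ?chi_ge0 ?powR_ge0.
  - by apply: emeasurable_sum => k; exact: mslices.
  rewrite -(int_chi_cst (powR_ge0 _ _)); apply: ae_ge0_le_integral.
  - exact: measurable_Rplus.
  - by move=> t t0; rewrite lee_fin mulr_ge0 ?chi_ge0 ?powR_ge0.
  - apply/measurable_EFinP; apply: measurable_funM; last exact: measurable_cst.
    exact: measurable_funTS (measurable_chi I).
  - move=> t t0; apply: mule_ge0; first by rewrite lee_fin powR_ge0.
    by apply: sume_ge0 => k _; rewrite lee_fin mulr_ge0 ?chi_ge0 ?powR_ge0.
  - by apply: measurable_funeM; apply: emeasurable_sum => k; exact: mslices.
  - apply: (aeS _ aeF) => t t0 h.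
    rewrite sumEFin -EFinM lee_fin; have [tI|tI] := boolP (t \in I).
      rewrite (eq_bigr (fun k : 'I_N.+2 => cmod (F f k t) `^ p)); last first.
        by move=> k _; rewrite slicesE// /chi tI mul1r.
      by rewrite /chi tI mul1r; exact: key.
    rewrite /chi (negbTE tI) mul0r mulr_ge0 ?powR_ge0// sumr_ge0// => k _.
    by rewrite /slices mulr_ge0 ?chi_ge0 ?powR_ge0.
by rewrite -EFinM lee_fin mulrA ler_pM2r.
Qed.

End fixed_interval.

Let ma := Cb_cmeas Ca.
Let mb := Cb_cmeas Cbb.

(** Surjectivity yields a solution [f'] of [A f' = A f] that carries the norm bound, and injectivity
    identifies it with [f]. As the sign of the given constant is unknown, it is replaced by
    [Num.max c 0]. *)
Lemma invertible_lower_bound : invertible_Lp p (Aop a b alpha) ->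
  exists2 C, 0 <= C & forall f, cmeas f -> (npow p f < +oo)%E ->
    (npow p f <= C%:E * npow p (Aop a b alpha f))%E.
Proof.
move=> [toLp [_ [inj [c surj]]]]; exists (Num.max c 0 `^ p); first exact: powR_ge0.
move=> f mf f1; have Lf : inLp p f by apply/(inLpE p_gt1).
have LAf := toLp f Lf; have [f' [Lf' [Af' f'le]]] := surj _ LAf.
have [mf' f'1] := (inLpE p_gt1 f').1 Lf'.
have d1 : (npow p (fun t => (f t - f' t)%R) < +oo)%E.
  have f'N : (npow p (fun t => (- f' t)%R) < +oo)%E by rewrite npowN.
  exact: (npowD_lty p_gt1 mf (cmeasN mf') f1 f'N).
have d0 : ae_zero (fun t => f t - f' t).
  apply: inj; first by apply/(inLpE p_gt1); split => //; exact: cmeasB.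
  apply: (aeS _ Af') => t t0; rewrite /Aop /Wop => e.
  transitivity (- (a t * f' t - b t * f' (alpha t) - (a t * f t - b t * f (alpha t)))); first by ring.
  by rewrite e oppr0.
rewrite (npow_ae_eq p mf mf'); last exact/ae_zeroB_eq.
apply: (npow_le_Lpnorm p_gt1); first by rewrite le_max lexx orbT.
apply: le_trans f'le _; apply: lee_wpmul2r; first exact: Lpnorm_ge0.
by rewrite lee_fin le_max lexx.
Qed.

Lemma invertible_solution : invertible_Lp p (Aop a b alpha) ->
  exists2 C, 0 <= C & forall h, cmeas h -> (npow p h < +oo)%E -> exists f,
    [/\ cmeas f, (npow p f <= C%:E * npow p h)%E &
      ae_Rplus (fun t => Aop a b alpha f t = h t)].
Proof.
move=> [_ [_ [_ [c surj]]]]; exists (Num.max c 0 `^ p); first exact: powR_ge0.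
move=> h mh h1; have Lh : inLp p h by apply/(inLpE p_gt1).
have [f [Lf [Af fle]]] := surj _ Lh.
have [mf f1] := (inLpE p_gt1 f).1 Lf; exists f; split => //; last exact/ae_zeroB_eq.
apply: (npow_le_Lpnorm p_gt1); first by rewrite le_max lexx orbT.
apply: le_trans fle _; apply: lee_wpmul2r; first exact: Lpnorm_ge0.
by rewrite lee_fin le_max lexx.
Qed.

Lemma ccont_near_le (f : R -> R[i]) (t0 e : R) : ccont f t0 -> 0 < e ->
  \forall t \near t0, cmod (f t) <= cmod (f t0) + e.
Proof.
move=> /ccont_cmod cf e0; have /cvgr_le/(_ (cmod (f t0) + e)) := cf.
by rewrite ltrDl e0 => /(_ isT).
Qed.

(* Both bounds test the operator on functions living on the orbit of a small
   wandering interval around [t0] and let the interval shrink to [t0]. *)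
Lemma orbit_lower_bound : invertible_Lp p (Aop a b alpha) ->
  exists2 C, 0 <= C & forall (t0 : R) N (x : nat -> R[i]), 0 < t0 ->
    x 0%N = 0 -> x N.+1 = 0 ->
    \sum_(k < N.+2) cmod (x k) `^ p <= C * \sum_(k < N.+1)
      cmod (a (iter k alpha t0) * x k - wcoef (iter k alpha t0) * x k.+1) `^ p.
Proof.
move=> /invertible_lower_bound[C C0 lb]; exists C => // t0 N x t00 x0 xN.
pose E k t := a (iter k alpha t) * x k - wcoef (iter k alpha t) * x k.+1.
have cE k : ccont (E k) t0.
  have c1 := ccont_iter k (fun t tt => Cb_ccont Ca tt) t00.
  have c2 := ccont_iter k ccont_wcoef t00.
  exact: ccontB (ccontM c1 (ccont_cst _ _)) (ccontM c2 (ccont_cst _ _)).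
apply/ler_addgt0Pr => e e_gt0.
(* Each of the [N.+1] terms may exceed its value at [t0] by [eta]; multiplied by [C] the total stays
   below [e], and the summand [1] keeps the denominator positive. *)
pose eta := e / (C * N.+1%:R + 1).
have den : 0 < C * N.+1%:R + 1 by rewrite ltr_wpDl// mulr_ge0.
have eta0 : 0 < eta by rewrite divr_gt0.
have /choice[dl dlP] : forall k, exists dl : R, 0 < dl /\
    (cmod (E k t0) + dl) `^ p <= cmod (E k t0) `^ p + eta.
  by move=> k; have [dl h1 h2] := powR_right_approx p_gt0 (cmod_ge0 (E k t0)) eta0; exists dl.
have nearE : \forall t \near t0, forall k, (k < N.+1)%N ->
    cmod (E k t) <= cmod (E k t0) + dl k.
  apply: (@near_forall_ltn R (nbhs t0) _ (fun k t => cmod (E k t) <= cmod (E k t0) + dl k)).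
  by move=> k; apply: ccont_near_le; [exact: cE|case: (dlP k)].
have [u [v [u0 uv IE Isep]]] := wandering_interval t00 nearE.
have eb : forall k, 0 <= cmod (E k t0) + dl k.
  by move=> k; rewrite addr_ge0 ?cmod_ge0// ltW//; case: (dlP k).
have h1 := @npow_Aop_orbit_fun u v u0 uv Isep x N _ x0 xN eb
  (fun k t kN tI => IE t tI k kN).
have mf := cmeas_orbit_fun p sa beta_gt0 mbeta `]u, v[ x N.+2.
have fE := npow_orbit_fun u0 uv Isep x N.+2.
have flt : (npow p (orbit_fun p alpha d beta `]u, v[ x N.+2) < +oo)%E by rewrite fE ltry.
have := le_trans (lb _ mf flt) (lee_wpmul2l (_ : (0 <= C%:E)%E) h1).
rewrite fE lee_fin => /(_ C0); rewrite -EFinM lee_fin mulrA ler_pM2r ?subr_gt0// => h.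
apply: le_trans h _; apply: (@le_trans _ _ (C * \sum_(k < N.+1) (cmod (E k t0) `^ p + eta))).
  by rewrite ler_wpM2l// ler_sum// => k _; case: (dlP k).
rewrite big_split/= mulrDr lerD2l sumr_const card_ord -mulr_natr.
rewrite mulrCA mulrA -mulrA /eta mulrAC ler_pdivrMr// ler_pM2l//.
by rewrite lerDl.
Qed.

Lemma orbit_dual_bound : invertible_Lp p (Aop a b alpha) ->
  exists2 C, 0 <= C & forall (t0 : R) N (z : nat -> R[i]) m, 0 < t0 ->
    z 0%N = 0 -> z N.+1 = 0 -> (m <= N)%N ->
    cmod (z m) <= C * \sum_(k < N.+1)
      cmod (a (iter k.+1 alpha t0) * z k.+1 - wcoef (iter k alpha t0) * z k).
Proof.
move=> /invertible_solution[C C0 sol]; exists (C `^ p^-1); first exact: powR_ge0.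
move=> t0 N z m t00 z0 zN mN.
pose E k t := a (iter k.+1 alpha t) * z k.+1 - wcoef (iter k alpha t) * z k.
have cE k : ccont (E k) t0.
  have c1 := ccont_iter k.+1 (fun t tt => Cb_ccont Ca tt) t00.
  have c2 := ccont_iter k ccont_wcoef t00.
  exact: ccontB (ccontM c1 (ccont_cst _ _)) (ccontM c2 (ccont_cst _ _)).
apply/ler_addgt0Pr => e e_gt0; set C' := C `^ p^-1.
have C'0 : 0 <= C' by exact: powR_ge0.
pose eta := e / (C' * N.+1%:R + 1).
have den : 0 < C' * N.+1%:R + 1 by rewrite ltr_wpDl// mulr_ge0.
have eta0 : 0 < eta by rewrite divr_gt0.
have nearE : \forall t \near t0, forall k, (k < N.+1)%N ->
    cmod (E k t) <= cmod (E k t0) + eta.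
  apply: (@near_forall_ltn R (nbhs t0) _ (fun k t => cmod (E k t) <= cmod (E k t0) + eta)).
  by move=> k; apply: ccont_near_le; [exact: cE|].
have [u [v [u0 uv IE Isep]]] := wandering_interval t00 nearE.
pose x k : R[i] := (k == m)%:R.
have mg := cmeas_orbit_fun p sa beta_gt0 mbeta `]u, v[ x N.+1.
have [|f [mf fC Af]] := sol _ mg.
  by rewrite (npow_orbit_fun u0 uv Isep) ltry.
pose S := \sum_(k < N.+1) (cmod (E k t0) + eta).
have S0 : 0 <= S by apply: sumr_ge0 => k _; rewrite addr_ge0 ?cmod_ge0// ltW.
have hS t : t \in `]u, v[ -> \sum_(k < N.+1) cmod (E k t) <= S.
  by move=> tI; apply: ler_sum => k _; exact: (IE t tI k (ltn_ord k)).
have h := dual_slice_bound u0 uv Isep mf C0 mN fC Af z0 zN S0 hS.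
have zS : cmod (z m) <= C' * S.
  rewrite leNgt; apply/negP => lt.
  have := gt0_ltr_powR p_gt0 _ _ lt; rewrite !nnegrE cmod_ge0 mulr_ge0// => /(_ isT isT).
  rewrite powRM// -powRrM mulVf ?gt_eqF// powRr1// mulrC ltNge.
  by rewrite h.
apply: le_trans zS _; rewrite /S big_split/= mulrDr lerD2l sumr_const card_ord -mulr_natr.
rewrite mulrCA mulrA -mulrA /eta mulrAC ler_pdivrMr// ler_pM2l//.
by rewrite lerDl.
Qed.

End discrete_estimates.

(** * Necessity of the conditions *)

Section ends_of_the_half_line.
Context {R : realType}.

(* [true] stands for the end [+oo] and [false] for the end [0]. *)
Definition eventually_at (e : bool) (P : R -> Prop) : Prop :=
  if e then exists2 y, 0 < y & forall t, y <= t -> P t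
  else exists2 x, 0 < x & forall t, 0 < t -> t <= x -> P t.

Definition end_filter (e : bool) : set_system R := if e then +oo else (0:R)^'+.

Lemma eventually_atP e (P : R -> Prop) :
  (\forall t \near end_filter e, P t) <-> eventually_at e P.
Proof.
case: e => /=; split.
- exact: near_pinftyP.
- move=> [y y0 h]; near=> t; apply: h; near: t.
  by apply: nbhs_pinfty_ge; exact: num_real.
- exact: near_right0P.
- move=> [x x0 h]; near=> t; apply: h; near: t; first exact: nbhs_right_gt.
  exact: nbhs_right_le.
Unshelve. all: by end_near. Qed.

Lemma eventually_atS e (P Q : R -> Prop) : (forall t, 0 < t -> P t -> Q t) ->
  eventually_at e P -> eventually_at e Q.
Proof.
case: e => PQ /= [y y0 h]; exists y => // t.
  by move=> yt; apply: PQ (h t yt); exact: lt_le_trans yt.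
by move=> t0 ty; apply: PQ (h t t0 ty).
Qed.

Lemma eventually_atI e (P Q : R -> Prop) : eventually_at e P ->
  eventually_at e Q -> eventually_at e (fun t => P t /\ Q t).
Proof.
case: e => /= -[x x0 h] [y y0 h'].
  by exists (Num.max x y); rewrite ?lt_max ?x0// => t; rewrite ge_max => /andP[? ?]; split; [exact: h|exact: h'].
by exists (Num.min x y); rewrite ?lt_min ?x0// => t t0; rewrite le_min => /andP[? ?]; split; [exact: h|exact: h'].
Qed.

Lemma eventually_atW e (P : R -> Prop) : (forall t, 0 < t -> P t) -> eventually_at e P.
Proof.
case: e => h /=; exists 1 => // t; first by move=> t1; apply: h; exact: lt_le_trans t1.
by move=> t0 _; exact: h.
Qed.

Lemma eventually_at_comparable e (P : R -> Prop) e0 e1 : 0 < e0 -> 0 < e1 ->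
  eventually_at e P ->
  eventually_at e (fun t => forall s, e0 * t <= s -> s <= e1 * t -> P s).
Proof.
case: e => /= e00 e10 [x x0 h].
  exists (x / e0); first by rewrite divr_gt0.
  move=> t xt s ts _; apply: h; apply: le_trans ts.
  by rewrite mulrC -ler_pdivrMr.
exists (x / e1); first by rewrite divr_gt0.
move=> t t0 tx s ts st; apply: h.
  by apply: lt_le_trans ts; rewrite mulr_gt0.
by apply: le_trans st _; rewrite mulrC -ler_pdivlMr.
Qed.

(** The ends have connected neighbourhoods, on which a continuous function bounded away from zero
    keeps its sign. *)
Lemma eventually_at_sign e (D : R -> R) eta : (forall t, 0 < t -> {for t, continuous D}) ->
  0 < eta -> eventually_at e (fun t => eta <= `|D t|) ->
  eventually_at e (fun t => eta <= D t) \/ eventually_at e (fun t => D t <= - eta).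
Proof.
move=> cD eta0.
have seg (J : R -> Prop) : (forall t, J t -> 0 < t) ->
    (forall s t u, J s -> J t -> s <= u -> u <= t -> J u) ->
    (forall t, J t -> eta <= `|D t|) ->
    (forall t, J t -> eta <= D t) \/ (forall t, J t -> D t <= - eta).
  move=> J0 Jc JD.
  have cases t : J t -> eta <= D t \/ D t <= - eta.
    by move=> /JD; rewrite ler_normr => /orP[->|]; [left|rewrite lerNr; right].
  have nozero s t : J s -> J t -> s <= t -> Num.min (D s) (D t) <= 0 -> 0 <= Num.max (D s) (D t) -> False.
    move=> Js Jt st h1 h2; have [||c] := @IVT R D s t 0 st.
    - apply: (@continuous_subspaceW _ _ _ (@Rplus R)).
        move=> x /=; rewrite in_itv/= /Rplus/= => /andP[h _].
        by apply: lt_le_trans h; exact: J0.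
      exact: within_Rplus.
    - by rewrite h1.
    - rewrite in_itv/= => /andP[sc ct] Dc0.
      have := JD c (Jc s t c Js Jt sc ct); rewrite Dc0 normr0 leNgt.
      by rewrite eta0.
  have [|] := pselect (exists2 s, J s & D s <= - eta); last first.
    move=> h; left => t Jt; have [//|dt] := cases t Jt.
    by exfalso; apply: h; exists t.
  move=> [s Js Ds]; right => t Jt; have [dt|//] := cases t Jt; exfalso.
  have Ds0 : D s <= 0 by apply: le_trans Ds _; rewrite oppr_le0 ltW.
  have Dt0 : 0 <= D t by apply: le_trans dt; exact: ltW.
  have [st|/ltW ts] := leP s t.
    by apply: (nozero s t Js Jt st); rewrite ?ge_min ?le_max ?Ds0 ?Dt0 ?orbT.
  by apply: (nozero t s Jt Js ts); rewrite ?ge_min ?le_max ?Ds0 ?Dt0 ?orbT.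
case: e => /= -[x x0 h].
  have [|||h1|h1] := seg (fun t => x <= t).
  - by move=> t xt; exact: lt_le_trans xt.
  - by move=> s t u xs _ su _; exact: le_trans su.
  - exact: h.
  - by left; exists x.
  - by right; exists x.
have [|||h1|h1] := seg (fun t => 0 < t /\ t <= x).
- by move=> t [].
- by move=> s t u [s0 _] [_ tx] su ut; split; [exact: lt_le_trans su|exact: le_trans tx].
- by move=> t [? ?]; exact: h.
- by left; exists x => // t ? ?; exact: h1.
- by right; exists x => // t ? ?; exact: h1.
Qed.

End ends_of_the_half_line.

Section orbits.
Context {R : realType}.
Variable f : R -> R.
Hypothesis f_gt0 : forall t, 0 < t -> 0 < f t.
Hypothesis f_cont : forall t, 0 < t -> {for t, continuous f}.

(** A bounded increasing orbit would approach its supremum [L]; by continuity [f > L] near [L], so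
    the next point of the orbit would lie beyond [L]. *)
Lemma iter_up_unbounded (t B : R) : (forall t, 0 < t -> t < f t) -> 0 < t ->
  exists K, forall k, (K <= k)%N -> B <= iter k f t.
Proof.
move=> up t0.
have mono k l : (k <= l)%N -> iter k f t <= iter l f t.
  move=> kl; rewrite -(subnK kl); elim: (l - k)%N => // n ih.
  by apply: le_trans ih _; rewrite addSn iterS; apply/ltW/up/iter_gt0.
suff [K hK] : exists K, B <= iter K f t.
  by exists K => k Kk; apply: le_trans hK _; exact: mono.
apply: contrapT => nB.
have ltB k : iter k f t < B by rewrite ltNge; apply/negP => h; apply: nB; exists k.
pose S := [set iter k f t | k in [set: nat]].
have Ssup : has_sup S.
  by split; [exists t, 0%N|exists B => _ [k _ <-]; exact/ltW].
pose L := sup S.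
have tL k : iter k f t <= L by apply: sup_ubound; [by case: Ssup|exists k].
have L0 : 0 < L by apply: lt_le_trans t0 (tL 0%N).
have := f_cont L0 => /cvgr_gt/(_ L (up L L0)) /nbhs_ballP[e /= e0 he].
have [_ [k _ <-] Lk] := sup_adherent e0 Ssup.
have : L < iter k.+1 f t.
  rewrite iterS; apply: he; rewrite /ball /= ger0_norm ?subr_ge0//.
  by rewrite ltrBlDr addrC -ltrBlDr.
by rewrite ltNge tL.
Qed.

Lemma iter_dn_small (t B : R) : (forall t, 0 < t -> f t < t) -> 0 < t -> 0 < B ->
  exists K, forall k, (K <= k)%N -> iter k f t <= B.
Proof.
move=> dn t0 B0.
have mono k l : (k <= l)%N -> iter l f t <= iter k f t.
  move=> kl; rewrite -(subnK kl); elim: (l - k)%N => // n ih.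
  by apply: le_trans _ ih; rewrite addSn iterS; apply/ltW/dn/iter_gt0.
suff [K hK] : exists K, iter K f t <= B.
  by exists K => k Kk; apply: le_trans hK; exact: mono.
apply: contrapT => nB.
have ltB k : B < iter k f t by rewrite ltNge; apply/negP => h; apply: nB; exists k.
pose S := [set iter k f t | k in [set: nat]].
have Sinf : has_inf S.
  by split; [exists t, 0%N|exists B => _ [k _ <-]; exact/ltW].
pose L := inf S.
have tL k : L <= iter k f t by apply: inf_lbound; [by case: Sinf|exists k].
have L0 : 0 < L.
  apply: lt_le_trans B0 _; apply: lb_le_inf; first by case: Sinf.
  by move=> _ [k _ <-]; exact/ltW.
have := f_cont L0 => /cvgr_lt/(_ L (dn L L0)) /nbhs_ballP[e /= e0 he].
have [_ [k _ <-] Lk] := inf_adherent e0 Sinf.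
have : iter k.+1 f t < L.
  rewrite iterS; apply: he; rewrite /ball /= distrC ger0_norm ?subr_ge0//.
  by rewrite ltrBlDr addrC.
by rewrite ltNge tL.
Qed.

Lemma orbit_eventually e (P : R -> Prop) t :
  (forall t, 0 < t -> if e then t < f t else f t < t) -> 0 < t ->
  eventually_at e P -> exists K, forall k, (K <= k)%N -> P (iter k f t).
Proof.
case: e => /= dir t0 [x x0 h].
  have [K hK] := iter_up_unbounded x dir t0.
  by exists K => k /hK; exact: h.
have [K hK] := iter_dn_small dir t0 x0.
by exists K => k /hK; apply: h; exact: iter_gt0.
Qed.

End orbits.

(** Applied to the zeros of a coefficient: beyond the last one the recurrence can be solved along
    the orbit by division. *)
Lemma last_zero {R : realType} (f : R -> R) (P : R -> Prop) (t : R) K :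
  (forall t, 0 < t -> 0 < f t) -> 0 < t -> P t ->
  (forall k, (K <= k)%N -> ~ P (iter k f t)) ->
  exists s, [/\ 0 < s, P s & forall k, (0 < k)%N -> ~ P (iter k f s)].
Proof.
move=> f0; elim: K t => [|K ih] t t0 Pt h; first by case: (h 0%N).
have [[k k0 Pk]|nk] := pselect (exists2 k, (0 < k)%N & P (iter k f t)).
  apply: (ih (iter k f t)) => //; first exact: iter_gt0.
  move=> l Kl; rewrite -iterD; apply: h; apply: leq_trans (_ : (l + 1 <= _)%N); first by rewrite addn1.
  by rewrite leq_add2l.
by exists t; split => // k k0 Pk; apply: nk; exists k.
Qed.

Lemma geometric_decay {R : realType} (y : nat -> R) (q e : R) K :
  0 <= q -> q < 1 -> (forall k, (K <= k)%N -> y k.+1 <= q * y k) -> 0 < e ->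
  exists N, forall n, (N <= n)%N -> y n <= e.
Proof.
move=> q0 q1 h e0.
have yK n : y (n + K)%N <= `|y K| * q ^+ n.
  elim: n => [|n ih]; first by rewrite expr0 mulr1 ler_norm.
  rewrite addSn; apply: le_trans (h _ (leq_addl _ _)) _.
  by rewrite exprS mulrCA ler_wpM2l.
have nq : `|q| < 1 by rewrite ger0_norm.
have := @cvg_geometric R `|y K| q nq => /cvgrPdist_lt/(_ e e0)[N _ hN].
exists (N + K)%N => n Nn; have Kn : (K <= n)%N by apply: leq_trans Nn; exact: leq_addl.
rewrite -(subnK Kn); apply: le_trans (yK _) _.
have /hN : (N <= n - K)%N by rewrite leq_subRL// addnC.
rewrite /= sub0r normrN ger0_norm; first exact: ltW.
by rewrite mulr_ge0// exprn_ge0.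
Qed.

(** * Slow variation of the coefficients along orbits *)

Section slow_variation.
Context {R : realType}.
Variable alpha : R -> R.
Hypothesis Salpha : SOS alpha.
Variables e0 e1 : R.
Hypotheses (e0_gt0 : 0 < e0) (e1_gt0 : 0 < e1).
Hypothesis de : forall t, 0 < t -> e0 <= derive1 alpha t <= e1.

Let increment s t : 0 < s -> s < t ->
  e0 * (t - s) <= alpha t - alpha s <= e1 * (t - s).
Proof.
move=> s0 st.
have [||c] := @MVT R alpha (derive1 alpha) s t st.
- move=> x; rewrite in_itv/= => /andP[sx _].
  by apply: DeriveDef; [apply: SOS_derivable => //; exact: lt_trans sx|rewrite derive1E].
- exact: SOS_cc.
- rewrite in_itv/= => /andP[sc _] ->.
  have /andP[h1 h2] := de (lt_trans s0 sc).
  by rewrite !ler_wpM2r// subr_ge0 ltW.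
Qed.

(** The mean value theorem on [[s, t]] with [s] tending to [0]. The upper bound needs [alpha s]
    small rather than [s], so there [s] is chosen as [beta y] with [y <= e]. *)
Lemma SOS_comparable t : 0 < t -> e0 * t <= alpha t <= e1 * t.
Proof.
move=> t0; apply/andP; split; apply/ler_addgt0Pr => e e_gt0.
  pose s := Num.min (t / 2) (e / e0).
  have s0 : 0 < s by rewrite lt_min !divr_gt0.
  have st : s < t by rewrite gt_min ltr_pdivrMr// ltr_pMr// ltr1n.
  have /andP[h _] := increment s0 st.
  have es : e0 * s <= e by rewrite mulrC -ler_pdivlMr// ge_min lexx orbT.
  have := SOS_gt0 Salpha s0; move: h; rewrite mulrBr; lra.
have [beta [b1 b2]] := SOS_inv Salpha.
pose y := Num.min (alpha t / 2) e.
have at0 := SOS_gt0 Salpha t0.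
have y0 : 0 < y by rewrite lt_min e_gt0 divr_gt0.
have yat : y < alpha t by rewrite gt_min ltr_pdivrMr// ltr_pMr// ltr1n.
have ye : y <= e by rewrite ge_min lexx orbT.
have [s0 sy] := b1 y y0.
have st : beta y < t by rewrite -(SOS_mono Salpha)// sy.
have /andP[_] := increment s0 st; rewrite sy => h.
have : e1 * (t - beta y) <= e1 * t by rewrite ler_pM2l// gerBl ltW.
by move: h ye; lra.
Qed.

Lemma eventually_at_shift e (P : R -> Prop) :
  eventually_at e P -> eventually_at e (fun t => P (alpha t)).
Proof.
move=> /(eventually_at_comparable e0_gt0 e1_gt0); apply: eventually_atS => t t0 h.
by have /andP[? ?] := SOS_comparable t0; exact: h.
Qed.

(** Since [alpha t] is comparable to [t], both points lie in one window [[lam * r, r]] with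
    [r = M1 * t], over which the oscillation of [f] is small. *)
Lemma SO_shift_small (f : R -> R[i]) e eps : SO f -> 0 < eps ->
  eventually_at e (fun t => cmod (f (alpha t) - f t) <= eps).
Proof.
move=> [Cf hosc] eps0; have [M M0 fM] := Cb_bound Cf.
pose m0 := Num.min e0 1; pose M1 := Num.max e1 1.
have m00 : 0 < m0 by rewrite lt_min e0_gt0 ltr01.
have M10 : 0 < M1 by rewrite lt_max ltr01 orbT.
have M11 : 1 <= M1 by rewrite le_max lexx orbT.
have m01 : m0 <= 1 by rewrite ge_min lexx orbT.
(* The factor [2] makes [lam < 1] strict even when [m0 = M1 = 1]. *)
pose lam := m0 / (2 * M1).
have lam0 : 0 < lam by rewrite divr_gt0// mulr_gt0.
have lam1 : lam < 1.
  rewrite ltr_pdivrMr ?mulr_gt0// mul1r; apply: le_lt_trans m01 _.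
  by apply: lt_le_trans (_ : 2 <= _); rewrite ?ltr1n// ler_peMr.
have small : eventually_at e (fun r => osc f lam r <= eps).
  have [h1 h2] := hosc lam lam0 lam1; apply/eventually_atP; case: e => /=.
    by have /cvgr_le/(_ eps eps0) := h2.
  by have /cvgr_le/(_ eps eps0) := h1.
(* Equal comparison constants only rescale the neighbourhood of the end, so that smallness holds at
   [r = M1 * t]. *)
have := eventually_at_comparable M10 M10 small; apply: eventually_atS => t t0 h.
apply: le_trans (h _ (lexx _) (lexx _)).
have lE : lam * (M1 * t) = m0 * t / 2.
  by rewrite /lam; field; rewrite gt_eqF.
have m0t : 0 < m0 * t by rewrite mulr_gt0.
have lpos : 0 < lam * (M1 * t) by rewrite lE divr_gt0.
have inI s : m0 * t <= s -> s <= M1 * t -> s \in `[lam * (M1 * t), M1 * t].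
  move=> h1 h2; rewrite in_itv/= h2 andbT lE; apply: le_trans h1.
  by rewrite ler_pdivrMr// ler_peMr ?ler1n// ltW.
have /andP[a1 a2] := SOS_comparable t0.
apply: sup_ubound; last first.
  exists (alpha t, t) => //; split => /=; apply: inI.
  - by apply: le_trans a1; rewrite ler_wpM2r ?(ltW t0)// ge_min lexx.
  - by apply: le_trans a2 _; rewrite ler_wpM2r ?(ltW t0)// le_max lexx.
  - by rewrite ler_piMl// ltW.
  - by rewrite ler_peMl// ltW.
exists (M + M) => _ [[x y] [/= hx hy] <-].
have pos s : s \in `[lam * (M1 * t), M1 * t] -> 0 < s.
  by rewrite in_itv/= => /andP[hs _]; exact: lt_le_trans hs.
by apply: le_trans (ler_cmodB _ _) _; rewrite lerD// fM ?pos.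
Qed.

Variable p : R.
Hypothesis p_gt1 : 1 < p.
Let p_gt0 : 0 < p. Proof. exact: lt_trans p_gt1. Qed.
Variables (a b : R -> R[i]).
Hypotheses (SOa : SO a) (SOb : SO b).

Local Notation D := (Dfun p a b alpha).
Let dp t := derive1 alpha t `^ (- p^-1).

Lemma SOS_weight_le t : 0 < t -> dp t <= e0 `^ (- p^-1).
Proof.
move=> t0; rewrite /dp !powRN lef_pV2 ?posrE ?powR_gt0 ?SOS_d_gt0//.
apply: ge0_ler_powR; rewrite ?nnegrE ?invr_ge0 ?(ltW p_gt0) ?(ltW e0_gt0)//.
  by rewrite ltW// SOS_d_gt0.
by case/andP: (de t0).
Qed.

Let dp_gt0 t : 0 < t -> 0 < dp t.
Proof. by move=> t0; rewrite powR_gt0// SOS_d_gt0. Qed.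

(** The ratio [rho] of the derivatives at [alpha t] and [t] is close to [1] near an end. Factoring
    out [dp t] leaves a power of [rho], so continuity of the power at the single point [1] gives a
    uniform estimate. *)
Let dp_slow e eps : 0 < eps -> eventually_at e (fun t => `|dp (alpha t) - dp t| <= eps).
Proof.
move=> eps0; pose E := e0 `^ (- p^-1); have E0 : 0 < E by exact: powR_gt0.
have := @continuous_powR_gt0 R (- p^-1) 1 ltr01 => /cvgrPdist_lt/(_ (eps / E)).
rewrite divr_gt0// => /(_ isT)/nbhs_ballP[dl /= dl0 hdl].
have SOd : SO (fun t => real_complex R (derive1 alpha t)).
  by case: Salpha => _ [_ [_ [_ [_ [_ [_ [_ h]]]]]]].
have dl2 : 0 < dl * e0 / 2 by rewrite divr_gt0// mulr_gt0.
have := SO_shift_small e SOd dl2; apply: eventually_atS => t t0.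
rewrite -rmorphB cmod_real => h.
have d0 := SOS_d_gt0 Salpha t0; have d1 := SOS_d_gt0 Salpha (SOS_gt0 Salpha t0).
set rho := derive1 alpha (alpha t) / derive1 alpha t.
have rho0 : 0 < rho by rewrite divr_gt0.
have rhoE : derive1 alpha (alpha t) = rho * derive1 alpha t by rewrite /rho divfK// gt_eqF.
have brho : `|1 - rho| < dl.
  rewrite distrC /rho -[X in _ - X](mulfV (lt0r_neq0 d0)) -mulrBl normrM normfV.
  rewrite (gtr0_norm d0) ltr_pdivrMr//; apply: le_lt_trans h _.
  rewrite ltr_pdivrMr//; have /andP[h1 _] := de t0.
  apply: (@le_lt_trans _ _ (dl * derive1 alpha t)); first by rewrite ler_pM2l.
  by rewrite ltr_pMr ?mulr_gt0// ltr1n.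
have := hdl rho brho; rewrite powR1 => h2.
have -> : dp (alpha t) - dp t = - (dp t * (1 - rho `^ (- p^-1))).
  by rewrite {1}/dp rhoE powRM ?(ltW rho0) ?(ltW d0)// -/(dp t); ring.
rewrite normrN normrM (gtr0_norm (dp_gt0 t0)).
apply: (@le_trans _ _ (E * (eps / E))); last by rewrite mulrCA mulfV ?mulr1// gt_eqF.
by rewrite ler_pM ?(ltW (dp_gt0 t0)) ?SOS_weight_le//; exact: ltW.
Qed.

Lemma Dfun_slow e eps : 0 < eps ->
  eventually_at e (fun t => `|D (alpha t) - D t| <= eps).
Proof.
move=> eps0; pose E := e0 `^ (- p^-1); have E0 : 0 < E by exact: powR_gt0.
have [M M0 bM] := Cb_bound (SO_Cb SOb).
have eps3 : 0 < eps / 3 by rewrite divr_gt0.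
have ha := SO_shift_small e SOa eps3.
have hb := SO_shift_small e SOb (divr_gt0 eps3 E0).
have hd := dp_slow e (divr_gt0 eps3 M0).
apply: eventually_atS (eventually_atI ha (eventually_atI hb hd)) => t t0 [h1 [h2 h3]].
have at0 := SOS_gt0 Salpha t0.
rewrite /Dfun -/(dp t) -/(dp (alpha t)).
have alg (x y u v r s : R) :
  x - y * r - (u - v * s) = (x - u) - (y - v) * r - v * (r - s) by ring.
rewrite alg.
have k1 : `|cmod (a (alpha t)) - cmod (a t)| <= eps / 3 by apply: le_trans (ler_cmod_dist _ _) h1.
have k2 : `|(cmod (b (alpha t)) - cmod (b t)) * dp (alpha t)| <= eps / 3.
  rewrite normrM (gtr0_norm (dp_gt0 at0)) -[leRHS](divfK (lt0r_neq0 E0)).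
  rewrite ler_pM ?(ltW (dp_gt0 at0)) ?SOS_weight_le//.
  exact: le_trans (ler_cmod_dist _ _) h2.
have k3 : `|cmod (b t) * (dp (alpha t) - dp t)| <= eps / 3.
  rewrite normrM (ger0_norm (cmod_ge0 _)) -[leRHS](divfK (lt0r_neq0 M0)) mulrC.
  by rewrite ler_pM ?cmod_ge0 ?bM.
apply: le_trans (ler_normB _ _) _; apply: le_trans (lerD (ler_normB _ _) (lexx _)) _.
by move: k1 k2 k3; lra.
Qed.

Lemma Dfun_slow_iter e eps k : 0 < eps ->
  eventually_at e (fun t => `|D (iter k alpha t) - D t| <= eps).
Proof.
elim: k eps => [|k ih] eps eps0.
  by apply: eventually_atW => t t0 /=; rewrite subrr normr0 ltW.
have eps2 : 0 < eps / 2 by rewrite divr_gt0.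
have h := eventually_atI (eventually_at_shift (ih _ eps2)) (Dfun_slow e eps2).
apply: eventually_atS h => t t0 [h1 h2]; rewrite iterSr.
rewrite [leRHS]splitr; apply: le_trans (lerD h1 h2).
by apply: le_trans (ler_normD _ _); rewrite addrA subrK.
Qed.

Lemma eventually_at_forall_ltn e (P : nat -> R -> Prop) N :
  (forall k, eventually_at e (P k)) -> eventually_at e (fun t => forall k, (k < N)%N -> P k t).
Proof.
move=> h; elim: N => [|N ih]; first exact: eventually_atW.
apply: eventually_atS (eventually_atI ih (h N)) => t t0 [h1 h2] k.
by rewrite ltnS leq_eqVlt => /orP[/eqP ->//|]; exact: h1.
Qed.

Lemma cmod_wcoef t : 0 < t -> cmod (wcoef p b alpha t) = cmod (b t) * dp t.
Proof. by move=> t0; rewrite /wcoef cmodM cmod_real ger0_norm// ltW// dp_gt0. Qed.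

Lemma Dfun_wcoef t : 0 < t -> D t = cmod (a t) - cmod (wcoef p b alpha t).
Proof. by move=> t0; rewrite cmod_wcoef. Qed.

Lemma Dfun_cont t : 0 < t -> {for t, continuous D}.
Proof.
move=> t0; apply: cvgB; first exact/ccont_cmod/Cb_ccont/t0/SO_Cb.
apply: cvgM; first exact/ccont_cmod/Cb_ccont/t0/SO_Cb.
apply: (@continuous_comp _ _ _ (derive1 alpha) (fun x => x `^ (- p^-1))).
  exact: SOS_dcont.
by apply: continuous_powR_gt0; exact: SOS_d_gt0.
Qed.

Lemma wcoef_bound : exists2 M, 0 < M & forall t, 0 < t ->
  cmod (a t) <= M /\ cmod (wcoef p b alpha t) <= M.
Proof.
have [Ma Ma0 aM] := Cb_bound (SO_Cb SOa); have [Mb Mb0 bM] := Cb_bound (SO_Cb SOb).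
exists (Num.max Ma (Mb * e0 `^ (- p^-1))); first by rewrite lt_max Ma0.
move=> t t0; split; first by rewrite le_max aM.
rewrite cmod_wcoef// le_max; apply/orP; right.
by rewrite ler_pM ?cmod_ge0 ?bM ?SOS_weight_le// ltW// dp_gt0.
Qed.

End slow_variation.

Section phases.
Context {R : realType}.

(** The value [1] at [z = 0] keeps the modulus equal to [1], so that phases can always be divided
    by. *)
Definition phase (z : R[i]) : R[i] := if z == 0 then 1 else z / real_complex R (cmod z).

Lemma phaseE z : z = phase z * real_complex R (cmod z).
Proof.
rewrite /phase; case: eqP => [->|/eqP z0]; first by rewrite cmod0 mulr0.
rewrite divfK//; apply/eqP => h; have : cmod (real_complex R (cmod z)) = 0 by rewrite h cmod0.
by rewrite cmod_real ger0_norm ?cmod_ge0// => /eqP; rewrite gt_eqF// cmod_gt0.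
Qed.

Lemma cmod_phase z : cmod (phase z) = 1.
Proof.
rewrite /phase; case: eqP => [_|/eqP z0]; first exact: cmod1.
rewrite cmodM cmodV cmod_real ger0_norm ?cmod_ge0// mulfV// gt_eqF//.
exact: cmod_gt0.
Qed.

Lemma phase_neq0 z : phase z != 0.
Proof. by apply/eqP => h; have := cmod_phase z; rewrite h cmod0 => /eqP; rewrite eq_sym oner_eq0. Qed.

(** A unimodular sequence [y] for which [u k * y k] and [w k * y k.+1] point in the same direction,
    so that only their moduli are subtracted. *)
Fixpoint phase_seq (u w : nat -> R[i]) (k : nat) : R[i] :=
  if k is k'.+1 then phase_seq u w k' * phase (u k') / phase (w k') else 1.

Lemma cmod_phase_seq u w k : cmod (phase_seq u w k) = 1.
Proof.
elim: k => [|k ih]; first exact: cmod1.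
by rewrite /= !cmodM cmodV !cmod_phase ih !mul1r invr1.
Qed.

Lemma cmod_phase_diff u w k :
  cmod (u k * phase_seq u w k - w k * phase_seq u w k.+1) = `|cmod (u k) - cmod (w k)|.
Proof.
have -> : u k * phase_seq u w k - w k * phase_seq u w k.+1 =
    phase_seq u w k * phase (u k) * real_complex R (cmod (u k) - cmod (w k)).
  rewrite [in LHS](phaseE (u k)) [X in _ - X * _](phaseE (w k)) /= rmorphB /=.
  by have := phase_neq0 (w k) => h; field.
by rewrite !cmodM cmod_phase_seq cmod_phase cmod_real !mul1r.
Qed.

End phases.

Section necessity.
Context {R : realType}.
Variable p : R.
Hypothesis p_gt1 : 1 < p.
Let p_gt0 : 0 < p. Proof. exact: lt_trans p_gt1. Qed.
Variables (a b : R -> R[i]) (alpha : R -> R).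
Hypotheses (SOa : SO a) (SOb : SO b) (Salpha : SOS alpha).
Hypothesis inv : invertible_Lp p (Aop a b alpha).

Local Notation D := (Dfun p a b alpha).
Local Notation w := (wcoef p b alpha).

(* If [D] is small far out, slow variation makes it small along a long stretch of
   the orbit; a unimodular sequence aligning the phases of [a] and [w] there then
   contradicts [orbit_lower_bound]. *)
Lemma Dfun_away_from_zero e :
  exists2 eta, 0 < eta & eventually_at e (fun t => eta <= `|D t|).
Proof.
have [e0 [e1 [e00 e10 de]]] := SOS_d_bound Salpha.
have [beta [b1 b2]] := SOS_inv Salpha.
have [C C0 LB] := orbit_lower_bound p_gt1 (SO_Cb SOa) (SO_Cb SOb) Salpha b1 b2 inv.
have [M M0 hM] := wcoef_bound Salpha e00 de p_gt1 SOa SOb.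
(* [th] is small enough that [C * th ^ p <= 1 / 2]. Half of it is left for the value of [D] at [t]
   and half for its variation along the stretch. *)
pose th := (2 * (C + 1))^-1 `^ p^-1.
have C1 : 0 < C + 1 by rewrite ltr_wpDl.
have th0 : 0 < th by rewrite powR_gt0 // invr_gt0 mulr_gt0.
have thp : C * th `^ p <= 2^-1.
  rewrite /th -powRrM mulVf ?gt_eqF// powRr1 ?invr_ge0 ?mulr_ge0 ?(ltW C1)//.
  by rewrite ler_pdivrMr ?mulr_gt0// mulrA mulVf// mul1r lerDl.
(* The lower bound would give [N <= (N + 1) / 2 + B / 2], where [B / 2] pays for the two truncation
   terms; this fails as soon as [N > B + 1]. *)
pose B := 4 * (C * M `^ p).
have B0 : 0 <= B by rewrite !mulr_ge0 ?powR_ge0.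
have [N NE] : exists N, N = (Num.truncn B).+2 by eexists.
have N0 : (0 < N)%N by rewrite NE.
have th2 : 0 < th / 2 by rewrite divr_gt0.
exists (th / 2) => //.
have slow := eventually_at_forall_ltn N.+1
  (fun k => Dfun_slow_iter Salpha e00 e10 de p_gt1 SOa SOb e k th2).
apply: eventually_atS slow => t t0 slow; rewrite leNgt; apply/negP => Dt.
have Dk k : (k < N.+1)%N -> `|D (iter k alpha t)| <= th.
  move=> /slow h; rewrite [leRHS]splitr; apply: le_trans (lerD h (ltW Dt)).
  by apply: le_trans (ler_normD _ _); rewrite subrK.
have pow_le (c c' : R) : 0 <= c -> c <= c' -> c `^ p <= c' `^ p.
  by move=> c0 cc'; apply: ge0_ler_powR; rewrite ?nnegrE ?(ltW p_gt0)//; exact: le_trans cc'.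
have tk k : 0 < iter k alpha t by apply: iter_gt0 => //; exact: SOS_gt0.
pose y := phase_seq (fun k => a (iter k alpha t)) (fun k => w (iter k alpha t)).
pose x k : R[i] := if (0 < k <= N)%N then y k else 0.
have x0 : x 0%N = 0 by [].
have xN : x N.+1 = 0 by rewrite /x ltnn andbF.
have xin k : (0 < k)%N -> (k <= N)%N -> x k = y k by move=> h1 h2; rewrite /x h1 h2.
clearbody x.
have := LB t N x t0 x0 xN; rewrite big_ord_recr/= xN cmod0 powR0 ?gt_eqF// addr0.
rewrite big_ord_recl/= x0 cmod0 powR0 ?gt_eqF// add0r.
rewrite (eq_bigr (fun=> 1)); last first.
  move=> i _; rewrite /bump /= add1n xin// cmod_phase_seq powR1//.
rewrite sumr_const card_ord -[1 *+ N]/(N%:R).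
apply/negP; rewrite -ltNge.
apply: (@le_lt_trans _ _ (C * \sum_(k < N.+1) (th `^ p + ((k == 0%N :> nat) + (k == N :> nat))%:R * M `^ p))).
  rewrite ler_wpM2l// ler_sum// => k _; have kN := ltn_ord k.
  have [aM wM] := hM _ (tk k).
  have [k0|k0] := eqVneq (k : nat) 0%N.
    rewrite k0 x0 mulr0 sub0r cmodN xin// cmodM cmod_phase_seq mulr1.
    apply: le_trans (_ : M `^ p <= _).
      by apply: pow_le; [exact: cmod_ge0|rewrite k0 in wM].
    by rewrite natrD mulrDl mul1r addrCA lerDl addr_ge0 ?mulr_ge0 ?powR_ge0.
  have [kEN|kEN] := eqVneq (k : nat) N.
    rewrite kEN xN mulr0 subr0 xin// cmodM cmod_phase_seq mulr1.
    apply: le_trans (_ : M `^ p <= _).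
      by apply: pow_le; [exact: cmod_ge0|rewrite kEN in aM].
    by rewrite add0n mul1r lerDr powR_ge0.
  have kN' : (k < N)%N by rewrite ltn_neqAle kEN -ltnS.
  rewrite addn0 mul0r addr0 !xin ?lt0n ?(ltnW kN')//.
  rewrite cmod_phase_diff -Dfun_wcoef//.
  by apply: pow_le; [exact: normr_ge0|exact: Dk].
rewrite big_split/= sumr_const card_ord -mulr_suml -natr_sum big_split/=.
have -> : (\sum_(i < N.+1) (i == 0%N :> nat))%N = 1%N.
  by rewrite big_ord_recl/= big1.
have -> : (\sum_(i < N.+1) (i == N :> nat))%N = 1%N.
  by rewrite big_ord_recr/= eqxx big1// => i _; rewrite (ltn_eqF (ltn_ord i)).
rewrite mulrDr -[_ *+ N.+1]mulr_natr [C * (_ * N.+1%:R)]mulrA -[(1 + 1)%N]/2%N.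
apply: (@le_lt_trans _ _ (2^-1 * N.+1%:R + B / 2)).
  apply: lerD; first by rewrite ler_wpM2r.
  by rewrite /B; lra.
have BN : B < (Num.truncn B).+1%:R by exact: Num.Theory.truncnS_gt.
have -> : N%:R = (Num.truncn B).+1%:R + 1 :> R by rewrite NE natr1.
have -> : N.+1%:R = (Num.truncn B).+1%:R + 2 :> R by rewrite NE -addn2 natrD.
move: BN; set z := (_.+1%:R); lra.
Qed.

End necessity.

(** * Solutions of the recurrences in both directions along an orbit *)

Section two_sided_sequences.
Context {R : realType}.
Variable p : R.
Hypothesis p_gt1 : 1 < p.
Let p_gt0 : 0 < p. Proof. exact: lt_trans p_gt1. Qed.
Variables (a b : R -> R[i]) (alpha : R -> R).
Hypotheses (SOa : SO a) (SOb : SO b) (Salpha : SOS alpha).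
Hypothesis inv : invertible_Lp p (Aop a b alpha).
Variable beta : R -> R.
Hypothesis beta1 : forall s, 0 < s -> 0 < beta s /\ alpha (beta s) = s.
Hypothesis beta2 : forall t, 0 < t -> beta (alpha t) = t.

Local Notation w := (wcoef p b alpha).
Let alpha_gt0 := SOS_gt0 Salpha.
Let beta_gt0 s : 0 < s -> 0 < beta s. Proof. by case/beta1. Qed.
Let alphaK t : 0 < t -> alpha (beta t) = t. Proof. by case/beta1. Qed.

(** The solution of [v k.+1 * y k.+1 = u k * y k] with [y 0 = 1], as long as the divisors are
    nonzero. *)
Fixpoint ratio_seq (u v : nat -> R[i]) (k : nat) : R[i] :=
  if k is k'.+1 then u k' / v k'.+1 * ratio_seq u v k' else 1.

Let orbit_mix m k t : 0 < t -> iter k alpha (iter m beta t) =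
  if (k <= m)%N then iter (m - k) beta t else iter (k - m) alpha t.
Proof.
move=> t0; case: leqP => [km|/ltnW mk].
  by rewrite -{1}(subnKC km) iterD (iter_cancel beta_gt0 alphaK)//; exact: iter_gt0.
by rewrite -{1}(subnK mk) iterD (iter_cancel beta_gt0 alphaK).
Qed.

Let mulz0_sub (c d x : R[i]) : c * x - d * 0 = c * x.
Proof. by rewrite mulr0 subr0. Qed.

Let sub_mulz0 (c d x : R[i]) : c * 0 - d * x = - (d * x).
Proof. by rewrite mulr0 sub0r. Qed.

(* The test sequence solves the homogeneous recurrence starting from [t] in both
   directions, so that only the two truncation terms remain. *)
Lemma dual_two_sided : exists2 C, 0 <= C & forall t n l, 0 < t ->
  (forall i, (0 < i)%N -> (i <= n)%N -> w (iter i beta t) != 0) ->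
  (forall i, (0 < i)%N -> (i <= l)%N -> a (iter i alpha t) != 0) ->
  1 <= C * (cmod (a (iter n beta t) *
      ratio_seq (fun i => a (iter i beta t)) (fun i => w (iter i beta t)) n) +
    cmod (w (iter l alpha t) *
      ratio_seq (fun i => w (iter i alpha t)) (fun i => a (iter i alpha t)) l)).
Proof.
have [C C0 DLB] := orbit_dual_bound p_gt1 (SO_Cb SOa) (SO_Cb SOb) Salpha beta1 beta2 inv.
exists C => // t n l t0 wn al.
set ze := ratio_seq (fun i => a (iter i beta t)) _.
set xi := ratio_seq (fun i => w (iter i alpha t)) _.
(* The orbit segment starts at [iter n.+1 beta t], so index [n.+1] is the point [t]. The backward
   and the forward solution meet there with the common value [1]; index [0] is padding. *)
pose z k : R[i] := if (k == 0)%N || (n.+1 + l < k)%N then 0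
  else if (k <= n.+1)%N then ze (n.+1 - k)%N else xi (k - n.+1)%N.
have z0 : z 0%N = 0 by [].
have zN : z (n.+1 + l).+1 = 0 by rewrite /z ltnSn orbT.
have zl k : (0 < k)%N -> (k <= n.+1)%N -> z k = ze (n.+1 - k)%N.
  move=> k0 kn; rewrite /z (gtn_eqF k0) /= ltnNge kn.
  by rewrite (leq_trans kn (leq_addr _ _)).
have zr i : (i <= l)%N -> z (n.+1 + i)%N = xi i.
  move=> il; rewrite /z ltnNge leq_add2l il /=.
  case: ifP => [|_]; last by rewrite addKn.
  rewrite -{2}(addn0 n.+1) leq_add2l leqn0 => /eqP ->.
  by rewrite addn0 subnn.
clearbody z.
have tm0 : 0 < iter n.+1 beta t by exact: iter_gt0.
have := DLB (iter n.+1 beta t) (n.+1 + l)%N z n.+1 tm0 z0 zN (leq_addr _ _).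
rewrite zl// subnn cmod1 => /le_trans; apply; rewrite ler_wpM2l//.
rewrite big_ord_recr big_ord_recl /=.
rewrite big1 ?addr0; last first.
  move=> k _; rewrite /bump /= add1n.
  suff -> : a (alpha (iter k.+1 alpha (iter n.+1 beta t))) * z k.+2
     - w (iter k.+1 alpha (iter n.+1 beta t)) * z k.+1 = 0 by rewrite cmod0.
  rewrite -[alpha (iter _ _ _)]/(iter k.+2 alpha (iter n.+1 beta t)).
  rewrite !orbit_mix//; have kl := ltn_ord k.
  have [kn|nk] := ltnP k.+1 n.+1.
    rewrite (ltnW kn) !zl//; last exact: ltnW.
    rewrite -(subnSK kn); set i := (n.+1 - k.+2)%N.
    have zeS : ze i.+1 = a (iter i beta t) / w (beta (iter i beta t)) * ze i by [].
    have wi : w (beta (iter i beta t)) != 0.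
      by apply: (wn i.+1) => //; rewrite /i subnSK// subSS leq_subr.
    by rewrite zeS /=; field.
  pose i := (k.+1 - n.+1)%N.
  have kE : k.+1 = (n.+1 + i)%N by rewrite /i subnKC.
  have k2E : k.+2 = (n.+1 + i.+1)%N by rewrite addnS -kE.
  have il : (i < l)%N by rewrite -(ltn_add2l n.+1) -kE.
  rewrite k2E kE !zr//; last exact: ltnW.
  rewrite addKn.
  have -> : (if (n.+1 + i <= n.+1)%N then iter (n.+1 - (n.+1 + i)) beta t else iter (n.+1 + i - n.+1) alpha t) = iter i alpha t.
    rewrite -{2}(addn0 n.+1) leq_add2l leqn0; case: eqP => [->|_]; last by rewrite addKn.
    by rewrite addn0 subnn.
  have ai : a (alpha (iter i alpha t)) != 0 by apply: (al i.+1).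
  have xiS : xi i.+1 = w (iter i alpha t) / a (alpha (iter i alpha t)) * xi i by [].
  by rewrite xiS /=; field.
have aE : alpha (beta (iter n beta t)) = iter n beta t by apply: alphaK; exact: iter_gt0.
have lE : alpha (iter (n + l) alpha (beta (iter n beta t))) = iter l alpha t.
  rewrite -[LHS]/(iter (n.+1 + l) alpha (iter n.+1 beta t)).
  by rewrite addnC iterD (iter_cancel beta_gt0 alphaK).
have zL : z (n.+1 + l)%N = xi l by apply: zr.
have z1 : z 1%N = ze n by rewrite zl// subSS subn0.
rewrite z0 z1 zN zL aE lE mulz0_sub sub_mulz0 cmodN.
exact: lexx.
Qed.

(** The analogue of [dual_two_sided] for the recurrence [a x k = w x k.+1] itself. Here both
    coefficients of an equation are taken at the earlier point, whence the shifts [i.+1] going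
    backward and [i.-1] going forward. *)
Lemma lower_two_sided : exists2 C, 0 <= C & forall t n l, 0 < t ->
  (forall i, (0 < i)%N -> (i <= n)%N -> a (iter i beta t) != 0) ->
  (forall i, (i < l)%N -> w (iter i alpha t) != 0) ->
  1 <= C * (cmod (w (iter n.+1 beta t) *
      ratio_seq (fun i => w (iter i.+1 beta t)) (fun i => a (iter i beta t)) n) `^ p +
    cmod (a (iter l alpha t) *
      ratio_seq (fun i => a (iter i alpha t)) (fun i => w (iter i.-1 alpha t)) l) `^ p).
Proof.
have [C C0 LB] := orbit_lower_bound p_gt1 (SO_Cb SOa) (SO_Cb SOb) Salpha beta1 beta2 inv.
exists C => // t n l t0 an wl.
set ze := ratio_seq (fun i => w (iter i.+1 beta t)) _.
set xi := ratio_seq (fun i => a (iter i alpha t)) _.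
pose z k : R[i] := if (k == 0)%N || (n.+1 + l < k)%N then 0
  else if (k <= n.+1)%N then ze (n.+1 - k)%N else xi (k - n.+1)%N.
have z0 : z 0%N = 0 by [].
have zN : z (n.+1 + l).+1 = 0 by rewrite /z ltnSn orbT.
have zl k : (0 < k)%N -> (k <= n.+1)%N -> z k = ze (n.+1 - k)%N.
  move=> k0 kn; rewrite /z (gtn_eqF k0) /= ltnNge kn.
  by rewrite (leq_trans kn (leq_addr _ _)).
have zr i : (i <= l)%N -> z (n.+1 + i)%N = xi i.
  move=> il; rewrite /z ltnNge leq_add2l il /=.
  case: ifP => [|_]; last by rewrite addKn.
  rewrite -{2}(addn0 n.+1) leq_add2l leqn0 => /eqP ->.
  by rewrite addn0 subnn.
clearbody z.
have tm0 : 0 < iter n.+1 beta t by exact: iter_gt0.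
have := LB (iter n.+1 beta t) (n.+1 + l)%N z tm0 z0 zN.
have nl2 : (n.+1 < (n.+1 + l).+2)%N by rewrite ltnS leqW// leq_addr.
rewrite (bigD1 (Ordinal nl2))//= zl// subnn cmod1 powR1.
move=> h; have {h} /le_trans -> // : 1 <= C * \sum_(k < (n.+1 + l).+1)
    cmod (a (iter k alpha (iter n.+1 beta t)) * z k -
          w (iter k alpha (iter n.+1 beta t)) * z k.+1) `^ p.
  by apply: le_trans h; rewrite lerDl; apply: sumr_ge0 => i _; exact: powR_ge0.
rewrite ler_wpM2l// big_ord_recr big_ord_recl /=.
rewrite big1 ?addr0; last first.
  move=> k _; rewrite /bump /= add1n.
  suff -> : a (iter k.+1 alpha (iter n.+1 beta t)) * z k.+1
     - w (iter k.+1 alpha (iter n.+1 beta t)) * z k.+2 = 0 by rewrite cmod0 powR0// gt_eqF.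
  rewrite !orbit_mix//; have kl := ltn_ord k.
  have [kn|nk] := ltnP k.+1 n.+1.
    rewrite (ltnW kn) !zl//; last exact: ltnW.
    rewrite -(subnSK kn); set i := (n.+1 - k.+2)%N.
    have zeS : ze i.+1 = w (beta (iter i beta t)) / a (beta (iter i beta t)) * ze i by [].
    have ai : a (beta (iter i beta t)) != 0.
      by apply: (an i.+1) => //; rewrite /i subnSK// subSS leq_subr.
    by rewrite zeS /=; field.
  pose i := (k.+1 - n.+1)%N.
  have kE : k.+1 = (n.+1 + i)%N by rewrite /i subnKC.
  have k2E : k.+2 = (n.+1 + i.+1)%N by rewrite addnS -kE.
  have il : (i < l)%N by rewrite -(ltn_add2l n.+1) -kE.
  rewrite k2E kE !zr//; last exact: ltnW.
  have -> : (if (n.+1 + i <= n.+1)%N then iter (n.+1 - (n.+1 + i)) beta t else iter (n.+1 + i - n.+1) alpha t) = iter i alpha t.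
    rewrite -{2}(addn0 n.+1) leq_add2l leqn0; case: eqP => [->|_]; last by rewrite addKn.
    by rewrite addn0 subnn.
  have wi := wl i il.
  have xiS : xi i.+1 = a (iter i alpha t) / w (iter i alpha t) * xi i by [].
  by rewrite xiS; field.
have lE : alpha (iter (n + l) alpha (beta (iter n beta t))) = iter l alpha t.
  rewrite -[LHS]/(iter (n.+1 + l) alpha (iter n.+1 beta t)).
  by rewrite addnC iterD (iter_cancel beta_gt0 alphaK).
have zL : z (n.+1 + l)%N = xi l by apply: zr.
have z1 : z 1%N = ze n by rewrite zl// subSS subn0.
rewrite z0 z1 zN zL lE mulz0_sub sub_mulz0 cmodN.
exact: lexx.
Qed.

Lemma cmod_ratio_seq_decay (u v : nat -> R[i]) (q e : R) K : 0 <= q -> q < 1 -> 0 < e ->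
  (forall k, (K <= k)%N -> cmod (u k) <= q * cmod (v k.+1)) ->
  exists N, forall n, (N <= n)%N -> cmod (ratio_seq u v n) <= e.
Proof.
move=> q0 q1 e0 h; apply: (geometric_decay (y := fun n => cmod (ratio_seq u v n)) (K := K) q0 q1 _ e0) => k Kk.
rewrite /= cmodM ler_wpM2r ?cmod_ge0// cmodM cmodV.
have [->|v0] := eqVneq (v k.+1) 0; first by rewrite cmod0 invr0 mulr0.
by rewrite ler_pdivrMr ?h// cmod_gt0.
Qed.

(** The extra factor [u n] regroups the product into quotients [u k / v k] with equal indices, so
    dominance of [v] over [u] at one and the same point gives the decay. *)
Lemma cmod_ratio_seq_decayM (u v : nat -> R[i]) (q e : R) K : 0 <= q -> q < 1 -> 0 < e ->
  (forall k, (K <= k)%N -> v k != 0) ->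
  (forall k, (K <= k)%N -> cmod (u k) <= q * cmod (v k)) ->
  exists N, forall n, (N <= n)%N -> cmod (u n * ratio_seq u v n) <= e.
Proof.
move=> q0 q1 e0 v0 h.
apply: (geometric_decay (y := fun n => cmod (u n * ratio_seq u v n)) (K := K) q0 q1 _ e0) => k Kk.
have Kk1 : (K <= k.+1)%N by exact: leqW.
rewrite (_ : u k.+1 * ratio_seq u v k.+1 = u k.+1 / v k.+1 * (u k * ratio_seq u v k)); last first.
  by rewrite /=; field; exact: v0.
rewrite cmodM ler_wpM2r ?cmod_ge0// cmodM cmodV ler_pdivrMr ?h// cmod_gt0//.
exact: v0.
Qed.

End two_sided_sequences.

(** Between the neighbourhoods of the ends there remains a compact interval, on which [f] attains a
    positive minimum. *)
Lemma lower_bound_of_ends {R : realType} (f : R -> R) (eta : R) :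
  (forall t, 0 < t -> {for t, continuous f}) -> (forall t, 0 < t -> 0 < f t) ->
  0 < eta -> (forall e, eventually_at e (fun t => eta <= f t)) ->
  0 < inf [set f t | t in @Rplus R].
Proof.
move=> fc f0 eta0 ends.
have [y y0 hy] := ends true; have [x x0 hx] := ends false.
pose z := Num.max x y.
have xz : x <= z by rewrite le_max lexx.
have [|c] := @EVT_min R f x z xz.
  apply: (@continuous_subspaceW _ _ _ (@Rplus R)); last exact: within_Rplus.
  by move=> t /=; rewrite in_itv/= /Rplus/= => /andP[h _]; exact: lt_le_trans h.
rewrite in_itv/= => /andP[xc cz] hc.
have c0 : 0 < c by exact: lt_le_trans xc.
apply: (@lt_le_trans _ _ (Num.min eta (f c))); first by rewrite lt_min eta0 f0.
apply: lb_le_inf; first by exists (f 1), 1 => //; exact: ltr01.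
move=> _ [t t0 <-]; rewrite ge_min.
have [tx|xt] := leP t x; first by rewrite hx.
have [tz|zt] := leP t z; first by rewrite (hc t) ?orbT// in_itv/= (ltW xt).
by rewrite hy// (le_trans _ (ltW zt))// le_max lexx orbT.
Qed.

(** * Signs at the ends and zeros of the coefficients *)

Section dichotomy.
Context {R : realType}.
Variable p : R.
Hypothesis p_gt1 : 1 < p.
Let p_gt0 : 0 < p. Proof. exact: lt_trans p_gt1. Qed.
Variables (a b : R -> R[i]) (alpha : R -> R).
Hypotheses (SOa : SO a) (SOb : SO b) (Salpha : SOS alpha).
Hypothesis inv : invertible_Lp p (Aop a b alpha).
Variable beta : R -> R.
Hypothesis beta1 : forall s, 0 < s -> 0 < beta s /\ alpha (beta s) = s.
Hypothesis beta2 : forall t, 0 < t -> beta (alpha t) = t.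
Variable e : bool.
Hypothesis dir : forall t, 0 < t -> if e then t < alpha t else alpha t < t.

Local Notation w := (wcoef p b alpha).
Let alpha_gt0 := SOS_gt0 Salpha.
Let beta_gt0 s : 0 < s -> 0 < beta s. Proof. by case/beta1. Qed.

Let forward (P : R -> Prop) t : 0 < t -> eventually_at e P ->
  exists K, forall k, (K <= k)%N -> P (iter k alpha t).
Proof. exact: (orbit_eventually alpha_gt0 (SOS_cont Salpha) dir). Qed.

Let backward (P : R -> Prop) t : 0 < t -> eventually_at (~~ e) P ->
  exists K, forall k, (K <= k)%N -> P (iter k beta t).
Proof.
apply: (orbit_eventually beta_gt0 (inv_cont Salpha beta1)) => s s0.
have [b0 bK] := beta1 s0; have := dir b0; rewrite bK.
by case: (e).
Qed.

Variable q : R.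
Hypotheses (q_ge0 : 0 <= q) (q_lt1 : q < 1).
Let a_dom t := a t != 0 /\ cmod (w t) <= q * cmod (a t).
Let w_dom t := w t != 0 /\ cmod (a t) <= q * cmod (w t).

Let small (C : R) : 0 <= C ->
  exists2 th, 0 < th & forall x y, x <= th -> y <= th -> ~ 1 <= C * (x + y).
Proof.
move=> C0; have C1 : 0 < C + 1 by rewrite ltr_wpDl.
exists (4 * (C + 1))^-1; first by rewrite invr_gt0 mulr_gt0.
move=> x y hx hy; apply/negP; rewrite -ltNge.
apply: (@le_lt_trans _ _ (C * (2 * (4 * (C + 1))^-1))).
  by rewrite ler_wpM2l// mulr_natl mulr2n lerD.
rewrite mulrA ltr_pdivrMr ?mulr_gt0// mul1r; lra.
Qed.

(** At the last zero [s] of [a] on a forward orbit the backward truncation term of [dual_two_sided]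
    with [n = 0] carries the factor [a s = 0], while the forward one decays because [a] dominates at
    the end reached by the iterates of [alpha]. *)
Lemma a_neq0 : eventually_at e a_dom -> forall t, 0 < t -> a t != 0.
Proof.
move=> edom t t0; apply/eqP => at0.
have [K hK] := forward t0 edom.
have [k Kk|s [s0 as0 sn]] := @last_zero R alpha (fun s => a s = 0) t K alpha_gt0 t0 at0.
  by have [/eqP] := hK k Kk.
have [C C0 DTS] := dual_two_sided p_gt1 SOa SOb Salpha inv beta1 beta2.
have [th th0 hth] := small C0.
have [L hL] := forward s0 edom.
have [N hN] := cmod_ratio_seq_decayM q_ge0 q_lt1 th0
  (fun k h => (hL k h).1) (fun k h => (hL k h).2).
have := DTS s 0%N N s0; rewrite /= as0 mul0r cmod0 => h.
apply: (hth _ _ (ltW th0) (hN N (leqnn _))); apply: h.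
  by case.
by move=> i i0 _; apply/eqP; exact: sn.
Qed.

(** The mirror image of [a_neq0]: at the last zero [s] of [w] on a backward orbit the forward
    truncation term with [l = 0] carries [w s = 0], and the backward one decays. *)
Lemma wcoef_neq0 : eventually_at (~~ e) w_dom -> forall t, 0 < t -> w t != 0.
Proof.
move=> edom t t0; apply/eqP => wt0.
have [K hK] := backward t0 edom.
have [k Kk|s [s0 ws0 sn]] := @last_zero R beta (fun s => w s = 0) t K beta_gt0 t0 wt0.
  by have [/eqP] := hK k Kk.
have [C C0 DTS] := dual_two_sided p_gt1 SOa SOb Salpha inv beta1 beta2.
have [th th0 hth] := small C0.
have [L hL] := backward s0 edom.
have [N hN] := cmod_ratio_seq_decayM q_ge0 q_lt1 th0
  (fun k h => (hL k h).1) (fun k h => (hL k h).2).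
have := DTS s N 0%N s0; rewrite [iter 0 _ _]/= ws0 mul0r cmod0 => h.
apply: (hth _ _ (hN N (leqnn _)) (ltW th0)); apply: h; last by case.
by move=> i i0 _; apply/eqP; exact: sn.
Qed.

(** The transposed recurrence multiplies by [w / a] going forward and by [a / w] going backward, so
    its solution decays in both directions; [a_neq0] and [wcoef_neq0] allow the divisions. *)
Lemma not_dom_inward : eventually_at e a_dom -> eventually_at (~~ e) w_dom -> False.
Proof.
move=> ea ew.
have [C C0 DTS] := dual_two_sided p_gt1 SOa SOb Salpha inv beta1 beta2.
have [th th0 hth] := small C0.
have [L hL] := forward ltr01 ea; have [L' hL'] := backward ltr01 ew.
have [N hN] := cmod_ratio_seq_decayM q_ge0 q_lt1 th0
  (fun k h => (hL k h).1) (fun k h => (hL k h).2).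
have [N' hN'] := cmod_ratio_seq_decayM q_ge0 q_lt1 th0
  (fun k h => (hL' k h).1) (fun k h => (hL' k h).2).
apply: (hth _ _ (hN' N' (leqnn _)) (hN N (leqnn _))); apply: DTS => //.
- by move=> i _ _; apply: wcoef_neq0 => //; exact: iter_gt0.
- by move=> i _ _; apply: a_neq0 => //; exact: iter_gt0.
Qed.

(** Here the recurrence itself decays both ways, with factors [a / w] forward and [w / a] backward.
    The coefficients may still vanish, so the starting point is chosen to keep all divisors
    nonzero. *)
Lemma not_dom_outward : eventually_at e w_dom -> eventually_at (~~ e) a_dom -> False.
Proof.
move=> ew ea.
have [C C0 LTS] := lower_two_sided p_gt1 SOa SOb Salpha inv beta1 beta2.
have [th th0 hth] := small C0.
have [e0 [e1 [e00 _ de]]] := SOS_d_bound Salpha.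
have [M M0 hM] := wcoef_bound Salpha e00 de p_gt1 SOa SOb.
(* A truncation term is a coefficient of modulus at most [M] times a value of the sequence; values
   below [th'] bring its [p]-th power below [th]. *)
pose th' := th `^ p^-1 / M.
have th'0 : 0 < th' by rewrite divr_gt0// powR_gt0.
have decay (c z : R[i]) : cmod c <= M -> cmod z <= th' -> cmod (c * z) `^ p <= th.
  move=> hc hz; rewrite -[leRHS]powRr1 ?(ltW th0)// -(mulVf (lt0r_neq0 p_gt0)) powRrM.
  apply: ge0_ler_powR; rewrite ?nnegrE ?cmod_ge0 ?powR_ge0 ?(ltW p_gt0)//.
  rewrite cmodM -[leRHS](divfK (lt0r_neq0 M0)) mulrC.
  by rewrite ler_pM ?cmod_ge0.
have right t : 0 < t -> exists N, forall n, (N <= n)%N ->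
    cmod (a (iter n alpha t) * ratio_seq (fun i => a (iter i alpha t))
      (fun i => w (iter i.-1 alpha t)) n) `^ p <= th.
  move=> t0; have [L hL] := forward t0 ew.
  have [N hN] := @cmod_ratio_seq_decay R (fun i => a (iter i alpha t))
    (fun i => w (iter i.-1 alpha t)) q th' L q_ge0 q_lt1 th'0 (fun k h => (hL k h).2).
  exists N => n /hN; apply: decay.
  by apply: (hM _ _).1; exact: iter_gt0.
have [[s s0 ws0]|nw] := pselect (exists2 s, 0 < s & w s = 0).
  have [K hK] := forward s0 ew.
  have [k Kk|t1 [t10 wt10 sn]] := @last_zero R alpha (fun s => w s = 0) s K alpha_gt0 s0 ws0.
    by have [/eqP] := hK k Kk.
  (* Starting at the image of the last zero [t1] of [w], the backward truncation term carries the
     factor [w t1 = 0]. *)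
  have at0 := alpha_gt0 t10; have [N hN] := right _ at0.
  have := LTS (alpha t1) 0%N N at0; rewrite [iter 1 _ _]/= beta2// wt10 mul0r cmod0 powR0 ?gt_eqF// => h.
  apply: (hth _ _ (ltW th0) (hN N (leqnn _))); apply: h; first by case.
  by move=> i _; rewrite -iterSr; apply/eqP; exact: sn.
(* If [w] has no zero, the start is moved so far back that [a] dominates, and hence is nonzero, on
   the whole backward orbit. *)
have [K hK] := backward ltr01 ea.
pose t := iter K beta 1.
have t0 : 0 < t by apply: iter_gt0 => //; exact: ltr01.
have tdom i : a_dom (iter i beta t) by rewrite /t -iterD; apply: hK; exact: leq_addl.
have [N hN] := right t t0.
have [N' hN'] := @cmod_ratio_seq_decay R (fun i => w (iter i.+1 beta t))
    (fun i => a (iter i beta t)) q th' 0%N q_ge0 q_lt1 th'0 (fun k _ => (tdom k.+1).2).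
have hl : cmod (w (iter N'.+1 beta t) * ratio_seq (fun i => w (iter i.+1 beta t))
    (fun i => a (iter i beta t)) N') `^ p <= th.
  by apply: decay (hN' N' (leqnn _)); apply: (hM _ _).2; exact: iter_gt0.
apply: (hth _ _ hl (hN N (leqnn _))); apply: LTS => //.
- by move=> i _ _; exact: (tdom i).1.
- move=> i _; apply/eqP => wi; apply: nw; exists (iter i alpha t) => //.
  exact: iter_gt0.
Qed.

End dichotomy.

Section invertibility_criterion.
Context {R : realType}.
Variable p : R.
Hypothesis p_gt1 : 1 < p.
Variables (a b : R -> R[i]) (alpha : R -> R).
Hypotheses (SOa : SO a) (SOb : SO b) (Salpha : SOS alpha).

Local Notation w := (wcoef p b alpha).
Local Notation D := (Dfun p a b alpha).

Lemma Dfun_dominance (eta : R) : 0 < eta -> exists q, [/\ 0 <= q, q < 1 &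
  forall t, 0 < t ->
    (eta <= D t -> a t != 0 /\ cmod (w t) <= q * cmod (a t)) /\
    (D t <= - eta -> w t != 0 /\ cmod (a t) <= q * cmod (w t))].
Proof.
move=> eta0; have [e0 [e1 [e00 _ de]]] := SOS_d_bound Salpha.
have [M M0 hM] := wcoef_bound Salpha e00 de p_gt1 SOa SOb.
have Me : 0 < M + eta by rewrite addr_gt0.
have key (u v : R[i]) : cmod u <= M -> eta <= cmod u - cmod v ->
    u != 0 /\ cmod v <= M / (M + eta) * cmod u.
  move=> uM h; split.
    by apply/eqP => u0; move: h; rewrite u0 cmod0; have := cmod_ge0 v; lra.
  rewrite mulrAC ler_pdivlMr//.
  have : eta * cmod u <= eta * (M + eta) by rewrite ler_wpM2l ?(ltW eta0)//; lra.
  have : cmod v * (M + eta) <= (cmod u - eta) * (M + eta) by rewrite ler_wpM2r ?(ltW Me)//; lra.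
  by lra.
(* This is slightly larger than the natural ratio [1 - eta / M], and it lies in [[0, 1)] without
   comparing [eta] with [M]. *)
exists (M / (M + eta)); split.
- by rewrite divr_ge0 ?ltW.
- by rewrite ltr_pdivrMr// mul1r ltrDl.
- move=> t t0; have [aM wM] := hM t t0; rewrite Dfun_wcoef//; split => h.
    exact: key.
  by apply: key => //; rewrite -lerN2 opprB.
Qed.

Lemma cond_of_ends (eta : R) : 0 < eta ->
  ((forall e, eventually_at e (fun t => eta <= D t)) ->
     (forall t, 0 < t -> a t != 0) -> cond1 p a b alpha) /\
  ((forall e, eventually_at e (fun t => D t <= - eta)) ->
     (forall t, 0 < t -> b t != 0) -> cond2 p a b alpha).
Proof.
move=> eta0; split => ends nz.
  split; last split.
  - apply: (@lower_bound_of_ends _ (fun t => cmod (a t)) eta) => //.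
    + by move=> t t0; exact/ccont_cmod/Cb_ccont/t0/SO_Cb.
    + by move=> t t0; exact/cmod_gt0/nz.
    + move=> e; apply: eventually_atS (ends e) => t t0 /le_trans; apply.
      by rewrite Dfun_wcoef// gerBl cmod_ge0.
  - by apply/limf_einf_gt0P; exists eta => //; exact/(eventually_atP false)/ends.
  - by apply/limf_einf_gt0P; exists eta => //; exact/(eventually_atP true)/ends.
have [e0 [e1 [e00 _ de]]] := SOS_d_bound Salpha.
have E0 : 0 < e0 `^ (- p^-1) by exact: powR_gt0.
split; last split.
(* Near the ends the product of [cmod (b t)] and the power of the derivative is at least [eta];
   dividing by an upper bound for that power bounds [cmod (b t)] from below. *)
- apply: (@lower_bound_of_ends _ (fun t => cmod (b t)) (eta / e0 `^ (- p^-1))).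
  + by move=> t t0; exact/ccont_cmod/Cb_ccont/t0/SO_Cb.
  + by move=> t t0; exact/cmod_gt0/nz.
  + by rewrite divr_gt0.
  + move=> e; apply: eventually_atS (ends e) => t t0; rewrite /Dfun => h.
    rewrite ler_pdivrMr//.
    apply: le_trans (ler_wpM2l (cmod_ge0 _) (SOS_weight_le Salpha e00 de p_gt1 t0)).
    by move: h (cmod_ge0 (a t)); lra.
- by apply/limf_esup_lt0P; exists eta => //; exact/(eventually_atP false)/ends.
- by apply/limf_esup_lt0P; exists eta => //; exact/(eventually_atP true)/ends.
Qed.

Lemma invertible_cond : invertible_Lp p (Aop a b alpha) ->
  cond1 p a b alpha \/ cond2 p a b alpha.
Proof.
move=> inv; have [beta [b1 b2]] := SOS_inv Salpha.
have [e dir] : exists e : bool, forall t, 0 < t -> if e then t < alpha t else alpha t < t.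
  by have [h|h] := sign_of_shift (SOS_cont Salpha) (SOS_neq Salpha); [exists true|exists false].
have [eta eta0 away] : exists2 eta, 0 < eta &
    forall e, eventually_at e (fun t => eta <= `|D t|).
  have [x x0 hx] := Dfun_away_from_zero p_gt1 SOa SOb Salpha inv true.
  have [y y0 hy] := Dfun_away_from_zero p_gt1 SOa SOb Salpha inv false.
  exists (Num.min x y); first by rewrite lt_min x0.
  by case; [move: hx|move: hy]; apply: eventually_atS => t _ h; rewrite ge_min h ?orbT.
have [q [q0 q1 hq]] := Dfun_dominance eta0.
have [c1 c2] := cond_of_ends eta0.
have adom e' : eventually_at e' (fun t => eta <= D t) ->
    eventually_at e' (fun t => a t != 0 /\ cmod (w t) <= q * cmod (a t)).
  by apply: eventually_atS => t t0; exact: (hq t t0).1.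
have wdom e' : eventually_at e' (fun t => D t <= - eta) ->
    eventually_at e' (fun t => w t != 0 /\ cmod (a t) <= q * cmod (w t)).
  by apply: eventually_atS => t t0; exact: (hq t t0).2.
have both (P : R -> Prop) : eventually_at e P -> eventually_at (~~ e) P ->
    forall e', eventually_at e' P by case: (e) => ? ? [].
have sgn e' := eventually_at_sign (Dfun_cont Salpha SOa SOb) eta0 (away e').
have [h|h] := sgn e; have [h'|h'] := sgn (~~ e).
- left; apply: c1; first exact: both.
  exact: (a_neq0 p_gt1 SOa SOb Salpha inv b1 b2 dir q0 q1 (adom e h)).
- by case: (not_dom_inward p_gt1 SOa SOb Salpha inv b1 b2 dir q0 q1 (adom e h) (wdom _ h')).
- by case: (not_dom_outward p_gt1 SOa SOb Salpha inv b1 b2 dir q0 q1 (wdom e h) (adom _ h')).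
- right; apply: c2; first exact: both.
  move=> t t0; have := wcoef_neq0 p_gt1 SOa SOb Salpha inv b1 b2 dir q0 q1 (wdom _ h') t0.
  by apply: contra => /eqP bt0; rewrite /wcoef bt0 mul0r.
Qed.

End invertibility_criterion.

Theorem theorem1p1 (R : realType) (p : R) (a b : R -> R[i]) (alpha : R -> R) :
  1 < p -> SO a -> SO b -> SOS alpha ->
  (invertible_Lp p (Aop a b alpha) <-> cond1 p a b alpha \/ cond2 p a b alpha) /\
  (cond1 p a b alpha -> neumann_conv p (Aop a b alpha) (S1 a b alpha)) /\
  (cond2 p a b alpha ->
     forall beta : R -> R,
       (forall s, 0 < s -> 0 < beta s /\ alpha (beta s) = s) ->
       (forall t, 0 < t -> beta (alpha t) = t) ->
       neumann_conv p (Aop a b alpha) (S2 a b beta)).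
Proof.
move=> p1 SOa SOb Salpha; have Ca := SO_Cb SOa; have Cbb := SO_Cb SOb.
split; [split|split].
- exact: invertible_cond.
- case; first exact: cond1_invertible.
  have [beta [b1 b2]] := SOS_inv Salpha.
  exact: (cond2_invertible p1 Ca Cbb Salpha b1 b2).
- exact: cond1_neumann.
- by move=> h beta b1 b2; exact: (cond2_neumann p1 Ca Cbb Salpha b1 b2 h).
Qed.
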